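(* Let $F\colon\mathbb{R}^4\to\mathbb{R}^4$ be the diffeomorphism described in the context, where the constants $\lambda_*,\mu_*$ are sufficiently large (depending on the other constants). Then for every $r$ with $1\le r<\infty$ there exist sequences of diffeomorphisms $(F_n)_{n\ge1}$ and $(G_n)_{n\ge1}$ of $\mathbb{R}^4$, both converging to $F$ in the $C^r$-topology, such that the following hold for every $n$: (1) $F_n$ has a historic contracting wandering domain $D$. (2) $G_n$ has a contracting wandering domain such that, for every point $x$ of this domain, the sequence of empirical measures $\frac{1}{m+1}\sum_{i=0}^{m}\delta_{G_n^i(x)}$ $(m=1,2,3,\dots)$ converges, as $m\to\infty$, in the weak $*$-topology to the periodic measure supported on a saddle periodic orbit of $G_n$.
   Context: **The map $F$.** Coordinates on $\mathbb{R}^4$ are $(x_u,y_u,x_s,y_s)$. Fix constants with $$1<\lambda_{cu1}<2<\lambda_{cu0}<\lambda_u,\qquad 0<\lambda_s<\lambda_{cs0}<\tfrac12<\lambda_{cs1}<1,$$ $$\lambda_{cu0}^{-1}+\lambda_{cu1}^{-1}>1,\quad \lambda_{cs0}+\lambda_{cs1}>1,\quad \lambda_{cs0}\lambda_{cs1}\lambda_u^2<1,\quad 1<\lambda_{cs0}\lambda_u^2<2.$$ Put $a_u=\frac{1}{1-\lambda_u^{-1}}$ and $a_s=\frac{1}{1-\lambda_s}$. Define $$V_0=[-1-2\lambda_{cu0}^{-1},-1+2\lambda_{cu0}^{-1}]\times[-1-2\lambda_u^{-1},-1+2\lambda_u^{-1}],$$ $$V_1=[1-3\lambda_{cu1}^{-1},1+\lambda_{cu1}^{-1}]\times[1-2\lambda_u^{-1},1+2\lambda_u^{-1}],$$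 $\mathbb{V}_i=V_i\times[-2,2]^2$ for $i=0,1$, and $\mathbb{V}_*=[-\delta,\delta]^2\times[-2,2]^2$, where $0<\delta<1-2\lambda_u^{-1}$ is a constant. Let $a_1>\frac{1}{2(1-2\lambda_u^{-1})}$, $0<a_2<\frac{2\lambda_s}{\delta}$, and let $\lambda_*,\mu_*>0$ be sufficiently large constants satisfying $$\lambda_*^{-1}<\frac{-2+\lambda_{cu0}^{-1}+\lambda_{cu1}^{-1}a_u}{4},\qquad \mu_*^{-1}<\frac{-2+\lambda_{cs1}+\lambda_{cs1}a_s}{4}.$$ (In particular the constants are such that the right-hand sides are positive. ''Sufficiently large'' means: there is $M>0$ depending only on the other constants such that the assertion holds whenever $\lambda_*,\mu_*>M$ and these inequalities hold.) Let $F\colon\mathbb{R}^4\to\mathbb{R}^4$ be a $C^\infty$ diffeomorphism such that $$F(x_u,y_u,x_s,y_s)=\begin{cases}(\lambda_{cu0}(x_u+1),\ \lambda_u(y_u+1),\ \lambda_sx_s-1,\ \lambda_{cs0}y_s-1)&\text{on }\mathbb{V}_0,\\(\lambda_{cu1}(x_u-1)+1,\ \lambda_u(y_u-1),\ \lambda_sx_s+1,\ \lambda_{cs1}(y_s-1)+1)&\text{on }\mathbb{V}_1,\\(-x_u^2+\lambda_*^{-1}(x_s-a_s)+1,\ -a_1y_u^2+\mu_*(y_s-1)+a_u,\ a_2x_u,\ y_u)&\text{on }\mathbb{V}_*.\end{cases}$$ The choice of the extension to $\mathbb{R}^4$ is otherwise arbitrary. **Definitions.** Let $f$ be a diffeomorphism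 of $M=\mathbb{R}^4$. A point $x$ has historic behavior if the sequence $\frac1{m+1}\sum_{i=0}^m\delta_{f^i(x)}$ of probability measures does not converge as $m\to\infty$ in the weak $*$-topology ($\delta_y$ is the Dirac measure at $y$). A non-trivial wandering domain for $f$ is a (nonempty) connected open set $D\subset M$ such that (1) $f^i(D)\cap f^j(D)=\emptyset$ for all integers $i,j\ge0$ with $i\ne j$, and (2) the union $\bigcup_{x\in D}\omega(x,f)$ of $\omega$-limit sets is not equal to a single periodic orbit. A contracting wandering domain is a non-trivial wandering domain $D$ such that the diameter of $f^n(D)$ converges to $0$ as $n\to\infty$. A wandering domain $D$ is historic if every $x\in D$ has historic behavior. The periodic measure on a periodic orbit is the uniform probability measure on that orbit. The $C^r$-topology is the one given by the supremum norm of derivatives up to order $r$. *)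

(* Defs.v *)
From HB Require Import structures.
From mathcomp Require Import all_boot all_order all_algebra.
From mathcomp Require Import all_classical all_reals all_analysis.
From mathcomp.real_closed Require Import complex.
Set Implicit Arguments.
Unset Strict Implicit.
Unset Printing Implicit Defensive.
Import Order.TTheory GRing.Theory Num.Theory.
Import numFieldNormedType.Exports.
Local Open Scope classical_set_scope.
Local Open Scope ring_scope.

(* R^4 carries the sup norm of 'rV[R]_4, and points have the coordinates
   (x_u, y_u, x_s, y_s) in this order. *)
Definition pt4 (R : realType) (xu yu xs ys : R) : 'rV[R]_4 :=
  \row_(j < 4) [:: xu; yu; xs; ys]`_j.

Definition a_u (R : realType) (lu : R) : R := 1 / (1 - lu^-1).

Definition a_s (R : realType) (ls : R) : R := 1 / (1 - ls).

Definition V0 (R : realType) (lcu0 lu : R) : set (R * R) :=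
  `[-1 - 2 * lcu0^-1, -1 + 2 * lcu0^-1] `*` `[-1 - 2 * lu^-1, -1 + 2 * lu^-1].

Definition V1 (R : realType) (lcu1 lu : R) : set (R * R) :=
  `[1 - 3 * lcu1^-1, 1 + lcu1^-1] `*` `[1 - 2 * lu^-1, 1 + 2 * lu^-1].

Definition Vstar (R : realType) (delta : R) : set (R * R) :=
  `[- delta, delta] `*` `[- delta, delta].

Definition box2 (R : realType) : set (R * R) := `[-2, 2] `*` `[-2, 2].

(* The partial derivative of f along the multi-index listed by s. *)
Fixpoint partials (R : realType) (s : seq 'I_4) (f : 'rV[R]_4 -> 'rV[R]_4)
    : 'rV[R]_4 -> 'rV[R]_4 :=
  if s is i :: s' then fun x => 'D_(delta_mx 0 i) (partials s' f) x else f.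

(* The derivability clause is needed because 'D_v is a total operator. *)
Definition Ck (R : realType) (k : nat) (f : 'rV[R]_4 -> 'rV[R]_4) : Prop :=
  (forall s, (size s < k)%N ->
     forall i x, derivable (partials s f) x (delta_mx 0 i)) /\
  (forall s, (size s <= k)%N -> continuous (partials s f)).

Definition Ck_diffeo (R : realType) (k : nat) (f : 'rV[R]_4 -> 'rV[R]_4)
    : Prop :=
  Ck k f /\ exists g, [/\ cancel f g, cancel g f & Ck k g].

Definition Cinfty_diffeo (R : realType) (f : 'rV[R]_4 -> 'rV[R]_4) : Prop :=
  (forall k, Ck k f) /\
  exists g, [/\ cancel f g, cancel g f & forall k, Ck k g].

(* The distance may be +oo, since R^4 is not compact. *)
Definition Ck_dist (R : realType) (k : nat) (f g : 'rV[R]_4 -> 'rV[R]_4)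
    : \bar R :=
  ereal_sup [set e | exists s x, (size s <= k)%N /\
                     e = `|partials s f x - partials s g x|%:E].

Definition Ck_cvg (R : realType) (k : nat)
    (F_ : nat -> 'rV[R]_4 -> 'rV[R]_4) (F : 'rV[R]_4 -> 'rV[R]_4) : Prop :=
  Ck_dist k (F_ n) F @[n --> \oo] --> 0%:E.

Definition borel4 (R : realType) := g_sigma_algebraType (@open 'rV[R]_4).

Definition weak_cvg (R : realType)
    (mu_ : nat -> {measure set (borel4 R) -> \bar R})
    (mu : {measure set (borel4 R) -> \bar R}) : Prop :=
  forall phi : 'rV[R]_4 -> R,
    continuous phi -> (exists M, forall x, `|phi x| <= M) ->
    (\int[mu_ m]_x (phi x)%:E)%E @[m --> \oo] --> (\int[mu]_x (phi x)%:E)%E.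

Definition orbit_measure (R : realType) (f : 'rV[R]_4 -> 'rV[R]_4)
    (x : 'rV[R]_4) (n : nat) : {measure set (borel4 R) -> \bar R} :=
  mscale (n%:R^-1)%:nng (msum (fun i => \d_(iter i f x : borel4 R)) n).

Definition empirical (R : realType) (f : 'rV[R]_4 -> 'rV[R]_4)
    (x : 'rV[R]_4) (m : nat) : {measure set (borel4 R) -> \bar R} :=
  orbit_measure f x m.+1.

Definition historic_behavior (R : realType) (f : 'rV[R]_4 -> 'rV[R]_4)
    (x : 'rV[R]_4) : Prop :=
  ~ exists mu : probability (borel4 R) R, weak_cvg (empirical f x) mu.

Definition least_period (R : realType) (f : 'rV[R]_4 -> 'rV[R]_4)
    (p : 'rV[R]_4) (k : nat) : Prop :=
  [/\ (0 < k)%N, iter k f p = p &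
      forall j, (0 < j < k)%N -> iter j f p <> p].

Definition forward_orbit (R : realType) (f : 'rV[R]_4 -> 'rV[R]_4)
    (p : 'rV[R]_4) : set 'rV[R]_4 :=
  range (fun i => iter i f p).

Definition is_periodic_orbit (R : realType) (f : 'rV[R]_4 -> 'rV[R]_4)
    (O : set 'rV[R]_4) : Prop :=
  exists p k, least_period f p k /\ O = forward_orbit f p.

(* The uniform probability measure on the orbit of p, if k is the least
   period of p. *)
Definition periodic_measure (R : realType) (f : 'rV[R]_4 -> 'rV[R]_4)
    (p : 'rV[R]_4) (k : nat) : {measure set (borel4 R) -> \bar R} :=
  orbit_measure f p k.

(* Hyperbolic with both stable and unstable directions: no complex eigenvalue
   of the derivative of f^k at p has modulus 1, and both sides of the unit
   circle are visited. *)
Definition saddle (R : realType) (f : 'rV[R]_4 -> 'rV[R]_4)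
    (p : 'rV[R]_4) (k : nat) : Prop :=
  let A := map_mx (real_complex R) (jacobian (iter k f) p) in
  [/\ least_period f p k,
      forall z : R[i], eigenvalue A z -> `|z| != 1,
      exists2 z : R[i], eigenvalue A z & `|z| < 1 &
      exists2 z : R[i], eigenvalue A z & 1 < `|z|].

Definition omega_limit (R : realType) (f : 'rV[R]_4 -> 'rV[R]_4)
    (x : 'rV[R]_4) : set 'rV[R]_4 :=
  cluster (iter n f x @[n --> \oo]).

Definition wandering_domain (R : realType) (f : 'rV[R]_4 -> 'rV[R]_4)
    (D : set 'rV[R]_4) : Prop :=
  [/\ [/\ D !=set0, open D & connected D],
      forall i j : nat, i <> j -> iter i f @` D `&` iter j f @` D = set0 &
      ~ is_periodic_orbit f (\bigcup_(x in D) omega_limit f x)].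

Definition diam (R : realType) (A : set 'rV[R]_4) : \bar R :=
  ereal_sup [set e | exists x y, [/\ A x, A y & e = `|x - y|%:E]].

Definition contracting_wandering_domain (R : realType)
    (f : 'rV[R]_4 -> 'rV[R]_4) (D : set 'rV[R]_4) : Prop :=
  wandering_domain f D /\
  diam (iter n f @` D) @[n --> \oo] --> 0%:E.

(* Main.v *)
(* Points that follow a word in {0,1} through the strips V_0 (letter 0) and V_1
   (letter 1) have unstable coordinates coded by the future word and stable
   coordinates coded by the past one. Suppose a block w_k leads from (X_k, Y_k, 0, 0)
   to a point (0, 0, S_k, T_k) of V_*. The quadratic map on V_* nearly sends it to
   (X_{k+1}, Y_{k+1}, 0, 0) provided that X_{k+1} and S_k, as well as Y_{k+1} and T_k,
   satisfy an affine equation; as the coding maps of V_0 and V_1 overlap in the centre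
   directions, the prefix of w_{k+1} and the suffix of w_k can be chosen digit by
   digit so that the error is exponentially small in k, in O(k) digits. Keeping the
   points S_k apart at a fixed exponential rate, the errors are removed by bumps in
   the coordinate x_s, which add up to a C^r-small perturbation F o Psi of F. The
   middle parts of the words are free: with |w_k| of order k^2, a box around the
   starting point contracts under the return maps, since the quadratic map squares the
   unstable size and lambda_cs0 lambda_cs1 lambda_u^2 < 1 controls the stable one, and
   it is a wandering domain. Filling the middle parts with 0's makes the empirical
   measures converge to the Dirac measure at the fixed point in V_0; using 0's and
   (01)'s alternately over longer and longer periods, the time averages of a function
   of y_u diverge. *)
From HB Require Import structures.
Require Import Defs.
From mathcomp Require Import all_boot all_order all_algebra.
From mathcomp Require Import all_classical all_reals all_analysis.
From mathcomp.real_closed Require Import complex.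
From mathcomp Require Import measurable_realfun ring lra zify.
Set Implicit Arguments.
Unset Strict Implicit.
Unset Printing Implicit Defensive.
Import Order.TTheory GRing.Theory Num.Theory.
Import numFieldNormedType.Exports.
Local Open Scope classical_set_scope.
Local Open Scope ring_scope.

(** * Differentiability *)

(** Choosing digits one by one requires a starting pair of words for which the unresolved tails
    already matter little. A periodic solution provides it: with the words [1^m (0 1^j)^oo] on both
    sides the two affine equations hold exactly for slightly different constants. The discrepancy,
    the same for all k, is removed by one wide plateau around [a_s], so the bumps carry only the
    decaying errors. A marker letter placed after a number of loops that depends on k separates the
    points S_k at the rate [ls ^+ (j.+1 * k)]. A bump of that width loses about [r.+1] powers of the
    width in the C^r norm; hence the separation has to be fixed before the precision of the
    matching. The matching reaches any exponential rate, at the cost of a larger constant in O(k),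
    which the length k^2 of the words absorbs. Since r is finite, clamped polynomials are smooth
    enough as cutoffs. The perturbed map is a diffeomorphism because it is F after two shears of
    small slope, each inverted by solving a monotone equation on a line. *)

Section RowVectors.
Context {R : realType} {n : nat}.
Implicit Types x y h : 'rV[R]_n.

Lemma norm_coord_le x i : `|x 0 i| <= `|x|.
Proof.
rewrite [leRHS]/Num.Def.normr/= mx_normrE.
exact: (le_bigmax _ (fun p : 'I_1 * 'I_n => `|x p.1 p.2|) (0, i)).
Qed.

Lemma norm_row_le x (e : R) : 0 <= e -> (forall i, `|x 0 i| <= e) -> `|x| <= e.
Proof.
move=> e0 xe; rewrite [leLHS]/Num.Def.normr/= mx_normrE.
by apply: bigmax_le => // -[i j] _ /=; rewrite (ord1 i).
Qed.

Lemma norm_delta_mx (i : 'I_n) : `|delta_mx 0 i : 'rV[R]_n| <= 1.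
Proof.
apply: norm_row_le => // j; rewrite mxE eqxx /=.
by case: (j == i); rewrite ?normr1 ?normr0.
Qed.

Lemma row_sum_delta_coord x : x = \sum_i x 0 i *: delta_mx 0 i.
Proof. by rewrite {1}[x]row_sum_delta. Qed.

End RowVectors.

Section Differentiability.
Context {R : realType}.

Lemma is_diff_eps (V W : normedModType R) (f : V -> W) (L : {linear V -> W})
    (x : V) :
  continuous L ->
  (forall e, 0 < e -> \forall h \near (0 : V),
     `|f (h + x) - (f x + L h)| <= e * `|h|) ->
  is_diff x f L.
Proof.
move=> Lc fL.
have fE : f \o shift x = cst (f x) + L +o_ 0 id.
  by apply/eqaddoP => e e0; exact: fL.
have dL := diff_unique Lc fE.
apply: DiffDef => //; apply/diff_locallyP; rewrite dL; split => //.
Qed.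

Lemma line_derive (V : normedModType R) (f : V -> R) (x v : V) (t : R) :
  derivable f (t *: v + x) v ->
  is_derive t 1 (fun s : R => f (s *: v + x)) ('D_v f (t *: v + x)).
Proof.
move=> df.
have E : (fun h : R => h^-1 *: ((f \o shift (t *: v + x)) (h *: v) -
    f (t *: v + x))) = (fun h : R => h^-1 *: (((fun s => f (s *: v + x)) \o
    shift t) h%:A - f (t *: v + x))).
  by apply/funext => s /=; rewrite [s%:A]mulr1 scalerDl addrA.
move: df; rewrite /derivable E => df; apply: DeriveDef; first exact: df.
by rewrite /derive E.
Qed.

Lemma line_MVT (V : normedModType R) (f : V -> R) (x v : V) (t : R) :
  (forall y, derivable f y v) ->
  exists2 s, `|s| <= `|t| & f (t *: v + x) - f x = t * 'D_v f (s *: v + x).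
Proof.
move=> df; pose g (s : R) : R := f (s *: v + x); pose dg (s : R) : R := 'D_v f (s *: v + x).
have dgE (s : R) : is_derive s 1 g (dg s) by exact: line_derive.
have gc (A : set R) : {within A, continuous g}.
  apply: continuous_subspaceT => s.
  apply: differentiable_continuous; apply/derivable1_diffP.
  by have [] := dgE s.
have g0 : g 0 = f x by rewrite /g scale0r add0r.
rewrite -g0 -/(g t).
have [t0|t0] := leP 0 t.
  have [s] := MVT_segment t0 (fun s _ => dgE s) (gc _).
  rewrite in_itv /= => /andP[s0 st] ->; exists s; last by rewrite subr0 mulrC.
  by rewrite !ger0_norm.
have [s] := MVT_segment (ltW t0) (fun s _ => dgE s) (gc _).
rewrite in_itv /= => /andP[s0 st] E; exists s.
  by rewrite !ler0_norm ?lerN2// ltW.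
by rewrite -opprB E sub0r mulrN opprK mulrC.
Qed.

Lemma derive_bound_lipschitz (V : normedModType R) (f : V -> R) (v : V) (C : R) :
  (forall y, derivable f y v) -> (forall y, `|'D_v f y| <= C) ->
  forall x t, `|f (t *: v + x) - f x| <= C * `|t|.
Proof.
move=> df dC x t; have [s _ ->] := line_MVT x t df.
by rewrite normrM mulrC ler_wpM2r.
Qed.

Section LinearForm.
Context {n : nat} (c : 'I_n -> R).

Definition linform (h : 'rV[R]_n) : R := \sum_i h 0 i * c i.

Lemma linform_is_linear : linear linform.
Proof.
move=> a u v; rewrite /linform scaler_sumr -big_split /=.
by apply: eq_bigr => i _; rewrite !mxE mulrDl scalerAl.
Qed.

HB.instance Definition _ :=
  GRing.isLinear.Build R 'rV[R]_n R _ linform linform_is_linear.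

Lemma linform_le h : `|linform h| <= (\sum_i `|c i|) * `|h|.
Proof.
rewrite (le_trans (ler_norm_sum _ _ _))// mulr_suml ler_sum// => i _.
by rewrite normrM mulrC ler_wpM2l// norm_coord_le.
Qed.

Lemma linform_continuous : continuous linform.
Proof.
apply/linear_bounded_continuous.
apply/linear_boundedP; near=> M => x.
rewrite (le_trans (linform_le _))// ler_wpM2r//.
Unshelve. all: by end_near. Qed.

End LinearForm.

(** Go from [x] to [h + x] along the coordinate axes and apply the mean value theorem on each leg;
    all intermediate points lie within [|h|] of [x], where the partial derivatives are close to
    their values at [x]. *)
Lemma C1_is_diff n (f : 'rV[R]_n -> R) (x : 'rV[R]_n) :
  (forall i y, derivable f y (delta_mx 0 i)) ->
  (forall i, {for x, continuous (fun y => 'D_(delta_mx 0 i) f y)}) ->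
  is_diff x f (linform (fun i => 'D_(delta_mx 0 i) f x)).
Proof.
move=> df dc; apply: is_diff_eps; first exact: linform_continuous.
move=> e e0.
pose P k (h : 'rV[R]_n) : 'rV[R]_n :=
  \row_j (if (j < k)%N then h 0 j + x 0 j else x 0 j).
have P0 h : P 0%N h = x by apply/rowP => j; rewrite !mxE.
have Pn h : P n h = h + x by apply/rowP => j; rewrite !mxE ltn_ord.
have PS h (k : 'I_n) : P k.+1 h = h 0 k *: delta_mx 0 k + P k h.
  apply/rowP => j; rewrite !mxE eqxx /= ltnS leq_eqVlt.
  have [jk|jk] /= := eqVneq (j : nat) k.
    by rewrite (ord_inj jk) eqxx ltnn mulr1.
  have -> : (j == k) = false by apply/negbTE; apply: contra jk => /eqP ->.
  by rewrite mulr0 add0r.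
(* [n.+1] rather than [n], since [n] may be [0]. *)
have e' : 0 < e / n.+1%:R by rewrite divr_gt0.
pose near_x i (h : 'rV[R]_n) := forall y : 'rV[R]_n, `|y| <= `|h| ->
  `|'D_(delta_mx 0 i) f (y + x) - 'D_(delta_mx 0 i) f x| <= e / n.+1%:R.
have near_all : \forall h \near nbhs (0 : 'rV[R]_n), forall i, near_x i h.
  apply: (@filter_forall _ _ near_x (nbhs (0 : 'rV[R]_n))) => i.
  have /cvgrPdist_le /(_ _ e') := dc i.
  move=> /nbhs_ballP [r /= r0 rP]; apply/nbhs_ballP; exists r => //= h.
  rewrite -ball_normE /= sub0r normrN => hr y yh.
  rewrite distrC; apply: rP; rewrite -ball_normE /= opprD addrCA subrr addr0 normrN.
  exact: le_lt_trans hr.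
near=> h.
have -> : f (h + x) - (f x + linform (fun i => 'D_(delta_mx 0 i) f x) h) =
  \sum_(k < n) (f (P k.+1 h) - f (P k h) - h 0 k * 'D_(delta_mx 0 k) f x).
  rewrite big_split /= sumrN opprD addrA; congr (_ - _).
  rewrite -(big_mkord xpredT (fun k => f (P k.+1 h) - f (P k h))).
  by rewrite telescope_sumr// Pn P0.
apply: (@le_trans _ _ (\sum_(k < n) e / n.+1%:R * `|h|)).
  rewrite (le_trans (ler_norm_sum _ _ _))// ler_sum// => k _.
  rewrite PS; have [s sh ->] := line_MVT (P k h) (h 0 k) (df k).
  rewrite -mulrBr normrM mulrC ler_pM// ?norm_coord_le//.
  have -> : s *: delta_mx 0 k + P k h = (s *: delta_mx 0 k + P k h - x) + x.
    by rewrite subrK.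
  move: (k) (s) (sh); near: h; apply: filterS near_all => h hP k s sh.
  apply: hP; apply: norm_row_le => // j; rewrite !mxE eqxx /=.
  have [->|jk] := eqVneq j k.
    by rewrite ltnn mulr1 addrK (le_trans sh)// norm_coord_le.
  rewrite mulr0 add0r; case: ifP => _; first by rewrite addrK norm_coord_le.
  by rewrite subrr normr0.
rewrite sumr_const card_ord -[leLHS]mulr_natl mulrA ler_wpM2r//.
rewrite mulrCA ler_piMr ?(ltW e0)// ler_pdivrMr ?ltr0n// mul1r ler_nat //.
Unshelve. all: by end_near. Qed.

End Differentiability.

(** * Maps of class C^k *)

Section Smooth.
Context {R : realType} {n : nat}.
Local Notation E := 'rV[R]_n.
Implicit Types f g h : E -> R.

(** Total differentiability is asked at each order, so that sums, products and compositions follow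
    by induction on [k]; [pder_smooth] recovers it from continuous partial derivatives. *)
Fixpoint smooth (k : nat) (f : E -> R) : Prop :=
  if k is k'.+1 then
    (forall x, differentiable f x) /\
    forall i : 'I_n, smooth k' (fun x => 'D_(delta_mx 0 i) f x)
  else continuous f.

Lemma smooth_continuous k f : smooth k f -> continuous f.
Proof.
by case: k => [|k] //= [fd _] x; apply: differentiable_continuous.
Qed.

Lemma smoothW k f : smooth k.+1 f -> smooth k f.
Proof.
elim: k f => [f|k IH f [fd fD]]; first exact: (@smooth_continuous 1).
by split => // i; apply: IH; exact: fD.
Qed.

Lemma smooth_le j k f : (j <= k)%N -> smooth k f -> smooth j f.
Proof.
move=> jk; rewrite -(subnK jk); elim: (k - j)%N => // m IH fS.
exact/IH/smoothW.
Qed.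

Lemma smooth_cst k (c : R) : smooth k (fun=> c).
Proof.
elim: k c => [|k IH] c /=; first exact: cst_continuous.
split=> [x|i]; first exact: differentiable_cst.
rewrite (_ : (fun x : E => _) = fun=> (0 : R)); first by have := IH 0.
by apply/funext => x; rewrite derive_cst.
Qed.

Lemma smooth_coord k (i : 'I_n) : smooth k (fun x : E => x 0 i).
Proof.
case: k => [|k] /=; first by move=> x; apply: coord_continuous.
split=> [x|j]; first exact: differentiable_coord.
rewrite (_ : (fun x : E => _) = fun=> (delta_mx 0 j : E) 0 i).
  exact: smooth_cst.
apply/funext => x; rewrite deriveE; last exact: differentiable_coord.
have @L : {linear E -> R}.
  by exists (fun N : E => N 0 i); do 2![eexists]; do ?[constructor];
     rewrite ?mxE// => ? *; rewrite ?mxE//; move=> ?; rewrite !mxE.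
have -> : (fun y : E => y 0 i) = L by [].
by rewrite diff_lin//; exact: coord_continuous.
Qed.

Lemma smooth_add k f g : smooth k f -> smooth k g -> smooth k (fun x => f x + g x).
Proof.
elim: k f g => [f g fc gc x|k IH f g [fd fD] [gd gD]] /=.
  exact: (continuousD (fc x) (gc x)).
split=> [x|i]; first exact: differentiableD.
rewrite (_ : (fun x : E => _) = fun x => 'D_(delta_mx 0 i) f x +
  'D_(delta_mx 0 i) g x); first exact: (IH _ _ (fD i) (gD i)).
by apply/funext => x; rewrite -deriveD//; exact: diff_derivable.
Qed.

Lemma smooth_mul k f g : smooth k f -> smooth k g -> smooth k (fun x => f x * g x).
Proof.
elim: k f g => [f g fc gc x|k IH f g fS gS] /=.
  exact: (continuousM (fc x) (gc x)).
have [fd fD] := fS; have [gd gD] := gS.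
split=> [x|i]; first exact: differentiableM.
rewrite (_ : (fun x : E => _) = fun x => f x * 'D_(delta_mx 0 i) g x +
  g x * 'D_(delta_mx 0 i) f x).
  apply: smooth_add; first exact: (IH _ _ (smoothW fS) (gD i)).
  exact: (IH _ _ (smoothW gS) (fD i)).
by apply/funext => x; rewrite -deriveM//; exact: diff_derivable.
Qed.

Lemma smooth_opp k f : smooth k f -> smooth k (fun x => - f x).
Proof.
move=> fS; rewrite (_ : (fun x => - f x) = fun x => -1 * f x).
  by apply: smooth_mul => //; exact: smooth_cst.
by apply/funext => x; rewrite mulN1r.
Qed.

Lemma smooth_sum k m (f : 'I_m -> E -> R) :
  (forall j, smooth k (f j)) -> smooth k (fun x => \sum_j f j x).
Proof.
elim: m f => [|m IH] f fS.
  rewrite (_ : (fun x => _) = fun=> 0); first exact: smooth_cst.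
  by apply/funext => x; rewrite big_ord0.
rewrite (_ : (fun x => _) = fun x => \sum_(j < m) f (widen_ord (leqnSn m) j) x
  + f ord_max x); last by apply/funext => x; rewrite big_ord_recr.
by apply: smooth_add => //; apply: IH.
Qed.

(** The outer function comes with its successive derivatives [D], the form in which the cutoffs are
    built. *)
Lemma smooth_comp1 k (D : nat -> R -> R) f :
  (forall j (t : R), (j <= k)%N -> is_derive t 1 (D j) (D j.+1 t)) ->
  smooth k f -> smooth k (fun x => D 0 (f x)).
Proof.
elim: k D f => [|k IH] D f dD.
  move=> fc x; apply: (@continuous_comp _ _ _ f (D 0)); first exact: fc.
  apply: differentiable_continuous; apply/derivable1_diffP.
  by have [] := dD 0 (f x) isT.
move=> fS; have [fd fD] := fS.
have Dd t : differentiable (D 0) t.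
  by apply/derivable1_diffP; have [] := dD 0 t isT.
split=> [x|i]; first exact: differentiable_comp.
rewrite (_ : (fun x : E => _) =
    fun x => D 1 (f x) * 'D_(delta_mx 0 i) f x); last first.
  apply/funext => x.
  rewrite deriveE; last exact: differentiable_comp.
  rewrite diff_comp//=.
  have -> : 'd f x (delta_mx 0 i) = 'D_(delta_mx 0 i) f x *: (1 : R).
    by rewrite -deriveE// [RHS]mulr1.
  rewrite linearZ /= [LHS]mulrC -deriveE//.
  by have [_ ->] := dD 0 (f x) isT.
apply: (smooth_mul _ (fD i)).
apply: (IH (fun j => D j.+1)); last exact: smoothW.
by move=> j t jk; exact: dD.
Qed.

Lemma smooth_inv k f : (forall x, f x != 0) -> smooth k f ->
  smooth k (fun x => (f x)^-1).
Proof.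
move=> f0; elim: k => [|k IH] fS.
  by move=> x; apply: continuousV => //; exact: fS.
have [fd fD] := fS; have IHk := IH (smoothW fS).
split=> [x|i]; first exact: differentiableV.
rewrite (_ : (fun x : E => _) = fun x => - ('D_(delta_mx 0 i) f x *
  ((f x)^-1 * (f x)^-1))).
  apply: smooth_opp; apply: (smooth_mul (fD i)); exact: smooth_mul.
apply/funext => x.
rewrite deriveE; last exact: differentiableV.
rewrite diffV//= -deriveE//.
by rewrite -[LHS]/(_ * _) expr2 invfM mulNr mulrC.
Qed.

End Smooth.

Lemma continuous_row (R : realType) (T : topologicalType) m
    (P : T -> 'rV[R]_m) (x : T) :
  (forall j, {for x, continuous (fun y => P y 0 j)}) -> {for x, continuous P}.
Proof.
move=> Pc; apply/cvgrPdist_le => /= e e0.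
have dist : \forall y \near nbhs x, forall i, `|P x 0 i - P y 0 i| <= e.
  apply: (@filter_forall _ _ (fun i y => `|P x 0 i - P y 0 i| <= e) (nbhs x)).
  by move=> i; have /cvgrPdist_le /(_ _ e0) := Pc i.
apply: filterS dist => y yP.
by apply: norm_row_le => [|i]; [exact: ltW|rewrite !mxE].
Qed.

Section SmoothComposition.
Context {R : realType} {n m : nat}.

Lemma differentiable_row (P : 'rV[R]_n -> 'rV[R]_m) x :
  (forall j, differentiable (fun y => P y 0 j) x) -> differentiable P x.
Proof.
move=> dP.
have -> : P = \sum_j (fun y => P y 0 j *: (delta_mx 0 j : 'rV[R]_m)).
  apply/funext => y; rewrite fct_sumE; exact: row_sum_delta_coord.
apply: differentiable_sum => j.
exact: differentiableZl.
Qed.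

Lemma derive_comp_row (f : 'rV[R]_m -> R) (P : 'rV[R]_n -> 'rV[R]_m) x v :
  (forall j, differentiable (fun y => P y 0 j) x) ->
  differentiable f (P x) ->
  'D_v (f \o P) x = \sum_j 'D_(delta_mx 0 j) f (P x) * 'D_v (fun y => P y 0 j) x.
Proof.
move=> dP df; have dP' := differentiable_row dP.
rewrite deriveE; last exact: differentiable_comp.
rewrite diff_comp//=.
have -> : 'd P x v = \sum_j 'D_v (fun y => P y 0 j) x *: delta_mx 0 j.
  rewrite -deriveE// derive_mx; last exact: diff_derivable.
  rewrite [LHS]row_sum_delta_coord; apply: eq_bigr => j _.
  by rewrite mxE.
rewrite linear_sum; apply: eq_bigr => j _.
by rewrite linearZ /= [LHS]mulrC -deriveE.
Qed.

Lemma smooth_comp k (f : 'rV[R]_m -> R) (P : 'rV[R]_n -> 'rV[R]_m) :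
  smooth k f -> (forall j, smooth k (fun y => P y 0 j)) ->
  smooth k (fun x => f (P x)).
Proof.
elim: k f => [|k IH] f fS PS.
  move=> x; apply: (@continuous_comp _ _ _ P f); last exact: fS.
  by apply: continuous_row => j; exact: PS.
have [fd fD] := fS.
have dPj x j : differentiable (fun y => P y 0 j) x by have [] := PS j.
split=> [x|i]; first exact: (differentiable_comp (differentiable_row (dPj x))).
rewrite (_ : (fun x => _) = fun x => \sum_j 'D_(delta_mx 0 j) f (P x) *
    'D_(delta_mx 0 i) (fun y => P y 0 j) x).
  apply: smooth_sum => j; apply: smooth_mul; last by have [_ ] := PS j; apply.
  by apply: (IH _ (fD j)) => j'; exact: smoothW.
by apply/funext => x; rewrite derive_comp_row.
Qed.

End SmoothComposition.

Section PartialDerivatives.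
Context {R : realType} {n : nat}.
Local Notation E := 'rV[R]_n.

Definition pder (s : seq 'I_n) (g : E -> R) : E -> R :=
  foldr (fun i (h : E -> R) x => 'D_(delta_mx 0 i) h x) g s.

Lemma smooth_pder k s (g : E -> R) : smooth (size s + k) g -> smooth k (pder s g).
Proof.
elim: s k => // i s IH k; rewrite [size _]/= addSnnS => /IH [_]; exact.
Qed.

Lemma pder_smooth k (g : E -> R) :
  (forall s, (size s < k)%N ->
     forall i x, derivable (pder s g) x (delta_mx 0 i)) ->
  (forall s, (size s <= k)%N -> continuous (pder s g)) ->
  smooth k g.
Proof.
move=> gd gc.
suff main m s : (size s + m)%N = k -> smooth m (pder s g) by exact: (main k [::]).
elim: m s => [|m IH] s sk; first by apply: gc; rewrite -sk addn0.
split=> [x|i]; last by apply: (IH (i :: s)); rewrite -sk /= addnS.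
have sk' : (size s < k)%N by rewrite -sk; lia.
have [] // := @C1_is_diff _ _ (pder s g) x; first by move=> i y; exact: gd.
by move=> i; apply: (gc (i :: s)).
Qed.

End PartialDerivatives.

Section CkSmooth.
Context {R : realType}.
Local Notation E := 'rV[R]_4.
Implicit Types f g : E -> E.

Lemma partials_pder k f s : Ck k f -> (size s <= k)%N ->
  forall x j, partials s f x 0 j = pder s (fun y => f y 0 j) x.
Proof.
move=> [fd fc]; elim: s => //= i s IH sk x j.
rewrite derive_mx ?mxE; last exact: fd.
by rewrite (_ : (fun y => partials s f y 0 j) = pder s (fun y => f y 0 j))//;
  apply/funext => y; rewrite IH// ltnW.
Qed.

(** With its converse [smooth_Ck], this replaces [Ck], which speaks of derivatives of a
    vector-valued map, by [smooth] for each coordinate. *)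
Lemma Ck_smooth k f : Ck k f -> forall j, smooth k (fun y => f y 0 j).
Proof.
move=> fCk j; have [fd fc] := fCk.
have E s : (size s <= k)%N -> pder s (fun y => f y 0 j) =
    fun x => partials s f x 0 j.
  by move=> sk; apply/funext => x; rewrite (partials_pder fCk).
apply: pder_smooth => s sk.
  move=> i x; rewrite (E _ (ltnW sk)).
  by have /derivable_mxP := fd s sk i x; exact.
rewrite E// => x.
exact: (continuous_comp (fc s sk x) (@coord_continuous _ _ _ 0 j _)).
Qed.

Lemma smooth_partials k f s :
  (forall j, smooth k (fun y => f y 0 j)) -> (size s <= k)%N ->
  forall x, partials s f x = \row_j pder s (fun y => f y 0 j) x.
Proof.
move=> fS; elim: s => [_ x|i s IH sk x] /=; first by apply/rowP => j; rewrite mxE.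
have pE : partials s f = fun x => \row_j pder s (fun y => f y 0 j) x.
  by apply/funext => y; rewrite IH// ltnW.
have dE : derivable (partials s f) x (delta_mx 0 i).
  apply/derivable_mxP => i' j; rewrite (ord1 i') pE.
  have -> : (fun y => (\row_j0 pder s (fun y => f y 0 j0) y : E) 0 j) =
    pder s (fun y => f y 0 j) by apply/funext => y; rewrite mxE.
  apply: diff_derivable.
  have /smooth_pder [] // : smooth (size s + 1) (fun y => f y 0 j).
  by apply: smooth_le (fS j); rewrite addn1.
rewrite (derive_mx dE); apply/rowP => j; rewrite !mxE.
by rewrite (_ : (fun y => partials s f y 0 j) = pder s (fun y => f y 0 j))//;
  apply/funext => y; rewrite pE mxE.
Qed.

Lemma smooth_Ck k f : (forall j, smooth k (fun y => f y 0 j)) -> Ck k f.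
Proof.
move=> fS; split=> s sk; last first.
  rewrite (_ : partials s f = fun x => \row_j pder s (fun y => f y 0 j) x); last first.
    by apply/funext => x; rewrite (smooth_partials fS).
  move=> x; apply: continuous_row => j.
  rewrite (_ : (fun y => _) = pder s (fun y => f y 0 j)); last first.
    by apply/funext => y; rewrite mxE.
  apply: (@smooth_continuous _ _ 0); apply: smooth_pder; rewrite addn0.
  exact: smooth_le (fS j).
move=> i x; apply/derivable_mxP => i' j; rewrite (ord1 i').
rewrite (_ : (fun y => _) = pder s (fun y => f y 0 j)); last first.
  by apply/funext => y; rewrite (smooth_partials fS) ?mxE// ltnW.
apply: diff_derivable.
have /smooth_pder [] // : smooth (size s + 1) (fun y => f y 0 j).
by apply: smooth_le (fS j); rewrite addn1.
Qed.

End CkSmooth.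

(** * Inverse of a shear along one coordinate axis *)

Section ShiftInverse.
Context {R : realType} {n : nat}.
Local Notation E := 'rV[R]_n.
Variables (h : E -> R) (i : 'I_n).
Local Notation e := (delta_mx 0 i : E).
Hypothesis hd : forall x, differentiable h x.
Hypothesis hle : forall x, `|'D_e h x| <= 2^-1.

Let h_lip x t : `|h (t *: e + x) - h x| <= 2^-1 * `|t|.
Proof.
by apply: derive_bound_lipschitz => // y; apply: diff_derivable.
Qed.

(** The shear [y |-> h y *: e + y] maps [t *: e + z] to [z] exactly when [t] solves this equation.
    As [h] has slope at most [1/2] along [e], the left side is nonpositive at [-2 |h z|] and
    nonnegative at [2 |h z|]. *)
Lemma shift_solution z : exists t, t + h (t *: e + z) = 0.
Proof.
pose phi t : R := t + h (t *: e + z); pose B := 2 * `|h z|.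
have B0 : 0 <= B by rewrite mulr_ge0.
have phic : continuous phi.
  move=> t; apply: differentiable_continuous; apply/derivable1_diffP.
  apply: (@derivableD _ _ _ id (fun t : R => h (t *: e + z))) => //.
  by have [] := @line_derive R _ h z e t (diff_derivable (hd _)).
have [] := @IVT R phi (- B) B 0.
- by rewrite (le_trans _ B0)// oppr_le0.
- exact: continuous_subspaceT.
- have := h_lip z B; have := h_lip z (- B); rewrite normrN (ger0_norm B0).
  rewrite /phi !ler_norml => /andP[h1 h2] /andP[h3 h4].
  rewrite ge_min le_max; apply/andP; split; apply/orP; [left|right];
    have := ler_norm (h z); have := lerNnormlW (lexx `|h z|);
    move: h1 h2 h3 h4; rewrite /B; lra.
- by move=> t _ t0; exists t.
Qed.

Lemma shift_unique z s t : s + h (s *: e + z) = 0 -> t + h (t *: e + z) = 0 -> s = t.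
Proof.
move=> s0 t0; have := h_lip (t *: e + z) (s - t).
rewrite addrA -scalerDl subrK.
have -> : h (s *: e + z) - h (t *: e + z) = - (s - t) by lra.
rewrite normrN => st; apply/eqP; rewrite -subr_eq0 -normr_le0; lra.
Qed.

Variable u : E -> R.
Hypothesis uE : forall z, u z + h (u z *: e + z) = 0.

Let u_incr z v : `|u (v + z) - u z| <=
  2 * `|h (v + (u z *: e + z)) - h (u z *: e + z)|.
Proof.
set t := u (v + z) - u z; set w := u z *: e + z.
have E1 : u (v + z) *: e + (v + z) = t *: e + (v + w).
  by rewrite /t /w scalerBl [v + (_ + _)]addrCA [RHS]addrA subrK.
have tE : t = - (h (t *: e + (v + w)) - h w).
  have := uE (v + z); have := uE z; rewrite E1 -/w /t; lra.
have := h_lip (v + w) t.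
have := ler_normD (h (t *: e + (v + w)) - h (v + w)) (h (v + w) - h w).
rewrite subrKA -[X in X <= _]normrN -tE; lra.
Qed.

(** Implicit differentiation of [uE], with a denominator of at least [1/2]. A crude estimate first
    bounds the increment of [u] by a multiple of [|v|], which turns the error term of [h] into
    [o(|v|)]. *)
Lemma shift_is_diff z : is_diff z u (linform (fun j =>
  - ('D_(delta_mx 0 j) h (u z *: e + z) / (1 + 'D_e h (u z *: e + z))))).
Proof.
set w := u z *: e + z; set c := 'D_e h w.
pose a j := 'D_(delta_mx 0 j) h w; pose A := \sum_j `|a j|.
have A0 : 0 <= A by apply: sumr_ge0.
have c2 : 2^-1 <= 1 + c by have := hle w; rewrite -/c ler_norml; lra.
have dhE v : 'd h w v = linform a v.
  rewrite [X in 'd h w X]row_sum_delta_coord linear_sum; apply: eq_bigr => j _.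
  by rewrite linearZ /= -deriveE.
have dh eps : 0 < eps ->
    \forall y \near (0 : E), `|h (y + w) - h w - linform a y| <= eps * `|y|.
  move=> e0; have /diff_locally /eqaddoP /(_ _ e0) := hd w.
  apply: filterS => y hy; rewrite -dhE -addrA -opprD; exact: hy.
apply: is_diff_eps; first exact: linform_continuous.
(* The increment [t] of [u] will satisfy [|t| <= 2 * (1 + A) * |v|], so that
   [|t *: e + v| <= K * |v|]. *)
move=> eps eps0; pose K := 3 + 2 * A.
have K0 : 0 < K by rewrite /K; lra.
have eps1 : 0 < eps / (2 * K) by rewrite divr_gt0// mulr_gt0.
have [r /= r0 rP] := (nbhs_ballP _ _).1 (dh _ eps1).
have [r' /= r'0 r'P] := (nbhs_ballP _ _).1 (dh _ ltr01).
have r1 : 0 < Num.min r' (r / K) by rewrite lt_min r'0 divr_gt0.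
apply/nbhs_ballP; exists (Num.min r' (r / K)) => //= v.
rewrite -ball_normE /= sub0r normrN lt_min => /andP[vr' vr].
set t := u (v + z) - u z.
have tv : `|t| <= 2 * (1 + A) * `|v|.
  have /r'P : ball (0 : E) r' v by rewrite -ball_normE /= sub0r normrN.
  have := u_incr z v; rewrite -/t -/w => h1 h2.
  have := ler_normD (h (v + w) - h w - linform a v) (linform a v).
  have := linform_le a v; rewrite subrK -/A; lra.
pose y := t *: e + v.
have yv : `|y| <= K * `|v|.
  rewrite /y (le_trans (ler_normD _ _))// normrZ.
  have := norm_delta_mx (R := R) i => ei.
  have : `|t| * `|e| <= `|t| by rewrite ler_piMr.
  rewrite /K; lra.
have /rP : ball (0 : E) r y.
  rewrite -ball_normE /= sub0r normrN (le_lt_trans yv)//.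
  by rewrite mulrC -ltr_pdivlMr.
have -> : y + w = u (v + z) *: e + (v + z).
  by rewrite /y -addrA /t /w scalerBl [v + (_ + _)]addrCA [LHS]addrA subrK.
have -> : h (u (v + z) *: e + (v + z)) - h w = - t.
  by have := uE (v + z); have := uE z; rewrite -/w /t; lra.
have -> : linform a y = t * c + linform a v.
  rewrite /y linearD linearZ /=; congr (_ * _ + _).
  rewrite /linform (bigD1 i)//= big1 => [|j ji].
    by rewrite mxE !eqxx mul1r addr0.
  by rewrite mxE (negbTE ji) andbF mul0r.
move=> hy; have c0 : 0 < 1 + c by lra.
rewrite opprD addrA -/t.
have -> : linform (fun j => - (a j / (1 + c))) v = - (linform a v / (1 + c)).
  rewrite /linform mulr_suml -sumrN; apply: eq_bigr => j _.
  by rewrite mulrN mulrA.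
have -> : t - - (linform a v / (1 + c)) = - (- t - (t * c + linform a v)) / (1 + c).
  by field; rewrite gt_eqF.
rewrite normrM normrN normfV (gtr0_norm c0) ler_pdivrMr//.
apply: (le_trans hy); apply: (@le_trans _ _ (eps / (2 * K) * (K * `|v|))).
  by rewrite ler_wpM2l// ltW.
have -> : eps / (2 * K) * (K * `|v|) = eps * `|v| * 2^-1.
  by field; rewrite gt_eqF.
by rewrite ler_wpM2l// mulr_ge0// ltW.
Qed.

(** Bootstrap: the partial derivatives of [u] are expressed by those of [h] at [u z *: e + z], hence
    are as smooth as [u] is already known to be, and [u] gains one order. *)
Lemma shift_smooth k : smooth k h -> smooth k u.
Proof.
move=> hS.
suff main m : (m <= k)%N -> smooth m u by exact: main.
have ud z : differentiable u z by have [] := shift_is_diff z.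
elim: m => [_ z|m IH mk]; first exact: differentiable_continuous.
have [_ hD] := smooth_le mk hS; have uS := IH (ltnW mk).
have PS j : smooth m (fun z => (u z *: e + z) 0 j).
  rewrite (_ : (fun z => _) = fun z => u z * e 0 j + z 0 j); last first.
    by apply/funext => z; rewrite !mxE.
  apply: smooth_add; last exact: smooth_coord.
  by apply: smooth_mul => //; exact: smooth_cst.
split=> // j.
rewrite (_ : (fun z => _) = fun z => - ('D_(delta_mx 0 j) h (u z *: e + z) *
    (1 + 'D_e h (u z *: e + z))^-1)); last first.
  apply/funext => z; have := shift_is_diff z => uz.
  rewrite deriveE// diff_val /linform (bigD1 j)//= big1 => [|j' jj'].
    by rewrite mxE !eqxx mul1r addr0.
  by rewrite mxE (negbTE jj') andbF mul0r.
apply: smooth_opp; apply: smooth_mul.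
  exact: (smooth_comp (hD j) PS).
apply: smooth_inv => [z|].
  by apply: lt0r_neq0; have := hle (u z *: e + z); rewrite ler_norml; lra.
apply: smooth_add; first exact: smooth_cst.
exact: (smooth_comp (hD i) PS).
Qed.

End ShiftInverse.

Lemma shift_inverse (R : realType) n k (h : 'rV[R]_n -> R) (i : 'I_n) :
  smooth k.+1 h -> (forall x, `|'D_(delta_mx 0 i) h x| <= 2^-1) ->
  exists2 u : 'rV[R]_n -> R, smooth k.+1 u &
    cancel (fun z => h z *: delta_mx 0 i + z) (fun z => u z *: delta_mx 0 i + z) /\
    cancel (fun z => u z *: delta_mx 0 i + z) (fun z => h z *: delta_mx 0 i + z).
Proof.
move=> hS hle; have [hd _] := hS.
have [u uE] := choice (shift_solution hd hle).
exists u; first exact: (shift_smooth hd hle uE hS).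
split=> z.
  set z' := h z *: _ + z.
  have -> : u z' = - h z.
    apply: (shift_unique hd hle (uE z')).
    by rewrite scaleNr addKr addNr.
  by rewrite scaleNr addKr.
by rewrite addrA -scalerDl addrC [h _ + _]addrC uE scale0r addr0.
Qed.

(** * Bump functions *)

Section Jets.
Context {R : realType}.

Lemma is_derive_epsP (f : R -> R) (t d : R) :
  is_derive t 1 f d <->
  forall e, 0 < e -> \forall h \near (0 : R), `|f (h + t) - f t - h * d| <= e * `|h|.
Proof.
split=> [[df <-] e e0|H].
  have /cvgrPdist_le /(_ _ e0) :
      (h^-1 *: ((f \o shift t) (h *: (1 : R)) - f t) : R) @[h --> 0^'] --> 'D_1 f t.
    exact: df.
  rewrite near_withinE; apply: filterS => h hP.
  have [->|h0] := eqVneq h 0.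
    by rewrite add0r subrr mul0r subr0 normr0 mulr0.
  have := hP h0; rewrite /= [h *: _]mulr1 -[h^-1 *: _]/(h^-1 * _) => hP'.
  have -> : f (h + t) - f t - h * 'D_1 f t =
      - h * ('D_1 f t - h^-1 * (f (h + t) - f t)) by field.
  by rewrite normrM normrN mulrC ler_wpM2r.
have cv : (h^-1 *: ((f \o shift t) (h *: (1 : R)) - f t) : R) @[h --> 0^'] --> d.
  apply/cvgrPdist_le => e e0; rewrite near_withinE.
  have := H _ e0; apply: filterS => h hP h0.
  rewrite /= [h *: _]mulr1 distrC -[h^-1 *: _]/(h^-1 * _).
  have -> : h^-1 * (f (h + t) - f t) - d = h^-1 * (f (h + t) - f t - h * d).
    by field; exact: h0.
  by rewrite normrM normfV ler_pdivrMl ?normr_gt0// [leRHS]mulrC.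
by apply: DeriveDef; [exact: (cvgP d)|exact: cvg_lim].
Qed.

(* [D j] is the [j]-th derivative of [D 0], and all of these up to order [r.+1]
   are bounded by [C]. *)
Definition jet (r : nat) (D : nat -> R -> R) (C : R) : Prop :=
  (forall j (t : R), (j <= r)%N -> is_derive t 1 (D j) (D j.+1 t)) /\
  (forall j t, (j <= r.+1)%N -> `|D j t| <= C).

Lemma jet_lipschitz r D C : jet r D C -> forall j s t, (j <= r)%N ->
  `|D j s - D j t| <= C * `|s - t|.
Proof.
move=> [dD bD] j s t jr.
have := @derive_bound_lipschitz R _ (D j) 1 C _ _ t (s - t).
rewrite [(s - t)%:A]mulr1 subrK; apply => y.
  by have [] := dD j y jr.
by have [_ ->] := dD j y jr; exact: bD.
Qed.

Lemma jet_ge0 r D C : jet r D C -> 0 <= C.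
Proof. by move=> [_ /(_ 0%N 0 isT)]; apply: le_trans. Qed.

Lemma jet_le r D C C' : C <= C' -> jet r D C -> jet r D C'.
Proof. by move=> CC' [dD bD]; split => // j t /bD/le_trans; apply. Qed.

Lemma jet_cst r (c : R) : jet r (fun j _ => if j == 0%N then c else 0) `|c|.
Proof.
split=> [j t _|j t _]; last by case: ifP => // _; rewrite normr0.
exact: is_derive_cst.
Qed.

Lemma jetD r D1 D2 C1 C2 : jet r D1 C1 -> jet r D2 C2 ->
  jet r (fun j t => D1 j t + D2 j t) (C1 + C2).
Proof.
move=> [d1 b1] [d2 b2]; split=> [j t jr|j t jr].
  by have ? := d1 j t jr; have ? := d2 j t jr; exact: is_deriveD.
by rewrite (le_trans (ler_normD _ _))// lerD// ?b1// b2.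
Qed.

Lemma jetZ r D C (a : R) : jet r D C -> jet r (fun j t => a * D j t) (`|a| * C).
Proof.
move=> [dD bD]; split=> [j t jr|j t jr].
  by have ? := dD j t jr; exact: is_deriveZ.
by rewrite normrM ler_wpM2l// bD.
Qed.

Lemma jet_affine r D C (a b A : R) : (forall j, (j <= r.+1)%N -> `|a| ^+ j <= A) ->
  jet r D C -> jet r (fun j t => a ^+ j * D j (a * t + b)) (A * C).
Proof.
move=> aA [dD bD]; split=> [j t jr|j t jr]; last first.
  by rewrite normrM normrX ler_pM// ?exprn_ge0// ?aA ?bD.
have ? := dD j (a * t + b) jr.
have ? : is_derive t 1 (fun s : R => a * s + b) a.
  apply: is_derive_eq; by rewrite addr0 [_%:A]mulr1.
have h : is_derive t 1 (fun s : R => D j (a * s + b)) (D j.+1 (a * t + b) * a).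
  by apply: (@is_derive1_comp R (D j) (fun s => a * s + b)).
suff -> : a ^+ j.+1 * D j.+1 (a * t + b) = a ^+ j *: (D j.+1 (a * t + b) * a).
  exact: is_deriveZ.
by rewrite [RHS]mulrC -mulrA -exprS mulrC.
Qed.

Section Series.
Variables (r : nat) (D : nat -> nat -> R -> R) (c : nat -> R) (C : R).
Hypothesis jD : forall k, jet r (D k) (c k).
Hypothesis cC : forall N, series c N <= C.

Let c0 k : 0 <= c k.
Proof. exact: jet_ge0 (jD k). Qed.

Definition jet_sum j t : R := limn (series (fun k => D k j t)).

Let c_cvg : cvgn (series c).
Proof.
apply: nondecreasing_is_cvgn; last by exists C => _ [N _ <-]; exact: cC.
by apply/nondecreasing_seqP => N; rewrite /series /= big_nat_recr//= lerDl.
Qed.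

Let c_tail (e : R) : 0 < e -> exists N, forall M, (N <= M)%N ->
  \sum_(N <= k < M) c k <= e.
Proof.
move=> e0; have e2 : 0 < e / 2 by rewrite divr_gt0.
have /cvgrPdist_le /(_ _ e2) [N _ NP] : series c @ \oo --> limn (series c) by [].
exists N => M NM.
have -> : \sum_(N <= k < M) c k = series c M - series c N.
  by rewrite /series /= [X in _ = X - _](@big_cat_nat _ _ _ N)//= addrAC subrr add0r.
have := NP M NM; have := NP N (leqnn N); rewrite !ler_norml /=; lra.
Qed.

Let term_cvg j t : (j <= r.+1)%N ->
  series (fun k => D k j t) @ \oo --> jet_sum j t.
Proof.
move=> jr; apply: normed_cvg; apply: series_le_cvg c_cvg => // k /=; last first.
  by have [_] := jD k; apply.
exact: normr_ge0.
Qed.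

Let tail_le (u : nat -> R) (l e : R) N : series u @ \oo --> l ->
  (forall M, (N <= M)%N -> \sum_(N <= k < M) `|u k| <= e) ->
  `|l - series u N| <= e.
Proof.
move=> ul ue; have uN : (series u M - series u N) @[M --> \oo] --> l - series u N.
  by apply: cvgB => //; exact: cvg_cst.
apply: (cvgr_to_le (cvg_norm uN)).
near=> M; have NM : (N <= M)%N by near: M; exact: nbhs_infty_ge.
rewrite /series /= [X in `|X - _|](@big_cat_nat _ _ _ N)//= addrAC subrr add0r.
exact: le_trans (ler_norm_sum _ _ _) (ue _ NM).
Unshelve. all: by end_near. Qed.

(** Termwise differentiation. Cut where the tail of [series c] is at most [e / 4]: Lipschitz bounds
    control the difference quotients of the remaining terms, and finitely many terms are left to
    differentiate. *)
Lemma jet_sum_jet : jet r jet_sum C.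
Proof.
split=> [j t jr|j t jr]; last first.
  have := @tail_le _ _ C 0%N (@term_cvg j t jr).
  rewrite [series _ 0]big_geq// subr0; apply => M _.
  rewrite (le_trans _ (cC M))// ler_sum// => k _.
  by have [_] := jD k; apply => //; exact: leqW.
apply/is_derive_epsP => e e0.
have e4 : 0 < e / 4 by rewrite divr_gt0.
have [N NP] := c_tail e4.
have dN : is_derive t 1 (fun s => series (fun k => D k j s) N)
    (series (fun k => D k j.+1 t) N).
  rewrite /series /= big_mkord.
  have -> : (fun s => \sum_(0 <= k < N) D k j s) = \sum_(k < N) D k j.
    by apply/funext => s; rewrite big_mkord fct_sumE.
  by apply: is_derive_sum => k; have [/(_ j t jr)] := jD k.
have /(is_derive_epsP _ _ _).1 /(_ _ e4) := dN.
apply: filterS => h hP.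
have h1 : `|(jet_sum j (h + t) - jet_sum j t) -
    (series (fun k => D k j (h + t)) N - series (fun k => D k j t) N)| <= e / 4 * `|h|.
  have sB M : series (fun k => D k j (h + t) - D k j t) M =
      series (fun k => D k j (h + t)) M - series (fun k => D k j t) M.
    by rewrite /series /= sumrB.
  rewrite -sB; apply: tail_le.
    rewrite (_ : series _ = fun M => series (fun k => D k j (h + t)) M -
      series (fun k => D k j t) M); last by apply/funext => M; rewrite sB.
    by apply: cvgB; apply: term_cvg; exact: leqW.
  move=> M NM; apply: (@le_trans _ _ (\sum_(N <= k < M) (c k * `|h|))).
    apply: ler_sum => k _; have := jet_lipschitz (jD k) (h + t) t jr.
    by rewrite addrK.
  by rewrite -mulr_suml ler_wpM2r// NP.
have h2 : `|jet_sum j.+1 t - series (fun k => D k j.+1 t) N| <= e / 4.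
  apply: tail_le; first exact: term_cvg.
  move=> M NM; apply: le_trans (NP M NM); apply: ler_sum => k _.
  by have [_] := jD k; apply => //; exact: leqW.
have h3 : `|h * (jet_sum j.+1 t - series (fun k => D k j.+1 t) N)| <= e / 4 * `|h|.
  by rewrite normrM mulrC ler_wpM2r.
move: h1 hP h3; rewrite !ler_norml.
have : 0 <= e * `|h| by rewrite mulr_ge0// ltW.
lra.
Qed.

Lemma jet_sum_single j t k0 : (j <= r.+1)%N ->
  (forall k, k != k0 -> D k j t = 0) -> jet_sum j t = D k0 j t.
Proof.
move=> jr Dk; apply/eqP; rewrite -subr_eq0 -normr_le0.
have -> : D k0 j t = series (fun k => D k j t) k0.+1.
  rewrite /series /= big_nat_recr//= big_nat big1 ?add0r// => k kk0.
  by rewrite Dk// ltn_eqF.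
apply: tail_le; first exact: term_cvg.
move=> M NM; rewrite big_nat big1// => k /andP[kM _].
by rewrite Dk ?normr0// gtn_eqF.
Qed.

End Series.

End Jets.

(** * Cutoff functions of class C^r made from polynomials *)

Section Plateau.
Context {R : realType}.

Definition clamp01 (t : R) : R := Num.max 0 (Num.min t 1).

Lemma clamp01_id t : 0 <= t <= 1 -> clamp01 t = t.
Proof. by move=> /andP[t0 t1]; rewrite /clamp01 min_l// max_r. Qed.

Lemma clamp01_0 t : t <= 0 -> clamp01 t = 0.
Proof. by move=> t0; rewrite /clamp01 max_l// ge_min t0. Qed.

Lemma clamp01_1 t : 1 <= t -> clamp01 t = 1.
Proof. by move=> t1; rewrite /clamp01 min_r// max_r. Qed.

Lemma clamp01_itv t : 0 <= clamp01 t <= 1.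
Proof.
have [t0|t0] := leP t 0; first by rewrite clamp01_0// lexx ler01.
have [t1|t1] := leP 1 t; first by rewrite clamp01_1// lexx ler01.
by rewrite clamp01_id ?(ltW t0) ?(ltW t1).
Qed.

Lemma is_derive_squeeze0 (f g : R -> R) (t : R) : is_derive t 1 g 0 ->
  (\forall h \near (0 : R), `|f (h + t) - f t| <= `|g (h + t) - g t|) ->
  is_derive t 1 f 0.
Proof.
move=> /is_derive_epsP gd fg; apply/is_derive_epsP => e e0.
apply: filterS2 (gd _ e0) fg => h.
by rewrite !mulr0 !subr0 => h1 h2; exact: le_trans h1.
Qed.

Lemma is_derive_clamp01 (P : {poly R}) (t : R) :
  P^`().[0] = 0 -> P^`().[1] = 0 ->
  is_derive t 1 (fun s => P.[clamp01 s]) P^`().[clamp01 t].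
Proof.
move=> P0 P1.
have near_lt (a : R) (A : R -> Prop) : 0 < a -> (forall h, `|h| < a -> A h) ->
    \forall h \near (0 : R), A h.
  move=> a0 hA; apply/nbhs_ballP; exists a => //= h.
  by rewrite -ball_normE /= sub0r normrN => /hA.
have [t0|t0|t0] := ltgtP t 0.
- rewrite clamp01_0 ?(ltW t0)// P0; apply: (is_derive_squeeze0 (g := cst 0)).
  apply: (@near_lt (- t)) => [|h]; first by rewrite oppr_gt0.
  rewrite ltr_norml => /andP[_ ht].
  by rewrite !clamp01_0 ?subrr//; lra.
- have [t1|t1|t1] := ltgtP t 1.
  + rewrite clamp01_id ?(ltW t0) ?(ltW t1)//.
    apply: (@near_eq_is_derive _ _ _ (horner P)).
    have e0 : 0 < Num.min t (1 - t) by rewrite lt_min t0 subr_gt0.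
    apply/nbhs_ballP; exists (Num.min t (1 - t)) => //= s.
    rewrite -ball_normE /= lt_min !ltr_norml => /andP[/andP[h1 h2] /andP[h3 h4]].
    rewrite clamp01_id//; apply/andP; split; lra.
  + rewrite clamp01_1 ?(ltW t1)// P1; apply: (is_derive_squeeze0 (g := cst 0)).
    apply: (@near_lt (t - 1)) => [|h]; first by rewrite subr_gt0.
    rewrite ltr_norml => /andP[ht _].
    by rewrite !clamp01_1 ?subrr//; lra.
  + rewrite t1 clamp01_id ?lexx ?ler01// P1.
    apply: (is_derive_squeeze0 (g := horner P)).
      by have := is_derive_poly P 1; rewrite P1.
    apply: (@near_lt 1) => // h; rewrite ltr_norml => /andP[h1 h2].
    rewrite (@clamp01_id 1) ?lexx ?ler01//.
    have [h0|h0] := leP h 0; first by rewrite clamp01_id//; apply/andP; split; lra.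
    by rewrite clamp01_1 ?subrr ?normr0//; lra.
- rewrite t0 clamp01_id ?lexx ?ler01// P0.
  apply: (is_derive_squeeze0 (g := horner P)).
    by have := is_derive_poly P 0; rewrite P0.
  apply: (@near_lt 1) => // h; rewrite ltr_norml => /andP[h1 h2].
  rewrite (@clamp01_id 0) ?lexx ?ler01//.
  have [h0|h0] := leP 0 h; first by rewrite clamp01_id//; apply/andP; split; lra.
  by rewrite clamp01_0 ?subrr ?normr0//; lra.
Qed.

Definition flat (a : nat) (c : R) (P : {poly R}) : Prop :=
  exists P1, P = ('X - c%:P) ^+ a * P1.

Lemma flat_deriv a c P : flat a.+1 c P -> flat a c P^`().
Proof.
move=> [P1 ->]; exists (a.+1%:R *: P1 + ('X - c%:P) * P1^`()).
rewrite derivM deriv_exp derivXsubC mul1r /= mulrDr exprSr mulrA; congr (_ + _).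
by rewrite -scaler_nat -scalerAl scalerAr.
Qed.

Lemma flat_root a c P : (0 < a)%N -> flat a c P -> P.[c] = 0.
Proof.
case: a => // a _ [P1 ->].
by rewrite hornerM horner_exp hornerXsubC subrr expr0n /= mul0r.
Qed.

Lemma flat_derivn a c P j : flat (j + a) c P -> flat a c P^`(j).
Proof.
by elim: j P => [|j IH] P //; rewrite derivSn => /flat_deriv; exact: IH.
Qed.

(** Rises from [0] to [1] on [[0, 1]], with derivative [m^2 X^(m-1) (1 - X^m)^(m-1)], which vanishes
    to order [m - 1] at both ends; clamping the argument then gives a step of any prescribed finite
    class. *)
Definition smoothstep_poly (m : nat) : {poly R} := 1 - (1 - 'X^m) ^+ m.

Lemma smoothstep_poly0 m : (0 < m)%N -> (smoothstep_poly m).[0] = 0.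
Proof.
case: m => // m _.
by rewrite /smoothstep_poly !hornerE ?hornerXn expr0n /= subr0 expr1n subrr.
Qed.

Lemma smoothstep_poly1 m : (0 < m)%N -> (smoothstep_poly m).[1] = 1.
Proof.
case: m => // m _.
by rewrite /smoothstep_poly !hornerE ?hornerXn expr1n subrr expr0n /= subr0.
Qed.

Lemma smoothstep_flat m : flat m 0 (smoothstep_poly m.+1)^`() /\
  flat m 1 (smoothstep_poly m.+1)^`().
Proof.
have E : (smoothstep_poly m.+1)^`() =
    (m.+1%:R * m.+1%:R) *: ((1 - 'X^(m.+1)) ^+ m * ('X ^+ m)).
  rewrite /smoothstep_poly derivB derivC sub0r deriv_exp derivB derivC sub0r derivXn /=.
  rewrite mulNr mulNrn opprK -scalerA !scaler_nat mulrnAl.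
  by rewrite [in RHS]mulrC.
split; rewrite E.
  exists ((m.+1%:R * m.+1%:R) *: (1 - 'X^(m.+1)) ^+ m).
  by rewrite subr0 scalerAl mulrC.
have /factor_theorem [q qE] : root (1 - 'X^(m.+1) : {poly R}) 1.
  by rewrite /root !hornerE ?hornerXn expr1n subrr.
exists ((m.+1%:R * m.+1%:R) *: (q ^+ m * 'X^m)).
by rewrite qE exprMn -scalerAr mulrA [X in _ *: (X * _)]mulrC.
Qed.

Lemma horner_clamp01_le (P : {poly R}) t :
  `|P.[clamp01 t]| <= \sum_(i < size P) `|P`_i|.
Proof.
have /andP[t0 t1] := clamp01_itv t.
rewrite horner_coef (le_trans (ler_norm_sum _ _ _))// ler_sum// => i _.
rewrite normrM ler_piMr// normrX (ger0_norm t0); exact: exprn_ile1.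
Qed.

Lemma smoothstep_jet r : exists C, jet r
  (fun j t => (smoothstep_poly r.+3)^`(j).[clamp01 t]) C.
Proof.
set Q := smoothstep_poly _; pose B j := \sum_(i < size Q^`(j)) `|Q^`(j)`_i|.
have B0 j : 0 <= B j by apply: sumr_ge0.
exists (\sum_(j < r.+2) B j); split=> [j t jr|j t jr].
  rewrite derivnS; apply: is_derive_clamp01; rewrite -derivnS derivSn.
    apply: (@flat_root 1) => //; apply: flat_derivn.
    have [[P1 QE] _] := smoothstep_flat r.+2.
    exists ('X^(r.+1 - j) * P1); rewrite subr0 mulrA -exprD.
    by rewrite QE subr0; congr ('X ^+ _ * _); lia.
  apply: (@flat_root 1) => //; apply: flat_derivn.
  have [_ [P1 QE]] := smoothstep_flat r.+2.
  exists (('X - 1) ^+ (r.+1 - j) * P1); rewrite mulrA -exprD.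
  by rewrite QE; congr (_ ^+ _ * _); lia.
rewrite (le_trans (horner_clamp01_le _ _))// (bigD1 (Ordinal (jr : (j < r.+2)%N)))//=.
by rewrite lerDl sumr_ge0.
Qed.

(** The cutoff is [s (t + 2) + s (2 - t) - 1], where [s] is the clamped step. *)
Lemma plateau_jet r : exists D : nat -> R -> R, exists2 C, jet r D C &
  (forall t, `|t| <= 1 -> D 0%N t = 1) /\ (forall t, 2 <= `|t| -> D 0%N t = 0).
Proof.
have [C jC] := smoothstep_jet r.
have p1 j : (j <= r.+1)%N -> `|1 : R| ^+ j <= 1 by rewrite normr1 expr1n.
have n1 j : (j <= r.+1)%N -> `|-1 : R| ^+ j <= 1 by rewrite normrN1 expr1n.
have j1 := jet_affine 2 p1 jC; have j2 := jet_affine 2 n1 jC.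
have j3 := jetD (jetD j1 j2) (jet_cst r (-1)).
eexists; eexists; first exact: j3.
split=> t; rewrite /= !expr0 !mul1r mulN1r.
  rewrite ler_norml => /andP[t1 t2].
  rewrite !clamp01_1 ?smoothstep_poly1//; lra.
rewrite ler_normr => /orP[] t2.
  rewrite (@clamp01_1 (t + 2)) ?smoothstep_poly1//; last by lra.
  rewrite clamp01_0 ?smoothstep_poly0//; lra.
rewrite (@clamp01_0 (t + 2)) ?smoothstep_poly0//; last by lra.
rewrite clamp01_1 ?smoothstep_poly1//; lra.
Qed.

End Plateau.

(** * Perturbations of diffeomorphisms *)

Notation i0 := (@Ordinal 4 0 isT).
Notation i1 := (@Ordinal 4 1 isT).
Notation i2 := (@Ordinal 4 2 isT).
Notation i3 := (@Ordinal 4 3 isT).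

Lemma ord4_ind (P : 'I_4 -> Prop) : P i0 -> P i1 -> P i2 -> P i3 -> forall j, P j.
Proof.
move=> p0 p1 p2 p3 [j jP].
case: j jP => [|[|[|[|//]]]] jP.
- by rewrite (_ : Ordinal jP = i0)//; exact: val_inj.
- by rewrite (_ : Ordinal jP = i1)//; exact: val_inj.
- by rewrite (_ : Ordinal jP = i2)//; exact: val_inj.
- by rewrite (_ : Ordinal jP = i3)//; exact: val_inj.
Qed.

Lemma big_ord4 (R : Type) (idx : R) (op : Monoid.law idx) (f : 'I_4 -> R) :
  \big[op/idx]_(j < 4) f j = op (op (op (f i0) (f i1)) (f i2)) (f i3).
Proof.
rewrite !big_ord_recr big_ord0 /= Monoid.mul1m.
by congr (op (op (op _ _) _) _); congr f; exact: val_inj.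
Qed.

Lemma pt4_eta (R : realType) (z : 'rV[R]_4) :
  z = pt4 (z 0 i0) (z 0 i1) (z 0 i2) (z 0 i3).
Proof. by apply/rowP; apply: ord4_ind; rewrite mxE. Qed.

Section TensorProducts.
Context {R : realType}.
Local Notation E := 'rV[R]_4.
Variables (r : nat) (D : 'I_4 -> nat -> R -> R) (C : 'I_4 -> R).
Hypothesis jD : forall i, jet r (D i) (C i).

(** [J] gives the order of derivation in each coordinate, so that every mixed partial derivative of
    a product of one-variable functions is again a [tensor]. *)
Definition tensor (J : 'I_4 -> nat) (z : E) : R := \prod_i D i (J i) (z 0 i).

Lemma tensor_bound J z : (forall i, (J i <= r.+1)%N) -> `|tensor J z| <= \prod_i C i.
Proof.
move=> Jr; rewrite /tensor normr_prod; apply: ler_prod => i _.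
by rewrite normr_ge0; have [_] := jD i; apply.
Qed.

Lemma tensor_smooth : smooth r (tensor (fun=> 0%N)).
Proof.
rewrite (_ : tensor _ = fun z => D i0 0 (z 0 i0) * D i1 0 (z 0 i1) *
  D i2 0 (z 0 i2) * D i3 0 (z 0 i3)); last first.
  by apply/funext => z; rewrite /tensor big_ord4.
have s i : smooth r (fun z : E => D i 0 (z 0 i)).
  apply: (smooth_comp1 (D := D i)); last exact: smooth_coord.
  by move=> j t jr; have [dD _] := jD i; exact: dD.
by do !apply: smooth_mul.
Qed.

Lemma tensor_pder s : (size s <= r)%N ->
  pder s (tensor (fun=> 0%N)) = tensor (fun i => count_mem i s).
Proof.
elim: s => // i s IH sr.
set J := fun i => count_mem i s; have Jr l : (J l <= r)%N.
  by rewrite (leq_trans (count_size _ _))// ltnW.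
have TS : smooth 1 (tensor J).
  rewrite -IH ?(ltnW sr)//; apply: smooth_pder.
  by apply: smooth_le tensor_smooth; rewrite addn1.
rewrite /= IH ?(ltnW sr)//; apply/funext => z.
have [Td _] := TS.
have h1 : is_derive (0 : R) 1 (fun s : R => tensor J (s *: delta_mx 0 i + z))
    ('D_(delta_mx 0 i) (tensor J) (0 *: delta_mx 0 i + z)).
  by apply: line_derive; apply: diff_derivable.
pose K := \prod_(l | l != i) D l (J l) (z 0 l).
have E1 : (fun s : R => tensor J (s *: delta_mx 0 i + z)) =
    fun s : R => K *: (D i (J i) (s + z 0 i) : R).
  apply/funext => t; rewrite /tensor (bigD1 i)//= mulrC -[RHS]/(_ * _).
  rewrite !mxE !eqxx mulr1; congr (_ * _); apply: eq_bigr => l li.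
  by rewrite !mxE (negbTE li) andbF mulr0 add0r.
have h2 : is_derive (0 : R) 1 (fun s : R => K *: (D i (J i) (s + z 0 i) : R))
    (K *: (D i (J i).+1 (z 0 i) : R)).
  apply: is_deriveZ.
  have ? : is_derive (0 + z 0 i) 1 (D i (J i)) (D i (J i).+1 (z 0 i)).
    by rewrite add0r; have [dD _] := jD i; exact: dD.
  have ? : is_derive (0 : R) 1 (fun s : R => s + z 0 i) 1.
    by apply: is_derive_eq; rewrite addr0.
  rewrite -[X in is_derive _ _ _ X]mulr1.
  exact: (@is_derive1_comp R (D i (J i)) (fun s => s + z 0 i)).
move: h1; rewrite E1 scale0r add0r => h1.
have := @derive_val _ _ _ _ _ _ _ h1; rewrite (@derive_val _ _ _ _ _ _ _ h2) => <-.
rewrite /tensor (bigD1 i)//= eqxx mulrC -[LHS]/(_ * _); congr (_ * _).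
by apply: eq_bigr => l li; rewrite eq_sym (negbTE li).
Qed.

Lemma tensor_pder_bound s z : (size s <= r)%N ->
  `|pder s (tensor (fun=> 0%N)) z| <= \prod_i C i.
Proof.
move=> sr; rewrite tensor_pder//; apply: tensor_bound => i.
by rewrite (leq_trans (count_size _ _))// leqW.
Qed.

End TensorProducts.

Section Perturbation.
Context {R : realType}.
Local Notation E := 'rV[R]_4.
Implicit Types (f g F G : E -> E) (h : 'I_4 -> E -> R).

Lemma pderD n k s (f g : 'rV[R]_n -> R) : smooth k f -> smooth k g -> (size s <= k)%N ->
  pder s (fun x => f x + g x) = fun x => pder s f x + pder s g x.
Proof.
move=> fS gS; elim: s => //= i s IH sk; apply/funext => x.
rewrite IH ?(ltnW sk)// -deriveD//; apply: diff_derivable.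
  by have [] // : smooth 1 (pder s f); apply: smooth_pder; apply: smooth_le fS; rewrite addn1.
by have [] // : smooth 1 (pder s g); apply: smooth_pder; apply: smooth_le gS; rewrite addn1.
Qed.

Definition perturb F h : E -> E := fun z => F z + \row_j h j z.

Lemma perturb_Ck r F h : Ck r F -> (forall j, smooth r (h j)) -> Ck r (perturb F h).
Proof.
move=> FC hS; apply: smooth_Ck => j.
rewrite (_ : (fun z => _) = fun z => F z 0 j + h j z).
  by apply: smooth_add => //; exact: Ck_smooth.
by apply/funext => z; rewrite !mxE.
Qed.

Lemma perturb_dist r F h e : Ck r F -> (forall j, smooth r (h j)) -> 0 <= e ->
  (forall j s z, (size s <= r)%N -> `|pder s (h j) z| <= e) ->
  (Ck_dist r (perturb F h) F <= e%:E)%E.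
Proof.
move=> FC hS e0 he; apply: ge_ereal_sup => _ [s [x [sr ->]]].
rewrite lee_fin; apply: norm_row_le => // j; rewrite !mxE.
have -> : partials s (perturb F h) x 0 j = pder s (fun z => F z 0 j + h j z) x.
  rewrite (partials_pder (perturb_Ck FC hS))//; congr (pder _ _ _).
  by apply/funext => z; rewrite !mxE.
rewrite (partials_pder FC)// (pderD (Ck_smooth FC j) (hS j) sr).
by rewrite addrC addKr he.
Qed.

Lemma shift_coords_smooth k (u : E -> R) i : smooth k u ->
  forall j, smooth k (fun z => (u z *: delta_mx 0 i + z : E) 0 j).
Proof.
move=> uS j; rewrite (_ : (fun z => _) = fun z => u z * (delta_mx 0 i : E) 0 j + z 0 j).
  apply: smooth_add; last exact: smooth_coord.
  by apply: smooth_mul => //; exact: smooth_cst.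
by apply/funext => z; rewrite !mxE.
Qed.

(** Once the perturbed map is written as [F] after two shears of slope at most [1/2], it is inverted
    by undoing [F] and then the shears one by one. *)
Lemma perturb_diffeo r F h (hA hB : E -> R) (iA iB : 'I_4) :
  (0 < r)%N -> Ck_diffeo r F -> (forall j, smooth r (h j)) ->
  smooth r hA -> smooth r hB ->
  (forall x, `|'D_(delta_mx 0 iA) hA x| <= 2^-1) ->
  (forall x, `|'D_(delta_mx 0 iB) hB x| <= 2^-1) ->
  (forall z, perturb F h z =
     let z' := hB z *: delta_mx 0 iB + z in F (hA z' *: delta_mx 0 iA + z')) ->
  Ck_diffeo r (perturb F h).
Proof.
case: r => // r _ [FC [G [FG GF GC]]] hS AS BS Ale Ble PE.
have [uA uAS [A1 A2]] := shift_inverse AS Ale.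
have [uB uBS [B1 B2]] := shift_inverse BS Ble.
split; first exact: perturb_Ck.
exists (fun z => let z1 := uA (G z) *: delta_mx 0 iA + G z in
                 uB z1 *: delta_mx 0 iB + z1); split.
- by move=> z; rewrite PE /= FG A1 B1.
- by move=> z; rewrite PE /= B2 A2 GF.
- apply: smooth_Ck => j /=.
  have s1 := shift_coords_smooth iB uBS j.
  have s2 l : smooth r.+1 (fun z => (uA (G z) *: delta_mx 0 iA + G z : E) 0 l).
    exact: (smooth_comp (shift_coords_smooth iA uAS l) (Ck_smooth GC)).
  exact: (smooth_comp s1 s2).
Qed.

End Perturbation.

(** * Perturbations supported near the fold *)

Section LocalPerturbation.
Context {R : realType}.
Local Notation E := 'rV[R]_4.

Lemma exprn_le_1D (a : R) j m : 0 <= a -> (j <= m)%N -> a ^+ j <= (1 + a) ^+ m.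
Proof.
move=> a0 jm; apply: (@le_trans _ _ ((1 + a) ^+ j)).
  by apply: lerXn2r; rewrite ?nnegrE//; lra.
by rewrite ler_weXn2l//; lra.
Qed.

(** The factor [(1 + s^-1) ^+ r.+1] is the price of a narrow cutoff; for bumps of shrinking width it
    has to be beaten by their heights. *)
Lemma plateau_at r : exists2 C : R, 0 <= C & forall c s : R, 0 < s ->
  exists D, [/\ jet r D ((1 + s^-1) ^+ r.+1 * C),
    forall t, `|t - c| <= s -> D 0%N t = 1 &
    forall t, 2 * s <= `|t - c| -> D 0%N t = 0].
Proof.
have [D [C jC [D1 D0]]] := @plateau_jet R r; exists C.
  exact: jet_ge0 jC.
move=> c s s0; have si : 0 < s^-1 by rewrite invr_gt0.
have sp j : (j <= r.+1)%N -> `|s^-1| ^+ j <= (1 + s^-1) ^+ r.+1.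
  by move=> jr; rewrite gtr0_norm// exprn_le_1D// ltW.
have E t : s^-1 * t + - (c / s) = (t - c) / s by rewrite mulrBl mulrC.
eexists; split; first exact: (jet_affine (- (c / s)) sp jC).
  move=> t ts /=; rewrite expr0 mul1r E D1// normrM (gtr0_norm si).
  by rewrite ler_pdivrMr// mul1r.
move=> t ts /=; rewrite expr0 mul1r E D0// normrM (gtr0_norm si).
by rewrite ler_pdivlMr.
Qed.

Definition tensor4 (A B C D : nat -> R -> R) : E -> R :=
  tensor (fun i => nth A [:: A; B; C; D] i) (fun=> 0%N).

Lemma tensor4E A B C D z : tensor4 A B C D z =
  A 0%N (z 0 i0) * B 0%N (z 0 i1) * C 0%N (z 0 i2) * D 0%N (z 0 i3).
Proof. by rewrite /tensor4 /tensor big_ord4. Qed.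

Lemma tensor4_jets r A B C D cA cB cC cD : jet r A cA -> jet r B cB ->
  jet r C cC -> jet r D cD ->
  smooth r (tensor4 A B C D) /\
  forall s z, (size s <= r)%N ->
    `|pder s (tensor4 A B C D) z| <= cA * cB * cC * cD.
Proof.
move=> jA jB jC jD.
have jj (i : 'I_4) : jet r (nth A [:: A; B; C; D] i) (nth 0 [:: cA; cB; cC; cD] i).
  by move: i; apply: ord4_ind.
split; first exact: tensor_smooth jj.
move=> s z sr; have := tensor_pder_bound jj z sr.
by rewrite big_ord4.
Qed.

(** On V_* the map is affine in [x_s] and in [y_s], which enter only the first and only the second
    coordinate of the image. Adding [l * D1] and [m * D2] to these coordinates therefore amounts to
    moving [x_s] and [y_s] beforehand, by two shears. Cutoffs in [x_u], [y_u] and [y_s] localise the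
    change; in [x_s] the functions [D1] and [D2] already vanish away from [aS]. *)
Lemma local_perturbation (l m aS aU a1 a2 d w : R) r (F : E -> E) :
  0 < l -> 0 < m -> 0 < d -> 0 < w -> aS + 4 * w <= 2 -> - 2 <= aS - 4 * w ->
  8 * w <= 1 -> (0 < r)%N -> Ck_diffeo r F ->
  (forall xu yu xs ys, `|xu| <= d -> `|yu| <= d -> `|xs| <= 2 -> `|ys| <= 2 ->
     F (pt4 xu yu xs ys) =
     pt4 (- xu ^+ 2 + l * (xs - aS) + 1) (- a1 * yu ^+ 2 + m * (ys - 1) + aU)
         (a2 * xu) yu) ->
  forall e : R, 0 < e -> exists2 eta : R, 0 < eta & forall D1 D2,
    jet r D1 eta -> jet r D2 eta ->
    (forall t, 2 * w <= `|t - aS| -> D1 0%N t = 0 /\ D2 0%N t = 0) ->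
    exists f : E -> E, [/\ Ck_diffeo r f, (Ck_dist r f F <= e%:E)%E,
      forall z : E, d < `|z 0 i1| -> f z = F z &
      forall xu yu xs ys, `|xu| <= d / 2 -> `|yu| <= d / 2 -> `|xs| <= 2 ->
        `|ys - 1| <= w -> f (pt4 xu yu xs ys) =
        pt4 (- xu ^+ 2 + l * (xs + D1 0%N xs - aS) + 1)
            (- a1 * yu ^+ 2 + m * (ys + D2 0%N xs - 1) + aU) (a2 * xu) yu].
Proof.
move=> l0 m0 d0 w0 aw1 aw2 w8 r0 FC FE e e0.
have [Cp Cp0 pl] := @plateau_at r.
have d2 : 0 < d / 2 by rewrite divr_gt0.
have [U [jU U1 U0]] := pl 0 _ d2.
(* [B] equals [1] up to distance [3 * w]: room for the support of [C], of half-width [2 * w], moved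
   by at most [w]. *)
have w3 : 0 < 3 * w by rewrite mulr_gt0.
have [B [jB B1 B0]] := pl 1 _ w3.
have [C [jC C1 C0]] := pl 1 _ w0.
set cU := (X in jet r U X) in jU; set cB := (X in jet r B X) in jB.
set cC := (X in jet r C X) in jC.
have cU0 := jet_ge0 jU; have cB0 := jet_ge0 jB; have cC0 := jet_ge0 jC.
clearbody cU cB cC.
pose K := cU * cU * (cB + cC); have K0 : 0 <= K.
  by apply: mulr_ge0; [exact: mulr_ge0|exact: addr_ge0].
pose Z := (1 + l + m) * (1 + K).
have Z0 : 0 < Z by rewrite mulr_gt0//; move: l0 m0 K0; clear; lra.
(* The three bounds serve the distance to [F], the slopes of the shears and their displacements. *)
pose mu := Num.min e (Num.min 2^-1 w).
have mu0 : 0 < mu by rewrite !lt_min e0 w0 invr_gt0 ltr0n.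
exists (mu / Z); first exact: divr_gt0.
set eta := mu / Z => D1 D2 jD1 jD2 D0.
have eta0 : 0 <= eta by apply/ltW/divr_gt0.
have Ke0 : 0 <= K * eta by rewrite mulr_ge0.
have KE : K * eta * (1 + l + m) <= mu.
  have -> : K * eta * (1 + l + m) = mu * (K * (1 + l + m) / Z).
    by rewrite /eta; field; rewrite gt_eqF.
  by rewrite ler_piMr ?(ltW mu0)// ler_pdivrMr// mul1r /Z [leLHS]mulrC ler_pM2l//; move: l0 m0; clear; lra.
clearbody eta.
have [Ke1 Kel Kem] : [/\ K * eta <= mu, l * (K * eta) <= mu & m * (K * eta) <= mu].
  have : 0 <= l * (K * eta) by rewrite mulr_ge0// ltW.
  have : 0 <= m * (K * eta) by rewrite mulr_ge0// ltW.
  by move: KE; rewrite !mulrDr mulr1 [_ * l]mulrC [_ * m]mulrC; clear -Ke0; split; lra.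
have [mue mu2 muw] : [/\ mu <= e, mu <= 2^-1 & mu <= w].
  by rewrite /mu !ge_min !lexx !orbT.
clear KE Z0; clearbody mu.
pose h1 := tensor4 U U D1 B; pose h2 := tensor4 U U D2 C.
have [h1S h1b'] := tensor4_jets jU jU jD1 jB.
have [h2S h2b'] := tensor4_jets jU jU jD2 jC.
have h1b s (z : E) : (size s <= r)%N -> `|pder s h1 z| <= K * eta.
  move=> sr; apply: le_trans (h1b' s z sr) _; rewrite /K -!mulrA [eta * _]mulrC.
  by do 2 apply: ler_wpM2l => //; apply: ler_wpM2r => //; rewrite lerDl.
have h2b s (z : E) : (size s <= r)%N -> `|pder s h2 z| <= K * eta.
  move=> sr; apply: le_trans (h2b' s z sr) _; rewrite /K -!mulrA [eta * _]mulrC.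
  by do 2 apply: ler_wpM2l => //; apply: ler_wpM2r => //; rewrite lerDr.
clear h1b' h2b' cU0 cB0 cC0 K0 jU jB jC; clearbody K.
pose h (j : 'I_4) : E -> R :=
  nth (fun=> 0) [:: (fun z => l * h1 z); (fun z => m * h2 z)] j.
have pderZ (a : R) (g : E -> R) s (z : E) : smooth r g -> (size s <= r)%N ->
    pder s (fun z => a * g z) z = a * pder s g z.
  move=> gS; elim: s z => //= i s IH z sr.
  rewrite (_ : pder s _ = fun z => a *: (pder s g z : R)); last first.
    by apply/funext => y; rewrite IH// ltnW.
  rewrite deriveZ//; apply: diff_derivable.
  have [] // : smooth 1 (pder s g).
  by apply: smooth_pder; apply: smooth_le gS; rewrite addn1.
have pder0 s (z : E) : pder s (fun _ : E => 0 : R) z = 0 :> R.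
  elim: s z => //= i s IH z; rewrite (_ : pder s _ = cst 0) ?derive_cst//.
  by apply/funext.
have hS : forall j, smooth r (h j).
  apply: ord4_ind; rewrite /h /=; do ?exact: smooth_cst;
    by apply: smooth_mul => //; exact: smooth_cst.
have hb : forall j s z, (size s <= r)%N -> `|pder s (h j) z| <= e.
  apply: ord4_ind => s z sr; rewrite /h /= ?pder0 ?normr0 ?(ltW e0)//.
    rewrite pderZ// normrM (gtr0_norm l0) (le_trans _ (le_trans Kel mue))//.
    by rewrite ler_wpM2l// ?(ltW l0)// h1b.
  rewrite pderZ// normrM (gtr0_norm m0) (le_trans _ (le_trans Kem mue))//.
  by rewrite ler_wpM2l// ?(ltW m0)// h2b.
have h1w (z : E) : `|h1 z| <= w.
  by rewrite (le_trans (h1b [::] z _))// (le_trans Ke1).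
have h2w (z : E) : `|h2 z| <= w.
  by rewrite (le_trans (h2b [::] z _))// (le_trans Ke1).
have h1N (z : E) : h1 z != 0 -> [/\ `|z 0 i0| <= d, `|z 0 i1| <= d,
    `|z 0 i2 - aS| <= 2 * w & `|z 0 i3 - 1| <= 6 * w].
  rewrite /h1 tensor4E; rewrite !mulf_eq0 !negb_or -!andbA => /and4P[n0 n1 n2 n3].
  split; rewrite leNgt; apply/negP => lt.
  - by move: n0; rewrite U0 ?eqxx// subr0; clear -lt; lra.
  - by move: n1; rewrite U0 ?eqxx// subr0; clear -lt; lra.
  - by move: n2; have [-> _] := D0 _ (ltW lt); rewrite eqxx.
  - by move: n3; rewrite B0 ?eqxx//; clear -lt; lra.
have h2N (z : E) : h2 z != 0 -> [/\ `|z 0 i0| <= d, `|z 0 i1| <= d,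
    `|z 0 i2 - aS| <= 2 * w & `|z 0 i3 - 1| <= 2 * w].
  rewrite /h2 tensor4E; rewrite !mulf_eq0 !negb_or -!andbA => /and4P[n0 n1 n2 n3].
  split; rewrite leNgt; apply/negP => lt.
  - by move: n0; rewrite U0 ?eqxx// subr0; clear -lt; lra.
  - by move: n1; rewrite U0 ?eqxx// subr0; clear -lt; lra.
  - by move: n2; have [_ ->] := D0 _ (ltW lt); rewrite eqxx.
  - by move: n3; rewrite C0 ?eqxx//; clear -lt; lra.
(* [h1] is constant along the shift by [h2], because the cutoff [B] is flat
   wherever [h2] does not vanish. *)
have h12 (z : E) : h1 (h2 z *: delta_mx 0 i3 + z) = h1 z.
  have [->|/h2N [_ _ _ z3]] := eqVneq (h2 z) 0; first by rewrite scale0r add0r.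
  rewrite /h1 !tensor4E !mxE /= !mulr0 !add0r mulr1; congr (_ * _).
  have := h2w z; move: z3; rewrite !ler_norml => /andP[h3 h4] /andP[h5 h6].
  by rewrite !B1// ler_norml; clear -h3 h4 h5 h6 w0; apply/andP; split; lra.
have PE (z : E) : perturb F h z = let z' := h2 z *: delta_mx 0 i3 + z in
    F (h1 z' *: delta_mx 0 i2 + z').
  rewrite /= h12 /perturb.
  have rowE : \row_j h j z = pt4 (l * h1 z) (m * h2 z) 0 0.
    by apply/rowP; apply: ord4_ind; rewrite !mxE.
  rewrite rowE.
  have [/andP[/eqP h1z /eqP h2z]|] := boolP ((h1 z == 0) && (h2 z == 0)).
    rewrite h1z h2z !scale0r !add0r !mulr0 (_ : pt4 0 0 0 0 = 0) ?addr0//.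
    by apply/rowP; apply: ord4_ind; rewrite !mxE.
  rewrite negb_and => hz.
  have [z0 z1 z2 z3] : [/\ `|z 0 i0| <= d, `|z 0 i1| <= d,
      `|z 0 i2 - aS| <= 2 * w & `|z 0 i3 - 1| <= 6 * w].
    case/orP: hz => [/h1N//|/h2N [? ? ? z3]]; split => //.
    by apply: le_trans z3 _; rewrite ler_wpM2r ?(ltW w0)// ler_nat.
  have z4 : `|z 0 i3 + h2 z| <= 2.
    have := h2w z; have [->|/h2N [_ _ _]] := eqVneq (h2 z) 0.
      by rewrite addr0; move: z3; rewrite !ler_norml; clear -w8; lra.
    by rewrite !ler_norml; clear -w8; lra.
  have z5 : `|z 0 i2 + h1 z| <= 2.
    by have := h1w z; move: z2; rewrite !ler_norml; clear -aw1 aw2; lra.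
  have z6 : `|z 0 i2| <= 2.
    by move: z2; rewrite !ler_norml; clear -aw1 aw2 w0; lra.
  have z7 : `|z 0 i3| <= 2.
    by move: z3; rewrite !ler_norml; clear -w8 w0; lra.
  have -> : h1 z *: delta_mx 0 i2 + (h2 z *: delta_mx 0 i3 + z) =
      pt4 (z 0 i0) (z 0 i1) (z 0 i2 + h1 z) (z 0 i3 + h2 z).
    by apply/rowP; apply: ord4_ind; rewrite !mxE /=; ring.
  rewrite {1}(pt4_eta z) !FE//.
  by apply/rowP; apply: ord4_ind; rewrite !mxE /=; ring.
exists (perturb F h); split.
- apply: (perturb_diffeo r0 FC hS h1S h2S _ _ PE) => x.
    by rewrite (le_trans (h1b [:: i2] x _))// (le_trans Ke1).
  by rewrite (le_trans (h2b [:: i3] x _))// (le_trans Ke1).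
- by apply: perturb_dist => //; [case: FC|exact: ltW].
- move=> z z1; rewrite /perturb (_ : \row_j h j z = 0) ?addr0//.
  have h1z : h1 z = 0.
    by apply/eqP; apply/negP => /negP /h1N [_ + _ _]; rewrite leNgt z1.
  have h2z : h2 z = 0.
    by apply/eqP; apply/negP => /negP /h2N [_ + _ _]; rewrite leNgt z1.
  by apply/rowP; apply: ord4_ind; rewrite !mxE /h /= ?h1z ?h2z ?mulr0.
- move=> xu yu xs ys xud yud xs2 ysw.
  have ys2 : `|ys| <= 2 by move: ysw; rewrite !ler_norml; clear -w8 w0; lra.
  have dd : d / 2 <= d by rewrite ler_pdivrMr// ler_peMr ?(ltW d0)// ler1n.
  rewrite /perturb FE ?(le_trans xud) ?(le_trans yud)//.
  have h1z : h1 (pt4 xu yu xs ys) = D1 0%N xs.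
    rewrite /h1 tensor4E !mxE /= !U1 ?subr0// B1 ?mul1r ?mulr1//.
    by apply: le_trans ysw _; rewrite ler_peMl ?(ltW w0)// ler1n.
  have h2z : h2 (pt4 xu yu xs ys) = D2 0%N xs.
    by rewrite /h2 tensor4E !mxE /= !U1 ?subr0// C1// !mul1r mulr1.
  by apply/rowP; apply: ord4_ind; rewrite !mxE /h /= ?h1z ?h2z; ring.
Qed.

End LocalPerturbation.

(** * Coding by words *)

Section Symbolic.
Context {R : realType}.
Implicit Types (w p q : seq bool) (x y s t : R).

(* [cmap] and [emap] are the contracting branches of the horseshoe in the four
   coordinates; the letters [false] and [true] stand for the strips V_0 and V_1. *)
Definition cmap (v0 v1 : R) (b : bool) x := if b then v1 * (x - 1) + 1 else v0 * x - 1.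
Definition emap (nu : R) (b : bool) x := nu * x + (if b then 1 else -1).

Definition crun v0 v1 w x := foldr (cmap v0 v1) x w.
Definition erun nu w x := foldr (emap nu) x w.
Definition cweight (v0 v1 : R) w : R := \prod_(b <- w) (if b then v1 else v0).

Lemma crun_cat v0 v1 w1 w2 x : crun v0 v1 (w1 ++ w2) x = crun v0 v1 w1 (crun v0 v1 w2 x).
Proof. exact: foldr_cat. Qed.

Lemma erun_cat nu w1 w2 x : erun nu (w1 ++ w2) x = erun nu w1 (erun nu w2 x).
Proof. exact: foldr_cat. Qed.

Lemma crunB v0 v1 w x y : crun v0 v1 w x - crun v0 v1 w y = cweight v0 v1 w * (x - y).
Proof.
elim: w => [|b w IH] /=; first by rewrite /cweight big_nil mul1r.
rewrite /cweight big_cons -mulrA -IH /cmap; case: b; ring.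
Qed.

Lemma erunB nu w x y : erun nu w x - erun nu w y = nu ^+ size w * (x - y).
Proof.
elim: w => [|b w IH] /=; first by rewrite expr0 mul1r.
rewrite exprS -mulrA -IH /emap; ring.
Qed.

Lemma cweight_cat v0 v1 w1 w2 :
  cweight v0 v1 (w1 ++ w2) = cweight v0 v1 w1 * cweight v0 v1 w2.
Proof. exact: big_cat. Qed.

Lemma cweight_gt0 v0 v1 w : 0 < v0 -> 0 < v1 -> 0 < cweight v0 v1 w.
Proof. by move=> ? ?; rewrite /cweight; elim/big_ind: _ => // [|[]//]; exact: mulr_gt0. Qed.

Lemma cweight_le v0 v1 w : 0 < v0 -> v0 <= v1 -> cweight v0 v1 w <= v1 ^+ size w.
Proof.
move=> v00 v01; have v10 := lt_le_trans v00 v01.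
elim: w => [|b w IH]; first by rewrite /cweight big_nil expr0.
rewrite /cweight big_cons exprS ler_pM//; first by case: b; exact: ltW.
  by rewrite ltW// cweight_gt0.
by case: b.
Qed.

Lemma cweight_ge v0 v1 w : 0 < v0 -> v0 <= v1 -> v0 ^+ size w <= cweight v0 v1 w.
Proof.
move=> v00 v01; have v10 := lt_le_trans v00 v01.
elim: w => [|b w IH]; first by rewrite /cweight big_nil expr0.
rewrite /cweight big_cons exprS ler_pM ?exprn_ge0 ?(ltW v00)//.
by case: b.
Qed.

Lemma cweight_rcons v0 v1 w b :
  cweight v0 v1 (rcons w b) = cweight v0 v1 w * (if b then v1 else v0).
Proof. by rewrite -cats1 cweight_cat /cweight big_seq1. Qed.

(* The attractor of the two maps [cmap v0 v1] is the interval [chull v0, 1]. *)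
Definition chull (v0 : R) : R := - (1 - v0)^-1.
(** [[-ehull nu, ehull nu]] is the convex hull of the attractor of the maps [emap nu]; the values at
    the inverse of lambda_u and at lambda_s are [a_u] and [a_s]. *)
Definition ehull (nu : R) : R := (1 - nu)^-1.

Lemma chull_gtN2 v0 : 0 < v0 -> v0 < 2^-1 -> -2 < chull v0 < -1.
Proof.
move=> v00 v02; have h : 0 < 1 - v0 by lra.
have h1 : 1 < (1 - v0)^-1 by rewrite invf_gt1//; lra.
have h2 : (1 - v0)^-1 < 2 by rewrite -div1r ltr_pdivrMr//; lra.
by rewrite /chull; apply/andP; split; lra.
Qed.

Lemma chull_fix v0 : v0 < 1 -> v0 * chull v0 - 1 = chull v0.
Proof. by move=> v01; rewrite /chull; field; rewrite subr_eq0 gt_eqF. Qed.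

Lemma ehull_fix nu : nu < 1 -> nu * ehull nu + 1 = ehull nu.
Proof. by move=> v01; rewrite /ehull; field; rewrite subr_eq0 gt_eqF. Qed.

Lemma cmap_hull v0 v1 b x : 0 < v0 -> v0 < 2^-1 -> 0 < v1 -> v1 < 1 ->
  chull v0 <= x <= 1 -> chull v0 <= cmap v0 v1 b x <= 1.
Proof.
move=> v00 v02 v10 v11 /andP[x0 x1]; have /andP[h1 h2] := chull_gtN2 v00 v02.
have fx := @chull_fix v0 ltac:(lra).
case: b; rewrite /cmap; apply/andP; split; nra.
Qed.

Lemma crun_hull v0 v1 w x : 0 < v0 -> v0 < 2^-1 -> 0 < v1 -> v1 < 1 ->
  chull v0 <= x <= 1 -> chull v0 <= crun v0 v1 w x <= 1.
Proof. by move=> ? ? ? ? xh; elim: w => //= b w IH; exact: cmap_hull. Qed.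

Lemma cmap_le2 v0 v1 b x : 0 < v0 -> v0 < 2^-1 -> 0 < v1 -> v1 < 1 ->
  `|x| <= 2 -> `|cmap v0 v1 b x| <= 2.
Proof.
move=> v00 v02 v10 v11; rewrite !ler_norml => /andP[x0 x1].
case: b; rewrite /cmap; apply/andP; split; nra.
Qed.

Lemma emap_le2 nu b x : 0 < nu -> nu < 2^-1 -> `|x| <= 2 -> `|emap nu b x| <= 2.
Proof.
move=> n0 n2; rewrite !ler_norml => /andP[x0 x1].
case: b; rewrite /emap; apply/andP; split; nra.
Qed.

Lemma erun_ehull nu w x : 0 < nu -> nu < 1 ->
  `|erun nu w x| - ehull nu <= nu ^+ size w * (`|x| - ehull nu).
Proof.
move=> n0 n1; elim: w => [|b w IH] /=; first by rewrite expr0 mul1r.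
rewrite exprS -mulrA; have fx := ehull_fix n1.
have h : `|emap nu b (erun nu w x)| <= nu * `|erun nu w x| + 1.
  rewrite /emap (le_trans (ler_normD _ _))// normrM (gtr0_norm n0) lerD2l.
  by case: b; rewrite ?normrN normr1.
have : nu * (`|erun nu w x| - ehull nu) <= nu * (nu ^+ size w * (`|x| - ehull nu)).
  by rewrite ler_wpM2l// ltW.
rewrite mulrBr; lra.
Qed.

Lemma erun_hull nu w x : 0 < nu -> nu < 1 -> `|x| <= ehull nu ->
  `|erun nu w x| <= ehull nu.
Proof.
move=> n0 n1 xh; rewrite -subr_le0 (le_trans (erun_ehull _ _ n0 n1))//.
by rewrite pmulr_rle0 ?exprn_gt0// subr_le0.
Qed.

Lemma ehull_gt0 nu : nu < 1 -> 0 < ehull nu.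
Proof. by move=> n1; rewrite invr_gt0 subr_gt0. Qed.

Lemma ehull_lt2 nu : 0 < nu -> nu < 2^-1 -> 1 < ehull nu < 2.
Proof. by move=> n0 n2; have := chull_gtN2 n0 n2; rewrite /chull /ehull; lra. Qed.

(** Length of the intersection of [[chull v0, v0 - 1]] and [[1 - v1 * (1 - chull v0), 1]], the
    images of the attractor under the two branches. *)
Definition overlap (v0 v1 : R) := (v0 - 1) - (1 - v1 * (1 - chull v0)).

Lemma overlap_gt0 v0 v1 : 0 < v0 -> v0 < 2^-1 -> 1 < v0 + v1 -> 0 < overlap v0 v1.
Proof.
move=> v00 v02 v01; rewrite /overlap /chull.
have h : 0 < 1 - v0 by lra.
have -> : v0 - 1 - (1 - v1 * (1 - - (1 - v0)^-1)) =
  (v0 + v1 - 1) * (2 - v0) / (1 - v0) by field; rewrite gt_eqF.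
by rewrite divr_gt0// mulr_gt0//; lra.
Qed.

(* Whatever the remaining digits of [q] are, the prescribed affine function of
   the point coded by [q] lies in the attractor seen through the word [p]. *)
Definition wins (v0 v1 nu A l : R) p q := forall s, `|s| <= ehull nu ->
  exists2 x, chull v0 <= x <= 1 & crun v0 v1 p x = A + l * erun nu q s.

(** Over all tails [s] the target points, seen through [p], lie in an interval no longer than the
    overlap of the two branches. One branch thus contains them all, and its letter can be chosen
    without knowing the later digits of [q]. *)
Lemma wins_step (v0 v1 nu A l : R) p q : 0 < v0 -> v0 < 2^-1 -> 1 < v0 + v1 ->
  0 < nu -> nu < 1 -> 0 < l -> wins v0 v1 nu A l p q ->
  2 * ehull nu * (l * nu ^+ size q) <= overlap v0 v1 * cweight v0 v1 p ->
  exists b, wins v0 v1 nu A l (rcons p b) q.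
Proof.
move=> v00 v02 v01 nu0 nu1 l0 pq small; have v10 : 0 < v1 by lra.
have a0 := ehull_gt0 nu1.
have cp0 : 0 < cweight v0 v1 p by apply: cweight_gt0.
have fx := @chull_fix v0 ltac:(lra).
(* The right end of that interval, reached at [s = ehull nu], decides the letter: [0] if it lies in
   the image of the branch [0], and [1] otherwise. *)
have [xm /andP[xm0 xm1] xmE] : exists2 x, chull v0 <= x <= 1 &
  crun v0 v1 p x = A + l * erun nu q (ehull nu).
  by apply: pq; rewrite gtr0_norm// lexx.
have diff s x : crun v0 v1 p x = A + l * erun nu q s ->
    cweight v0 v1 p * (xm - x) = l * nu ^+ size q * (ehull nu - s).
  by move=> xE; rewrite -crunB xmE xE -mulrA -erunB; ring.
have ln0 : 0 < l * nu ^+ size q by rewrite mulr_gt0// exprn_gt0.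
have [xmv|xmv] := leP xm (v0 - 1).
  exists false => s sa; have [x /andP[x0 x1] xE] := pq s sa.
  have xxm : x <= xm.
    have := diff _ _ xE; move: sa; rewrite ler_norml => /andP[_ s1] dE.
    by rewrite -subr_ge0 -(pmulr_rge0 _ cp0) dE mulr_ge0 ?subr_ge0// ltW.
  exists ((x + 1) / v0).
    by rewrite ler_pdivlMr// ler_pdivrMr//; apply/andP; split; lra.
  rewrite -cats1 crun_cat -xE; congr (crun _ _ _ _).
  by rewrite /= /cmap; field; rewrite gt_eqF.
exists true => s sa; have [x /andP[x0 x1] xE] := pq s sa.
have xxm : xm - overlap v0 v1 <= x.
  have := diff _ _ xE; move: sa; rewrite ler_norml => /andP[s0 _] dE.
  rewrite lerBlDr -lerBlDl -(ler_pM2l cp0) dE [leRHS]mulrC.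
  apply: le_trans small; rewrite mulrC ler_wpM2r ?(ltW ln0)//; lra.
exists ((x - 1) / v1 + 1).
  rewrite -lerBlDr ler_pdivlMr// -lerBrDr subrr pmulr_lle0 ?invr_gt0//.
  by move: xxm; rewrite /overlap => xxm; apply/andP; split; lra.
rewrite -cats1 crun_cat -xE; congr (crun _ _ _ _).
by rewrite /= /cmap; field; rewrite gt_eqF.
Qed.

Lemma wins_rcons (v0 v1 nu A l : R) p q b : 0 < nu -> nu < 1 -> wins v0 v1 nu A l p q -> wins v0 v1 nu A l p (rcons q b).
Proof.
move=> nu0 nu1 pq s sa; have := pq (emap nu b s) (@erun_hull nu [:: b] s nu0 nu1 sa).
by rewrite -cats1 erun_cat.
Qed.

(** The attractor is shorter than [3], so stopping the expansion at [p] costs at most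
    [3 * cweight v0 v1 p], whatever follows the two words. *)
Lemma wins_residual (v0 v1 nu A l : R) p q s x : 0 < v0 -> v0 < 2^-1 -> 0 < v1 ->
  wins v0 v1 nu A l p q -> `|s| <= ehull nu ->
  chull v0 <= x <= 1 ->
  `|crun v0 v1 p x - (A + l * erun nu q s)| <= 3 * cweight v0 v1 p.
Proof.
move=> v00 v02 v10 pq sa /andP[x0 x1]; have [x' /andP[x'0 x'1] <-] := pq s sa.
have /andP[c0 c1] := chull_gtN2 v00 v02.
have cp := cweight_gt0 p v00 v10.
rewrite crunB normrM (gtr0_norm cp) mulrC ler_wpM2r ?(ltW cp)//.
rewrite ler_norml; apply/andP; split; lra.
Qed.

Lemma expr_lt_eps (th e : R) : 0 <= th -> th < 1 -> 0 < e ->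
  exists n, forall m, (n <= m)%N -> th ^+ m < e.
Proof.
move=> th0 th1 e0.
have /cvgr0Pnorm_lt /(_ _ e0) [n _ nP] : (th ^+ m) @[m --> \oo] --> (0 : R).
  by apply: cvg_expr; rewrite ger0_norm.
exists n => m /nP /=; rewrite ger0_norm// exprn_ge0//.
Qed.

Lemma expr_mul_le_eps (v a e : R) : 0 < v -> v < 1 -> 0 < e ->
  exists m0, forall m, (m0 <= m)%N -> `|v ^+ m * a| <= e.
Proof.
move=> v0 v1 e0; have a1 : 0 < 1 + `|a| by have := normr_ge0 a; lra.
have [m0 m0P] := expr_lt_eps (ltW v0) v1 (divr_gt0 e0 a1); exists m0 => m /m0P.
rewrite ltr_pdivlMr// => h; rewrite normrM gtr0_norm ?exprn_gt0//.
have := exprn_gt0 m v0; have := normr_ge0 a; nra.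
Qed.

Lemma exponent_compare (nu v K l : R) : 0 < nu -> 0 < v -> v < 1 -> 0 < K -> 0 < l ->
  exists c, forall a b, l * nu ^+ a <= K * v ^+ b -> (b <= c * a.+1)%N.
Proof.
move=> nu0 v0 v1 K0 l0.
have [c1 c1P] := expr_lt_eps (ltW v0) v1 nu0.
have lK : 0 < l / K by rewrite divr_gt0.
have [c2 c2P] := expr_lt_eps (ltW v0) v1 lK.
exists (maxn c1 c2) => a b lab; rewrite leqNgt; apply/negP => bc.
suff : K * v ^+ b < l * nu ^+ a by rewrite ltNge lab.
have vb : v ^+ b <= nu ^+ a * v ^+ c2.
  apply: (@le_trans _ _ (v ^+ (c1 * a + c2))).
    apply: ler_wiXn2l; rewrite ?(ltW v0) ?(ltW v1)//; move: bc; rewrite mulnS; nia.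
  rewrite exprD exprM ler_wpM2r ?exprn_ge0 ?(ltW v0)//.
  by apply: lerXn2r; rewrite ?nnegrE ?exprn_ge0 ?(ltW v0) ?(ltW nu0)// ltW// c1P.
apply: (@le_lt_trans _ _ (K * (nu ^+ a * v ^+ c2))); first by rewrite ler_pM2l.
by rewrite mulrCA [ltRHS]mulrC ltr_pM2l ?exprn_gt0// mulrC -ltr_pdivlMr// c2P.
Qed.

End Symbolic.

(* In the notation of the theorem, [u0], [u1] and [nu] are the inverses of
   lambda_cu0, lambda_cu1 and lambda_u, [v0], [v1] and [ls] are lambda_cs0,
   lambda_cs1 and lambda_s, and [li], [mi] are the inverses of lambda_* and mu_*. *)
Record consts (R : realType) := Consts {
  u0 : R; u1 : R; v0 : R; v1 : R; ls : R; nu : R; li : R; mi : R;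
  ls_gt0 : 0 < ls; ls_v0 : ls < v0; v0_nu : v0 < nu; nu_u0 : nu < u0;
  u0_lt2 : u0 < 2^-1; u1_lt1 : u1 < 1; v1_lt1 : v1 < 1;
  u01 : 1 < u0 + u1; v01 : 1 < v0 + v1; v01_nu : v0 * v1 < nu ^+ 2;
  li_gt0 : 0 < li; mi_gt0 : 0 < mi }.

(** * Digit-by-digit solution of the two matching equations *)

Section Matching.
Context {R : realType}.
Variable P : consts R.
Implicit Types (p q w : seq bool) (x y s t A B : R).

Local Notation u0 := (u0 P).
Local Notation u1 := (u1 P).
Local Notation v0 := (v0 P).
Local Notation v1 := (v1 P).
Local Notation ls := (ls P).
Local Notation nu := (nu P).
Local Notation li := (li P).
Local Notation mi := (mi P).

Lemma consts_bounds : [/\ 0 < ls, ls < v0, v0 < nu, nu < u0 & u0 < 2^-1] /\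
  [/\ 2^-1 < u1, u1 < 1, 2^-1 < v1 & v1 < 1].
Proof.
have := ls_gt0 P; have := ls_v0 P; have := v0_nu P; have := nu_u0 P.
have := u0_lt2 P; have := u1_lt1 P; have := v1_lt1 P; have := u01 P; have := v01 P.
by split; split => //; lra.
Qed.

Lemma u0_gt0 : 0 < u0. Proof. have [[? ? ? ? ?] _] := consts_bounds; lra. Qed.
Lemma v0_gt0 : 0 < v0. Proof. have [[? ? ? ? ?] _] := consts_bounds; lra. Qed.
Lemma nu_gt0 : 0 < nu. Proof. have [[? ? ? ? ?] _] := consts_bounds; lra. Qed.
Lemma u1_gt0 : 0 < u1. Proof. have [_ [? ? ? ?]] := consts_bounds; lra. Qed.
Lemma v1_gt0 : 0 < v1. Proof. have [_ [? ? ? ?]] := consts_bounds; lra. Qed.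
Lemma v0_lt2 : v0 < 2^-1. Proof. have [[? ? ? ? ?] _] := consts_bounds; lra. Qed.
Lemma nu_lt2 : nu < 2^-1. Proof. have [[? ? ? ? ?] _] := consts_bounds; lra. Qed.
Lemma ls_lt2 : ls < 2^-1. Proof. have [[? ? ? ? ?] _] := consts_bounds; lra. Qed.
Lemma nu_lt1 : nu < 1. Proof. have [[? ? ? ? ?] _] := consts_bounds; lra. Qed.
Lemma ls_lt1 : ls < 1. Proof. have [[? ? ? ? ?] _] := consts_bounds; lra. Qed.
Lemma u0_le_u1 : u0 <= u1. Proof. have [[? ? ? ? ?] [? ? ? ?]] := consts_bounds; lra. Qed.
Lemma v0_le_v1 : v0 <= v1. Proof. have [[? ? ? ? ?] [? ? ? ?]] := consts_bounds; lra. Qed.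

(** The equations are [X = A + li * S] and [T = B + mi * Y]. The prefix [p] of the next word codes
    [X] and [Y]; the reversed suffix [q] of the current word codes [S] and [T]. Each equation is
    solved for its centre coordinate, [X] or [T], whose two branches overlap. *)
Definition good A B p q := wins u0 u1 ls A li p q /\ wins v0 v1 nu B mi q p.

(* Lengths of the windows left for the tails of [p] and [q]; their product
   decreases at each new digit. *)
Definition width1 p q := li * ls ^+ size q / cweight u0 u1 p.
Definition width2 p q := mi * nu ^+ size p / cweight v0 v1 q.
Definition max1 := overlap u0 u1 / (2 * ehull ls).
Definition max2 := overlap v0 v1 / (2 * ehull nu).

Definition extendable A B p q := [/\ good A B p q, width1 p q <= max1,
  width2 p q <= max2 & width1 p q * width2 p q <= max1 * max2 * (u0 * v0)].

Lemma max1_gt0 : 0 < max1.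
Proof.
rewrite divr_gt0 ?mulr_gt0 ?ehull_gt0 ?ls_lt1//.
by apply: overlap_gt0; [exact: u0_gt0|exact: u0_lt2|exact: u01].
Qed.

Lemma max2_gt0 : 0 < max2.
Proof.
rewrite divr_gt0 ?mulr_gt0 ?ehull_gt0 ?nu_lt1//.
by apply: overlap_gt0; [exact: v0_gt0|exact: v0_lt2|exact: v01].
Qed.

Lemma width1_gt0 p q : 0 < width1 p q.
Proof.
by rewrite /width1 divr_gt0 ?cweight_gt0 ?u0_gt0 ?u1_gt0// mulr_gt0 ?li_gt0// exprn_gt0// ls_gt0.
Qed.

Lemma width2_gt0 p q : 0 < width2 p q.
Proof.
by rewrite /width2 divr_gt0 ?cweight_gt0 ?v0_gt0 ?v1_gt0// mulr_gt0 ?mi_gt0// exprn_gt0// nu_gt0.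
Qed.

Lemma width1_rconsl p q b : width1 (rcons p b) q = width1 p q / (if b then u1 else u0).
Proof. by rewrite /width1 cweight_rcons invfM mulrA. Qed.

Lemma width1_rconsr p q b : width1 p (rcons q b) = width1 p q * ls.
Proof. by rewrite /width1 size_rcons exprSr mulrA mulrAC. Qed.

Lemma width2_rconsr p q b : width2 p (rcons q b) = width2 p q / (if b then v1 else v0).
Proof. by rewrite /width2 cweight_rcons invfM mulrA. Qed.

Lemma width2_rconsl p q b : width2 (rcons p b) q = width2 p q * nu.
Proof. by rewrite /width2 size_rcons exprSr mulrA mulrAC. Qed.

(** A letter added to [p] refines the scale of [X] and thereby enlarges [width1]. If [width1] has
    room for a factor [u0^-1], [wins_step] supplies this letter; if not, the bound on the product
    leaves [width2] room for a letter of [q]. The product bound persists because [nu] is below both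
    [u0] and [u1], and [ls] below both [v0] and [v1]. *)
Lemma extend_digit A B p q : extendable A B p q ->
  exists b, extendable A B (rcons p b) q \/ extendable A B p (rcons q b).
Proof.
move=> [[g1 g2] w1 w2 w12].
have [[ls0 lsv0 v0nu nuu0 u02] [u12 u11 v12 v11]] := consts_bounds.
have W1 := width1_gt0 p q; have W2 := width2_gt0 p q.
have M1 := max1_gt0; have M2 := max2_gt0.
have u00 := u0_gt0; have v00 := v0_gt0.
have v02 := v0_lt2; have nu0 := nu_gt0; have nu1 := nu_lt1; have ls1 := ls_lt1.
have W12 := mulr_gt0 W1 W2.
have [small|big] := leP (width1 p q) (max1 * u0).
  have [] := @wins_step _ u0 u1 ls A li p q u00 u02 (u01 P) ls0 ls1 (li_gt0 P) g1.
    move: w1; rewrite /width1 /max1.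
    rewrite ler_pdivrMr ?cweight_gt0 ?u1_gt0// mulrAC ler_pdivlMr ?mulr_gt0 ?ehull_gt0//.
    by rewrite mulrC.
  move=> b gb; exists b; left; rewrite /extendable width1_rconsl width2_rconsl.
  have ub : u0 <= (if b then u1 else u0) by case: (b); [exact: u0_le_u1|].
  have ub0 : 0 < (if b then u1 else u0) := lt_le_trans u00 ub.
  split.
  - by split => //; apply: wins_rcons.
  - by rewrite ler_pdivrMr// (le_trans small)// ler_pM2l.
  - by rewrite (le_trans _ w2)// ler_piMr// ltW.
  - rewrite mulrACA (le_trans _ w12)// ler_piMr ?(ltW W12)//.
    by rewrite mulrC ler_pdivrMr// mul1r (le_trans _ ub)// ltW.
have small : width2 p q <= max2 * v0.
  rewrite leNgt; apply/negP => big2.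
  have : max1 * u0 * (max2 * v0) < width1 p q * width2 p q.
    by apply: ltr_pM => //; rewrite mulr_ge0// ltW.
  by rewrite mulrACA ltNge w12.
have [] := @wins_step _ v0 v1 nu B mi q p v00 v02 (v01 P) nu0 nu1 (mi_gt0 P) g2.
  move: w2; rewrite /width2 /max2.
  rewrite ler_pdivrMr ?cweight_gt0 ?v1_gt0// mulrAC ler_pdivlMr ?mulr_gt0 ?ehull_gt0//.
  by rewrite mulrC.
move=> b gb; exists b; right; rewrite /extendable width1_rconsr width2_rconsr.
have vb : v0 <= (if b then v1 else v0) by case: (b); [exact: v0_le_v1|].
have vb0 : 0 < (if b then v1 else v0) := lt_le_trans v00 vb.
split.
- by split => //; apply: wins_rcons.
- by rewrite (le_trans _ w1)// ler_piMr// ltW.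
- by rewrite ler_pdivrMr// (le_trans small)// ler_pM2l.
- rewrite mulrACA (le_trans _ w12)// ler_piMr ?(ltW W12)//.
  by rewrite mulrC mulrC ler_pdivrMr// mul1r (le_trans _ vb)// ltW.
Qed.

Lemma extend_digits A B p q N : extendable A B p q ->
  exists p' q', extendable A B (p ++ p') (q ++ q') /\ (size p' + size q')%N = N.
Proof.
move=> pq; elim: N => [|N [p' [q' [pq' sz]]]]; first by exists [::], [::]; rewrite !cats0.
have [b [pb|qb]] := extend_digit pq'.
  by exists (rcons p' b), q'; rewrite -rcons_cat size_rcons addSn sz.
by exists p', (rcons q' b); rewrite -rcons_cat size_rcons addnS sz.
Qed.

(** If one word were much longer than the other, one of the widths would exceed its bound. Hence
    both words get a fixed proportion of the new letters, and both residuals decay. *)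
Lemma extendable_length : exists c, forall A B p q, extendable A B p q ->
  (size q <= c * (size p).+1)%N /\ (size p <= c * (size q).+1)%N.
Proof.
have [[ls0 lsv0 v0nu nuu0 u02] [u12 u11 v12 v11]] := consts_bounds.
have [c cP] := exponent_compare nu_gt0 v1_gt0 v11 max2_gt0 (mi_gt0 P).
have [d dP] := exponent_compare ls0 u1_gt0 u11 max1_gt0 (li_gt0 P).
exists (maxn c d) => A B p q [_ w1 w2 _]; split.
  have /cP h : mi * nu ^+ size p <= max2 * v1 ^+ size q.
    move: w2; rewrite /width2 ler_pdivrMr ?cweight_gt0 ?v0_gt0 ?v1_gt0// => /le_trans; apply.
    by rewrite ler_pM2l ?max2_gt0// cweight_le ?v0_gt0 ?v0_le_v1.
  by rewrite (leq_trans h)// leq_mul2r leq_maxl orbT.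
have /dP h : li * ls ^+ size q <= max1 * u1 ^+ size p.
  move: w1; rewrite /width1 ler_pdivrMr ?cweight_gt0 ?u0_gt0 ?u1_gt0// => /le_trans; apply.
  by rewrite ler_pM2l ?max1_gt0// cweight_le ?u0_gt0 ?u0_le_u1.
by rewrite (leq_trans h)// leq_mul2r leq_maxr orbT.
Qed.

Lemma geometric_rate (th rho e : R) (c : nat) : 0 < th -> th < 1 -> 0 < rho -> 0 < e ->
  exists H, forall k L, (H * k.+1 <= c.+1 * L.+1)%N -> th ^+ L <= e * rho ^+ k.
Proof.
move=> th0 th1 r0 e0.
have [h1 h1P] := expr_lt_eps (ltW th0) th1 r0.
have [h2 h2P] := expr_lt_eps (ltW th0) th1 e0.
exists (c.+1 * (h1 + h2).+1)%N => k L HL.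
have kL : ((h1 + h2) * k.+1 <= L)%N.
  move: HL; rewrite -mulnA leq_pmul2l// => HL; nia.
apply: (@le_trans _ _ (th ^+ ((h1 + h2) * k.+1))).
  by apply: ler_wiXn2l; rewrite ?(ltW th0) ?(ltW th1).
rewrite mulnS exprD exprM; apply: ler_pM; rewrite ?exprn_ge0 ?(ltW th0)//.
  by apply/ltW/h2P; lia.
apply: lerXn2r; rewrite ?nnegrE ?exprn_ge0 ?(ltW th0) ?(ltW r0)//.
by apply/ltW/h1P; lia.
Qed.

End Matching.

(** * Periodic words that start the matching *)

Section BaseWords.
Context {R : realType}.
Implicit Types (x y s t : R).

Lemma crun_nseq1 (v0 v1 : R) j x : crun v0 v1 (nseq j true) x = 1 - v1 ^+ j * (1 - x).
Proof.
elim: j => [|j IH] /=; first by rewrite expr0; ring.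
rewrite IH /cmap exprS; ring.
Qed.

Lemma erun_nseq1 (nu : R) j x : nu < 1 ->
  erun nu (nseq j true) x = ehull nu - nu ^+ j * (ehull nu - x).
Proof.
move=> n1; have fx := ehull_fix n1.
elim: j => [|j IH] /=; first by rewrite expr0; ring.
by rewrite IH /emap exprS -{3}fx; ring.
Qed.

Definition loop j : seq bool := false :: nseq j true.

Lemma size_loop j : size (loop j) = j.+1.
Proof. by rewrite /= size_nseq. Qed.

Lemma cweight_nseq1 (v0 v1 : R) j : cweight v0 v1 (nseq j true) = v1 ^+ j.
Proof. by rewrite /cweight big_nseq /=; elim: j => //= j ->; rewrite exprS. Qed.

Lemma cweight_loop (v0 v1 : R) j : cweight v0 v1 (loop j) = v0 * v1 ^+ j.
Proof. by rewrite -[loop j]cat1s cweight_cat cweight_nseq1 /cweight big_seq1. Qed.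

Definition cfix (v0 v1 : R) j := (v0 * (1 - v1 ^+ j) - 1) / (1 - v0 * v1 ^+ j).
Definition efix (nu : R) j := erun nu (loop j) 0 / (1 - nu ^+ j.+1).

Lemma cfixE (v0 v1 : R) j : v0 * v1 ^+ j < 1 -> crun v0 v1 (loop j) (cfix v0 v1 j) = cfix v0 v1 j.
Proof.
move=> h; rewrite /= crun_nseq1 /cmap /cfix; field.
by rewrite subr_eq0 gt_eqF.
Qed.

Lemma efixE (nu : R) j : 0 < nu -> nu < 1 -> erun nu (loop j) (efix nu j) = efix nu j.
Proof.
move=> n0 n1; have nj : nu ^+ j.+1 < 1 by apply: exprn_ilt1; rewrite ?ltW.
have := erunB nu (loop j) (efix nu j) 0; rewrite size_loop subr0 => h.
have -> : erun nu (loop j) (efix nu j) = erun nu (loop j) 0 + nu ^+ j.+1 * efix nu j.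
  by rewrite -h; ring.
rewrite /efix; field; by rewrite subr_eq0 gt_eqF.
Qed.

Lemma efix_hull (nu : R) j : 0 < nu -> nu < 1 -> `|efix nu j| <= ehull nu.
Proof.
move=> n0 n1; have nj : nu ^+ j.+1 < 1 by apply: exprn_ilt1; rewrite ?ltW.
have := erun_ehull (loop j) (efix nu j) n0 n1; rewrite efixE// size_loop.
move=> h; rewrite -subr_le0 leNgt; apply/negP => h0.
by move: h; rewrite leNgt gtr_pMl// nj.
Qed.

Let flatten_nseqS T k (s : seq T) : flatten (nseq k.+1 s) = s ++ flatten (nseq k s).
Proof. by []. Qed.

(** The run [1^m] brings the coded points close to [1] and [ehull], that is to the centre [(a_s, 1)]
    of the fold in the stable coordinates and to its image [(1, a_u)] in the unstable ones. *)
Definition baseword m j k := nseq m true ++ flatten (nseq k (loop j)).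

Lemma size_baseword m j k : size (baseword m j k) = (m + j.+1 * k)%N.
Proof.
rewrite size_cat size_nseq size_flatten /shape map_nseq sumn_nseq /loop /=.
by rewrite size_nseq.
Qed.

Lemma baseword_add m j k l : baseword m j (k + l) = baseword m j k ++ flatten (nseq l (loop j)).
Proof. by rewrite /baseword nseqD flatten_cat catA. Qed.

Lemma cweight_baseword (v0 v1 : R) m j k :
  cweight v0 v1 (baseword m j k) = v1 ^+ m * (v0 * v1 ^+ j) ^+ k.
Proof.
rewrite cweight_cat cweight_nseq1; congr (_ * _).
elim: k => [|k IH]; first by rewrite /cweight big_nil expr0.
by rewrite flatten_nseqS cweight_cat IH cweight_loop exprS.
Qed.

Lemma crun_baseword (v0 v1 : R) m j k : v0 * v1 ^+ j < 1 ->
  crun v0 v1 (baseword m j k) (cfix v0 v1 j) = 1 - v1 ^+ m * (1 - cfix v0 v1 j).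
Proof.
move=> h; rewrite crun_cat crun_nseq1; congr (_ - _ * (_ - _)).
by elim: k => // k IH; rewrite flatten_nseqS crun_cat IH cfixE.
Qed.

Lemma erun_baseword (nu : R) m j k : 0 < nu -> nu < 1 ->
  erun nu (baseword m j k) (efix nu j) = ehull nu - nu ^+ m * (ehull nu - efix nu j).
Proof.
move=> n0 n1; rewrite erun_cat erun_nseq1//; congr (_ - _ * (_ - _)).
by elim: k => // k IH; rewrite flatten_nseqS erun_cat IH efixE.
Qed.

(** As [j] grows, the fixed point tends to [v0 - 1], the right end of the overlap. It is then
    interior to the image of the branch [1] as well, so it also has an expansion starting with [1]
    instead of [0]. *)
Lemma cfix_overlap (v0 v1 : R) : 0 < v0 -> v0 < 2^-1 -> 1 < v0 + v1 -> v1 < 1 ->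
  exists j0, forall j, (j0 <= j)%N -> 1 - v1 * (1 - chull v0) < cfix v0 v1 j < 1.
Proof.
move=> v00 v02 v01 v11; have v10 : 0 < v1 by lra.
have ov := overlap_gt0 v00 v02 v01.
have ov3 : 0 < overlap v0 v1 / 3 by rewrite divr_gt0.
have [j0 j0P] := expr_lt_eps (ltW v10) v11 ov3; exists j0 => j /j0P jP.
have p0 : 0 < v1 ^+ j by rewrite exprn_gt0.
have p1 : v1 ^+ j <= 1 by rewrite exprn_ile1// ltW.
have h : 0 < 1 - v0 * v1 ^+ j by nra.
move: jP; rewrite ltr_pdivlMr// /overlap => jP.
rewrite /cfix ltr_pdivlMr// ltr_pdivrMr//; apply/andP; split; nra.
Qed.

End BaseWords.

Section Pairs.
Context {R : realType}.
Variable P : consts R.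
Local Notation u0 := (u0 P).
Local Notation u1 := (u1 P).
Local Notation v0 := (v0 P).
Local Notation v1 := (v1 P).
Local Notation ls := (ls P).
Local Notation nu := (nu P).
Local Notation li := (li P).
Local Notation mi := (mi P).

(** As [v0 < nu], a letter [0] added to both words makes [width2] grow; by the last condition the
    [j] letters [1] that follow more than make up for it. For [width1] the same follows from
    [ls < u0] and [ls < u1]. *)
Definition base_ok j := [/\ 1 - u1 * (1 - chull u0) < cfix u0 u1 j < 1,
  1 - v1 * (1 - chull v0) < cfix v0 v1 j < 1 & nu ^+ j.+1 < v0 * v1 ^+ j].

Lemma base_ok_exists : exists j, base_ok j.
Proof.
have [[ls0 lsv0 v0nu nuu0 u02] [u12 u11 v12 v11]] := consts_bounds P.
have u00 := u0_gt0 P; have v00 := v0_gt0 P; have n0 := nu_gt0 P; have v10 := v1_gt0 P.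
have [j1 j1P] := cfix_overlap u00 u02 (u01 P) u11.
have [j2 j2P] := cfix_overlap v00 (v0_lt2 P) (v01 P) v11.
have r0 : 0 <= nu / v1 by apply/ltW/divr_gt0.
have r1 : nu / v1 < 1 by rewrite ltr_pdivrMr// mul1r; lra.
have e0 : 0 < v0 / nu by rewrite divr_gt0.
have [j3 j3P] := expr_lt_eps r0 r1 e0.
exists (j1 + j2 + j3)%N; split; [apply: j1P; clear; lia|apply: j2P; clear; lia|].
have : (nu / v1) ^+ (j1 + j2 + j3) < v0 / nu by apply: j3P; clear; lia.
by rewrite ltr_pdivlMr// expr_div_n mulrAC ltr_pdivrMr ?exprn_gt0// -exprSr.
Qed.

Variables (j : nat) (jok : base_ok j).

(* With these offsets, which tend to those of the unperturbed fold, the periodic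
   words [1^m (0 1^j)^oo] on both sides solve the two matching equations. *)
Definition offset1 m := 1 - u1 ^+ m * (1 - cfix u0 u1 j) -
  li * (ehull ls - ls ^+ m * (ehull ls - efix ls j)).
Definition offset2 m := 1 - v1 ^+ m * (1 - cfix v0 v1 j) -
  mi * (ehull nu - nu ^+ m * (ehull nu - efix nu j)).

Lemma offsets_limit e : 0 < e -> exists m0, forall m, (m0 <= m)%N ->
  `|offset1 m - (1 - li * ehull ls)| <= e /\ `|offset2 m - (1 - mi * ehull nu)| <= e.
Proof.
move=> e0; have [[ls0 lsv0 v0nu nuu0 u02] [u12 u11 v12 v11]] := consts_bounds P.
have e2 : 0 < e / 2 by rewrite divr_gt0.
have [m1 m1P] := expr_mul_le_eps (1 - cfix u0 u1 j) (u1_gt0 P) u11 e2.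
have [m2 m2P] := expr_mul_le_eps (1 - cfix v0 v1 j) (v1_gt0 P) v11 e2.
have [m3 m3P] := expr_mul_le_eps (li * (ehull ls - efix ls j)) ls0 (ls_lt1 P) e2.
have [m4 m4P] := expr_mul_le_eps (mi * (ehull nu - efix nu j)) (nu_gt0 P) (nu_lt1 P) e2.
exists (m1 + m2 + m3 + m4)%N => m mm.
have := m1P m ltac:(clear -mm; lia); have := m2P m ltac:(clear -mm; lia).
have := m3P m ltac:(clear -mm; lia); have := m4P m ltac:(clear -mm; lia).
rewrite /offset1 /offset2 !ler_norml => /andP[p1 q1] /andP[p2 q2] /andP[p3 q3] /andP[p4 q4].
by clear -jok p1 q1 p2 q2 p3 q3 p4 q4; split; apply/andP; split; lra.
Qed.

(** With periodic tails both equations hold exactly, at points interior to the allowed intervals.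
    After many loops the widths are so small that no other tail moves the solutions out of these
    intervals. *)
Lemma base_extendable m : exists k1, forall k, (k1 <= k)%N ->
  extendable P (offset1 m) (offset2 m) (baseword m j k) (rcons (baseword m j k) true).
Proof.
have [[ls0 lsv0 v0nu nuu0 u02] [u12 u11 v12 v11]] := consts_bounds P.
have [/andP[x0 x1] /andP[t0 t1] nj] := jok.
have u00 := u0_gt0 P; have v00 := v0_gt0 P; have n0 := nu_gt0 P.
have v10 := v1_gt0 P; have u10 := u1_gt0 P.
have ls1 := ls_lt1 P; have nu1 := nu_lt1 P.
have fu := @chull_fix _ u0 ltac:(lra); have fv := @chull_fix _ v0 ltac:(lra).
have /andP[cu1 cu2] := chull_gtN2 u00 u02.
have /andP[cv1 cv2] := chull_gtN2 v00 (v0_lt2 P).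
have uj1 : u0 * u1 ^+ j < 1.
  apply: (@le_lt_trans _ _ u0); last by lra.
  by rewrite ler_piMr ?(ltW u00)// exprn_ile1// ltW.
have vj1 : v0 * v1 ^+ j < 1.
  apply: (@le_lt_trans _ _ v0); last by lra.
  by rewrite ler_piMr ?(ltW v00)// exprn_ile1// ltW.
have uj0 : 0 < u0 * u1 ^+ j by rewrite mulr_gt0// exprn_gt0.
have vj0 : 0 < v0 * v1 ^+ j by rewrite mulr_gt0// exprn_gt0.
pose xo := cfix u0 u1 j; pose to := cfix v0 v1 j.
pose so := efix ls j; pose yo := efix nu j.
pose base k := baseword m j k.
have w1E k : width1 P (base k) (base k) =
    li * ls ^+ m / u1 ^+ m * (ls ^+ j.+1 / (u0 * u1 ^+ j)) ^+ k.
  rewrite /width1 cweight_baseword size_baseword exprD exprM expr_div_n.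
  by field; rewrite !gt_eqF// ?exprn_gt0.
have w2E k : width2 P (base k) (base k) =
    mi * nu ^+ m / v1 ^+ m * (nu ^+ j.+1 / (v0 * v1 ^+ j)) ^+ k.
  rewrite /width2 cweight_baseword size_baseword exprD exprM expr_div_n.
  by field; rewrite !gt_eqF// ?exprn_gt0.
have small1 e : 0 < e -> exists k1, forall k, (k1 <= k)%N -> width1 P (base k) (base k) <= e.
  move=> e0; set c := li * ls ^+ m / u1 ^+ m.
  have c0 : 0 < c by rewrite divr_gt0 ?mulr_gt0 ?exprn_gt0// li_gt0.
  have ec : 0 < e / c by rewrite divr_gt0.
  have r0 : 0 <= ls ^+ j.+1 / (u0 * u1 ^+ j) by rewrite divr_ge0 ?exprn_ge0 ?(ltW ls0)// ltW.
  have r1 : ls ^+ j.+1 / (u0 * u1 ^+ j) < 1.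
    rewrite ltr_pdivrMr// mul1r exprS.
    apply: (@le_lt_trans _ _ (ls * u1 ^+ j)); last by rewrite ltr_pM2r ?exprn_gt0//; lra.
    by rewrite ler_pM2l//; apply: lerXn2r; rewrite ?nnegrE; clear -jok ls0 lsv0 v0nu nuu0 u02 u12; lra.
  have [k1 k1P] := expr_lt_eps r0 r1 ec; exists k1 => k /k1P.
  by rewrite w1E -/c ltr_pdivlMr// mulrC => /ltW.
have small2 e : 0 < e -> exists k1, forall k, (k1 <= k)%N -> width2 P (base k) (base k) <= e.
  move=> e0; set c := mi * nu ^+ m / v1 ^+ m.
  have c0 : 0 < c by rewrite divr_gt0 ?mulr_gt0 ?exprn_gt0// mi_gt0.
  have ec : 0 < e / c by rewrite divr_gt0.
  have r0 : 0 <= nu ^+ j.+1 / (v0 * v1 ^+ j) by rewrite divr_ge0 ?exprn_ge0 ?(ltW n0)// ltW.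
  have r1 : nu ^+ j.+1 / (v0 * v1 ^+ j) < 1 by rewrite ltr_pdivrMr// mul1r.
  have [k1 k1P] := expr_lt_eps r0 r1 ec; exists k1 => k /k1P.
  by rewrite w2E -/c ltr_pdivlMr// mulrC => /ltW.
(* Distance from the periodic solution to the ends of its interval, divided by the largest variation
   of a tail. For [e2] the interval is the image of the branch [1], because of the letter added to
   [q]. *)
pose e1 := Num.min (xo - chull u0) (1 - xo) / (2 * ehull ls).
pose e2 := Num.min (to - (1 - v1 * (1 - chull v0))) (1 - to) / (2 * ehull nu).
have xc : chull u0 < xo by rewrite /xo; nra.
have hs0 := ehull_gt0 ls1; have hn0 := ehull_gt0 nu1.
have e10 : 0 < e1 by rewrite divr_gt0 ?mulr_gt0// lt_min !subr_gt0 xc.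
have e20 : 0 < e2 by rewrite divr_gt0 ?mulr_gt0// lt_min !subr_gt0 t0.
have M1 := max1_gt0 P; have M2 := max2_gt0 P.
(* The factor [u0 * v0] is for the bound on the product; the factor [v0] in [e50] pays for the
   letter [1], which divides [width2] by [v1]. *)
have e30 : 0 < Num.min e1 (Num.min (max1 P) (max1 P * u0 * v0)).
  by rewrite !lt_min e10 M1 /=; do 2 apply: mulr_gt0 => //.
have e50 : 0 < Num.min e2 (max2 P * v0) by rewrite lt_min e20 /=; exact: mulr_gt0.
have [k1 k1P] := small1 _ e30; have [k2 k2P] := small2 _ e50.
exists (k1 + k2)%N => k kk.
have := k1P k ltac:(clear -kk; lia); have := k2P k ltac:(clear -kk; lia).
rewrite !le_min => /andP[w2e w2m] /and3P[w1e w1m w1mm].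
have W1 := width1_gt0 P (base k) (base k).
have W2 := width2_gt0 P (base k) (base k).
split.
- split.
  + apply: wins_rcons => // s sa.
    have soa := efix_hull j ls0 ls1; rewrite -/so in soa.
    exists (xo + width1 P (base k) (base k) * (s - so)).
      have d2 : `|width1 P (base k) (base k) * (s - so)| <= Num.min (xo - chull u0) (1 - xo).
        move: w1e; rewrite /e1 ler_pdivlMr ?mulr_gt0//; apply: le_trans.
        rewrite normrM gtr0_norm// ler_wpM2l ?(ltW W1)//.
        by rewrite (le_trans (ler_normB _ _))//; clear -jok sa soa; lra.
      move: d2; rewrite le_min !ler_norml => /andP[/andP[p1 q1] /andP[p2 q2]].
      by clear -jok p1 q1 p2 q2; apply/andP; split; lra.
    have := crunB u0 u1 (base k) (xo + width1 P (base k) (base k) * (s - so)) xo.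
    rewrite crun_baseword// => /eqP; rewrite subr_eq => /eqP ->.
    have := erunB ls (base k) s so; rewrite erun_baseword// => /eqP.
    rewrite subr_eq => /eqP ->; rewrite /offset1 /width1 -/xo -/so.
    by field; rewrite gt_eqF// cweight_gt0.
  + move=> y ya.
    have yoa := efix_hull j n0 nu1; rewrite -/yo in yoa.
    pose t := to + width2 P (base k) (base k) * (y - yo).
    exists ((t - 1) / v1 + 1).
      have d2 : `|width2 P (base k) (base k) * (y - yo)| <=
          Num.min (to - (1 - v1 * (1 - chull v0))) (1 - to).
        move: w2e; rewrite /e2 ler_pdivlMr ?mulr_gt0//; apply: le_trans.
        rewrite normrM gtr0_norm// ler_wpM2l ?(ltW W2)//.
        by rewrite (le_trans (ler_normB _ _))//; clear -jok ya yoa; lra.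
      rewrite -lerBlDr ler_pdivlMr// -lerBrDr subrr pmulr_lle0 ?invr_gt0//.
      move: d2; rewrite le_min !ler_norml => /andP[/andP[p1 q1] /andP[p2 q2]].
      by rewrite /t; clear -jok p1 q1 p2 q2; apply/andP; split; lra.
    rewrite -cats1 crun_cat.
    have -> : crun v0 v1 [:: true] ((t - 1) / v1 + 1) = t.
      by rewrite /= /cmap; field; rewrite gt_eqF.
    have := crunB v0 v1 (base k) t to.
    rewrite crun_baseword// => /eqP; rewrite subr_eq => /eqP ->.
    have := erunB nu (base k) y yo; rewrite erun_baseword// => /eqP.
    rewrite subr_eq => /eqP ->; rewrite /t /offset2 /width2 -/to -/yo.
    by field; rewrite gt_eqF// cweight_gt0.
- by rewrite width1_rconsr (le_trans _ w1m)// ler_piMr// ltW.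
- rewrite width2_rconsr ler_pdivrMr// (le_trans w2m)// ler_pM2l//.
  exact: v0_le_v1.
- rewrite width1_rconsr width2_rconsr.
  apply: (@le_trans _ _ ((max1 P * u0 * v0) * (max2 P))); last by rewrite le_eqVlt; apply/orP; left; apply/eqP; ring.
  apply: ler_pM.
  - by apply/ltW/mulr_gt0.
  - by apply/ltW/divr_gt0.
  - by rewrite (le_trans _ w1mm)// ler_piMr// ltW.
  by rewrite ler_pdivrMr// (le_trans w2m)// ler_pM2l// v0_le_v1.
Qed.

(* Changing the letter after [k1 + k] loops in [q] from [0] to [1] is what
   separates the landing points on the fold of different blocks. *)
Lemma matched_pairs m : exists k1, forall e rho : R, 0 < e -> 0 < rho ->
  exists H, forall k, exists p q, [/\ (size p + size q <= H * k.+1)%N,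
    exists q1, q = baseword m j (k1 + k) ++ true :: q1,
    forall s x, `|s| <= ehull ls -> chull u0 <= x <= 1 ->
      `|crun u0 u1 p x - (offset1 m + li * erun ls q s)| <= e * rho ^+ k &
    forall y t, `|y| <= ehull nu -> chull v0 <= t <= 1 ->
      `|crun v0 v1 q t - (offset2 m + mi * erun nu p y)| <= e * rho ^+ k].
Proof.
have [[ls0 lsv0 v0nu nuu0 u02] [u12 u11 v12 v11]] := consts_bounds P.
have [k1 k1P] := base_extendable m; exists k1 => e rho e0 r0.
have [c cP] := extendable_length P.
have e3 : 0 < e / 3 by rewrite divr_gt0.
have [H1 H1P] := geometric_rate c (u1_gt0 P) u11 r0 e3.
have [H2 H2P] := geometric_rate c (v1_gt0 P) v11 r0 e3.
exists (2 * (m + j.+1 * k1 + j.+1) + 1 + (H1 + H2))%N => k.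
have [p [q [pq sz]]] := extend_digits ((H1 + H2) * k.+1) (k1P (k1 + k)%N (leq_addr _ _)).
move: pq; set p' := _ ++ p; set q' := _ ++ q => pq.
have [c1 c2] := cP _ _ _ _ pq; have [[g1 g2] _ _ _] := pq.
have szp : size p' = (m + j.+1 * (k1 + k) + size p)%N by rewrite size_cat size_baseword.
have szq : size q' = ((m + j.+1 * (k1 + k)).+1 + size q)%N.
  by rewrite size_cat size_rcons size_baseword.
exists p', q'; split.
- by rewrite szp szq; clear -sz; nia.
- by exists q; rewrite /q' cat_rcons.
- move=> s x sa xh.
  apply: (le_trans (wins_residual (u0_gt0 P) u02 (u1_gt0 P) g1 sa xh)).
  rewrite -ler_pdivlMl// mulrA [3^-1 * e]mulrC.
  apply: (le_trans (cweight_le _ (u0_gt0 P) (u0_le_u1 P))).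
  by apply: H1P; rewrite mulSn; clear -c1 szp szq sz; nia.
- move=> y t ya th.
  apply: (le_trans (wins_residual (v0_gt0 P) (v0_lt2 P) (v1_gt0 P) g2 ya th)).
  rewrite -ler_pdivlMl// mulrA [3^-1 * e]mulrC.
  apply: (le_trans (cweight_le _ (v0_gt0 P) (v0_le_v1 P))).
  by apply: H2P; rewrite mulSn; clear -c2 szp szq sz; nia.
Qed.

End Pairs.

(** * Shadowing orbits *)

Section Shadowing.
Context {R : realType}.
Variable P : consts R.
Local Notation E := 'rV[R]_4.
Local Notation u0 := (u0 P).
Local Notation u1 := (u1 P).
Local Notation v0 := (v0 P).
Local Notation v1 := (v1 P).
Local Notation ls := (ls P).
Local Notation nu := (nu P).
Local Notation li := (li P).
Local Notation mi := (mi P).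
Implicit Types (f : E -> E) (z : E) (w : seq bool).

(** Written with the inverse branches in the unstable coordinates: the strip V_b is then the image
    of [[-2, 2]^2], and no division occurs. *)
Definition horseshoe f := forall b (x y s t : R),
  `|x| <= 2 -> `|y| <= 2 -> `|s| <= 2 -> `|t| <= 2 ->
  f (pt4 (cmap u0 u1 b x) (emap nu b y) s t) =
  pt4 x y (emap ls b s) (cmap v0 v1 b t).

Definition folded (a1 a2 d wd : R) (g1 g2 : R -> R) f := forall x y s t : R,
  `|x| <= d -> `|y| <= d -> `|s| <= 2 -> `|t - 1| <= wd ->
  f (pt4 x y s t) = pt4 (- x ^+ 2 + li * (s + g1 s - ehull ls) + 1)
    (- a1 * y ^+ 2 + mi^-1 * (t + g2 s - 1) + ehull nu) (a2 * x) y.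

(** [w] is the word still to be followed. The unstable errors share one bound, which grows by
    [nu^-1] per step; those of [x_s] and [y_s] shrink at different rates and are kept apart. *)
Definition near_state w (s t e h h' : R) z :=
  [/\ `|z 0 i0 - crun u0 u1 w 0| <= e, `|z 0 i1 - erun nu w 0| <= e,
      `|z 0 i2 - s| <= h & `|z 0 i3 - t| <= h'] /\
  [/\ `|z 0 i2| <= 2 & `|z 0 i3| <= 2].

(** The unstable coordinates coded by words stay this far inside [[-2, 2]], so an error up to this
    size remains in the range of [horseshoe]. *)
Definition margin := 2 + chull u0.

Lemma margin_gt0 : 0 < margin.
Proof.
by have /andP[h _] := chull_gtN2 (u0_gt0 P) (u0_lt2 P); rewrite /margin; lra.
Qed.

Lemma crun0_le w : `|crun u0 u1 w 0| <= 2 - margin.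
Proof.
have /andP[h h1] := chull_gtN2 (u0_gt0 P) (u0_lt2 P).
have := @crun_hull _ u0 u1 w 0 (u0_gt0 P) (u0_lt2 P) (u1_gt0 P) (u1_lt1 P).
rewrite ler01 andbT (ltW (lt_trans h1 _)) ?oppr_lt0// => /(_ isT) /andP[h2 h3].
by rewrite /margin ler_norml; apply/andP; split; lra.
Qed.

Lemma ehull_nu_le : ehull nu <= 2 - margin.
Proof.
rewrite /margin /chull /ehull; have -> : 2 - (2 - (1 - u0)^-1) = (1 - u0)^-1 by ring.
have := nu_u0 P; have := u0_lt2 P => u02 nuu.
by rewrite lef_pV2 ?posrE; lra.
Qed.

Lemma erun0_le w : `|erun nu w 0| <= 2 - margin.
Proof.
apply: le_trans ehull_nu_le; apply: erun_hull; rewrite ?nu_gt0 ?nu_lt1//.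
by rewrite normr0 ltW// ehull_gt0// nu_lt1.
Qed.

(** The second conclusion recovers the letter from the sign of [y_u] and keeps [|y_u|] away from [0]
    in the strips; the visits to the fold and the time averages are read from it. *)
Lemma near_state_step f b w s t e h h' z : horseshoe f -> 0 <= e ->
  near_state (b :: w) s t e h h' z -> nu^-1 * e <= margin ->
  [/\ near_state w (emap ls b s) (cmap v0 v1 b t) (nu^-1 * e) (ls * h)
        ((if b then v1 else v0) * h') (f z) &
      if b then 1 - 2 * nu <= z 0 i1 else z 0 i1 <= - (1 - 2 * nu)].
Proof.
move=> hf e0 [[h0 h1 h2 h3] [h4 h5]] em.
have [[ls0 lsv0 v0nu nuu0 u02] [u12 u11 v12 v11]] := consts_bounds P.
have u00 := u0_gt0 P; have v00 := v0_gt0 P; have n0 := nu_gt0 P.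
have v10 := v1_gt0 P; have u10 := u1_gt0 P.
pose ub := if b then u1 else u0; pose vb := if b then v1 else v0.
have ub0 : 0 < ub by rewrite /ub; case: (b).
have vb0 : 0 < vb by rewrite /vb; case: (b).
have nuub : nu <= ub by rewrite /ub; case: (b); clear -nuu0 u02 u12; lra.
pose x := if b then (z 0 i0 - 1) / u1 + 1 else (z 0 i0 + 1) / u0.
pose y := (z 0 i1 - (if b then 1 else -1)) / nu.
have xE : cmap u0 u1 b x = z 0 i0.
  by rewrite /cmap /x; case: (b); field; rewrite gt_eqF.
have yE : emap nu b y = z 0 i1.
  by rewrite /emap /y; field; rewrite gt_eqF.
have xe : `|x - crun u0 u1 w 0| <= nu^-1 * e.
  have : ub * (x - crun u0 u1 w 0) = z 0 i0 - crun u0 u1 (b :: w) 0.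
    by rewrite -xE /= /cmap /ub; case: (b); ring.
  move=> E1; rewrite -E1 normrM (gtr0_norm ub0) in h0.
  rewrite ler_pdivlMl//; apply: le_trans h0; exact: ler_wpM2r.
have ye : `|y - erun nu w 0| <= nu^-1 * e.
  have : nu * (y - erun nu w 0) = z 0 i1 - erun nu (b :: w) 0.
    by rewrite -yE /= /emap; ring.
  move=> E1; rewrite -E1 normrM (gtr0_norm n0) in h1.
  by rewrite ler_pdivlMl.
have x2 : `|x| <= 2.
  have := crun0_le w; have := ler_normD (x - crun u0 u1 w 0) (crun u0 u1 w 0).
  by rewrite subrK; clear -xe em; lra.
have y2 : `|y| <= 2.
  have := erun0_le w; have := ler_normD (y - erun nu w 0) (erun nu w 0).
  by rewrite subrK; clear -ye em; lra.
have fz : f z = pt4 x y (emap ls b (z 0 i2)) (cmap v0 v1 b (z 0 i3)).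
  by rewrite -hf// xE yE -pt4_eta.
split; last first.
  rewrite -yE /emap; move: (y) y2 => y'; rewrite ler_norml.
  by case: (b) => /andP[y0 y2]; clear -n0 y0 y2; nra.
rewrite fz; split; last first.
  split; rewrite mxE /=; first by apply: emap_le2 => //; exact: ls_lt2.
  by apply: cmap_le2 => //; exact: v0_lt2.
split; rewrite mxE //=.
- have -> : emap ls b (z 0 i2) - emap ls b s = ls * (z 0 i2 - s).
    by rewrite /emap; ring.
  by rewrite normrM (gtr0_norm ls0) ler_pM2l.
- have -> : cmap v0 v1 b (z 0 i3) - cmap v0 v1 b t = vb * (z 0 i3 - t).
    by rewrite /cmap /vb; case: (b); ring.
  by rewrite normrM (gtr0_norm vb0) ler_pM2l.
Qed.

Lemma near_state_run f w1 w2 s t e h h' z : horseshoe f -> 0 <= e ->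
  near_state (w1 ++ w2) s t e h h' z -> nu^-1 ^+ size w1 * e <= margin ->
  near_state w2 (erun ls (rev w1) s) (crun v0 v1 (rev w1) t)
    (nu^-1 ^+ size w1 * e) (ls ^+ size w1 * h) (cweight v0 v1 w1 * h')
    (iter (size w1) f z).
Proof.
move=> hf; elim: w1 s t e h h' z => [|b w1 IH] s t e h h' z e0 zw em.
  by rewrite /= !expr0 /cweight big_nil !mul1r.
have n0 := nu_gt0 P; have n1 := nu_lt1 P.
have ni0 : 0 < nu^-1 by rewrite invr_gt0.
have ni1 : 1 <= nu^-1 by rewrite ltW// invf_gt1.
rewrite [size _]/= iterSr in em *.
have em1 : nu^-1 * e <= margin.
  apply: le_trans em; rewrite ler_wpM2r// exprS ler_peMr ?(ltW ni0)//.
  exact: exprn_ege1.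
have [zw' _] := near_state_step hf e0 zw em1.
have := IH _ _ _ _ _ _ _ zw'; rewrite rev_cons.
rewrite -cats1 /erun /crun !foldr_cat /= -/(erun _ _ _) -/(crun _ _ _ _).
rewrite !mulrA -!exprSr /cweight big_cons -/(cweight _ _ _).
rewrite [(if b then v1 else v0) * _]mulrC; apply => //.
by rewrite mulr_ge0// ltW.
Qed.

Lemma near_state_sign f b w s t e h h' z : horseshoe f -> 0 <= e ->
  near_state (b :: w) s t e h h' z -> nu^-1 * e <= margin ->
  if b then 1 - 2 * nu <= z 0 i1 else z 0 i1 <= - (1 - 2 * nu).
Proof. by move=> hf e0 zw em; have [] := near_state_step hf e0 zw em. Qed.

Section Orbit.
Variables (f : E -> E) (a1 a2 d wd : R) (g1 g2 : R -> R).
Variables (w : nat -> seq bool) (e h : nat -> R).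

Definition blow k := nu^-1 ^+ size (w k) * e k.
Definition Xw k := crun u0 u1 (w k) 0.
Definition Yw k := erun nu (w k) 0.
Definition Sw k := erun ls (rev (w k)) 0.
Definition Tw k := crun v0 v1 (rev (w k)) 0.

(* The [k]-th block of an orbit starts [e k]-close to [(Xw k, Yw k)] in the
   unstable coordinates and reaches the fold [blow k]-close to [(0, 0)] in them and
   close to [(Sw k, Tw k)] in the stable ones; by [sc_X] and [sc_Y] the fold maps
   [(0, 0, Sw k, Tw k)] exactly to the start of the next block. *)
Record scheme : Prop := Scheme {
  sc_horse : horseshoe f;
  sc_fold : folded a1 a2 d wd g1 g2 f;
  sc_a1 : 0 <= a1;
  sc_a2 : 0 <= a2;
  sc_g1 : forall s t, `|g1 s - g1 t| <= `|s - t|;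
  sc_g2 : forall s t, `|g2 s - g2 t| <= `|s - t|;
  sc_X : forall k, Xw k.+1 = 1 + li * (Sw k + g1 (Sw k) - ehull ls);
  sc_Y : forall k, Yw k.+1 = ehull nu + mi^-1 * (Tw k + g2 (Sw k) - 1);
  sc_T : forall k, `|Tw k - 1| <= wd / 2;
  sc_e : forall k, 0 < e k;
  sc_eh : forall k, e k <= h k;
  sc_h : forall k, h k <= wd / 2 /\ h k <= 2;
  sc_blow : forall k, [/\ blow k <= margin, blow k <= d & blow k < 1 - 2 * nu];
  sc_enext : forall k, (1 + a1) * blow k ^+ 2 +
    2 * (li + mi^-1) * (cweight v0 v1 (w k) * h k) <= e k.+1;
  sc_hnext : forall k, (1 + a2) * blow k <= h k.+1;
  sc_size : forall k, (size (w k) < size (w k.+1))%N;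
  sc_blow0 : blow k @[k --> \oo] --> 0;
  sc_h0 : h k @[k --> \oo] --> 0 }.

Hypothesis sch : scheme.

(** The added [1] counts the iterate on the fold. *)
Definition block_time k := \sum_(i < k) (size (w i)).+1.

Lemma block_timeS k : block_time k.+1 = (block_time k + (size (w k)).+1)%N.
Proof. by rewrite /block_time big_ord_recr. Qed.

Definition start_domain : set E := ball (pt4 (Xw 0) (Yw 0) 0 0) (e 0%N).

(** The fold squares the unstable error and adds the contracted stable one, doubled by the variation
    of [g1] and [g2] and multiplied by [li] or [mi^-1]. The new stable coordinates are [a2 * x_u]
    and [y_u], which is why [h k.+1] is compared with [blow k]. *)
Lemma fold_step k z : near_state [::] (Sw k) (Tw k) (blow k)
    (ls ^+ size (w k) * h k) (cweight v0 v1 (w k) * h k) z ->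
  near_state (w k.+1) 0 0 (e k.+1) (h k.+1) (h k.+1) (f z).
Proof.
have [[ls0 lsv0 v0nu nuu0 u02] [u12 u11 v12 v11]] := consts_bounds P.
have v00 := v0_gt0 P; have v10 := v1_gt0 P.
have l0 := li_gt0 P; have mi0 := mi_gt0 P.
have b0 : 0 < blow k.
  by rewrite mulr_gt0 ?exprn_gt0 ?invr_gt0 ?nu_gt0// sc_e.
have [bm bd bk] := sc_blow sch k; have hk0 : 0 < h k := lt_le_trans (sc_e sch k) (sc_eh sch k).
have [hw h2] := sc_h sch k.
have lsL : ls ^+ size (w k) <= cweight v0 v1 (w k).
  apply: le_trans (cweight_ge _ v00 (v0_le_v1 P)).
  by apply: lerXn2r; rewrite ?nnegrE ?ltW.
have L1 : cweight v0 v1 (w k) <= 1.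
  apply: le_trans (cweight_le _ v00 (v0_le_v1 P)) _.
  by rewrite exprn_ile1// ltW.
have L0 : 0 < cweight v0 v1 (w k) by apply: cweight_gt0.
set L := cweight _ _ _ in lsL L1 L0 *; set l := ls ^+ _ in lsL *.
move=> [[z0 z1 z2 z3] [z4 z5]].
rewrite /crun /= subr0 in z0; rewrite /erun /= subr0 in z1.
have t3 : `|z 0 i3 - 1| <= wd.
  have := ler_normD (z 0 i3 - Tw k) (Tw k - 1); rewrite subrKA.
  have := sc_T sch k; have : L * h k <= h k by rewrite ler_piMl// ltW.
  by move: z3 hw; clear -sch; lra.
have := sc_fold sch (le_trans z0 bd) (le_trans z1 bd) z4 t3.
rewrite -pt4_eta => ->; rewrite /near_state !mxE /= !subr0.
have a1g := sc_a1 sch; have a2g := sc_a2 sch.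
have x2 : `|z 0 i0 ^+ 2| <= blow k ^+ 2.
  by rewrite normrX; apply: lerXn2r => //; rewrite nnegrE ltW.
have y2 : `|z 0 i1 ^+ 2| <= blow k ^+ 2.
  by rewrite normrX; apply: lerXn2r => //; rewrite nnegrE ltW.
have en := sc_enext sch k; rewrite -/L in en.
have hn := sc_hnext sch k.
have mi'0 : 0 < mi^-1 by rewrite invr_gt0.
have sz : `|z 0 i2 - Sw k| <= L * h k.
  by apply: le_trans z2 _; rewrite ler_wpM2r// ltW.
have g1z : `|g1 (z 0 i2) - g1 (Sw k)| <= L * h k := le_trans (sc_g1 sch _ _) sz.
have g2z : `|g2 (z 0 i2) - g2 (Sw k)| <= L * h k := le_trans (sc_g2 sch _ _) sz.
have Lh0 : 0 <= L * h k by rewrite mulr_ge0 ?ltW.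
have b2 : 0 <= blow k ^+ 2 by rewrite exprn_ge0// ltW.
have bh : blow k <= h k.+1 by have : 0 <= a2 * blow k by [rewrite mulr_ge0// ltW]; clear -sch hn; lra.
have [_ h2n] := sc_h sch k.+1.
split; split.
- rewrite -/(Xw k.+1) (sc_X sch).
  have -> : - z 0 i0 ^+ 2 + li * (z 0 i2 + g1 (z 0 i2) - ehull ls) + 1 -
      (1 + li * (Sw k + g1 (Sw k) - ehull ls)) =
    - z 0 i0 ^+ 2 + li * ((z 0 i2 - Sw k) + (g1 (z 0 i2) - g1 (Sw k))) by ring.
  rewrite (le_trans (ler_normD _ _))// normrN [`|li * _|]normrM (gtr0_norm l0).
  have := ler_normD (z 0 i2 - Sw k) (g1 (z 0 i2) - g1 (Sw k)).
  set G := `|_ + _| => hG.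
  have : li * G <= li * (2 * (L * h k)) by rewrite ler_pM2l//; clear -sch hG sz g1z; lra.
  have : 0 <= a1 * blow k ^+ 2 by rewrite mulr_ge0.
  have : 0 <= mi^-1 * (L * h k) by rewrite mulr_ge0// ltW.
  by move: x2 en; clear -sch; rewrite !mulrDl !mulrDr; lra.
- rewrite -/(Yw k.+1) (sc_Y sch).
  have -> : - a1 * z 0 i1 ^+ 2 + mi^-1 * (z 0 i3 + g2 (z 0 i2) - 1) + ehull nu -
      (ehull nu + mi^-1 * (Tw k + g2 (Sw k) - 1)) =
    - (a1 * z 0 i1 ^+ 2) + mi^-1 * ((z 0 i3 - Tw k) + (g2 (z 0 i2) - g2 (Sw k))) by ring.
  rewrite (le_trans (ler_normD _ _))// normrN [`|a1 * _|]normrM [`|mi^-1 * _|]normrM.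
  rewrite (gtr0_norm mi'0) (ger0_norm a1g).
  have := ler_normD (z 0 i3 - Tw k) (g2 (z 0 i2) - g2 (Sw k)).
  set G := `|_ + _| => hG.
  have : mi^-1 * G <= mi^-1 * (2 * (L * h k)) by rewrite ler_pM2l//; clear -sch hG z3 g2z; lra.
  have : a1 * `|z 0 i1 ^+ 2| <= a1 * blow k ^+ 2 by rewrite ler_wpM2l.
  have : 0 <= li * (L * h k) by rewrite mulr_ge0// ltW.
  by move: b2 en; clear -sch; rewrite !mulrDl !mulrDr; lra.
- rewrite normrM (ger0_norm a2g) (le_trans _ hn)// mulrDl mul1r.
  by rewrite ler_wpDl ?(ltW b0)// ler_wpM2l.
- exact: le_trans bh.
- rewrite normrM (ger0_norm a2g) (le_trans _ h2n)// (le_trans _ hn)// mulrDl mul1r.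
  by rewrite ler_wpDl ?(ltW b0)// ler_wpM2l.
- exact: le_trans (le_trans z1 bh) h2n.
Qed.

Lemma domain_start x : start_domain x ->
  near_state (w 0) 0 0 (e 0%N) (h 0%N) (h 0%N) x.
Proof.
rewrite /start_domain -ball_normE /= => xD.
have c i : `|x 0 i - (pt4 (Xw 0) (Yw 0) 0 0) 0 i| <= e 0%N.
  rewrite distrC; apply: le_trans (ltW xD).
  by have := norm_coord_le (pt4 (Xw 0) (Yw 0) 0 0 - x) i; rewrite !mxE.
have eh := sc_eh sch 0; have [_ h2] := sc_h sch 0.
have := c i0; have := c i1; have := c i2; have := c i3; rewrite !mxE /= !subr0.
move=> c3 c2 c1 c0; rewrite /near_state !subr0.
by split; split => //; do ?[exact: le_trans eh]; apply: le_trans h2; exact: le_trans eh.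
Qed.

Lemma orbit_block_start x : start_domain x -> forall k,
  near_state (w k) 0 0 (e k) (h k) (h k) (iter (block_time k) f x).
Proof.
move=> xD; elim=> [|k IH]; first by rewrite /block_time big_ord0; exact: domain_start.
rewrite block_timeS addnS iterS [iter _ f _](_ : _ =
  iter (size (w k)) f (iter (block_time k) f x)); last by rewrite addnC iterD.
apply: fold_step; have [bm _ _] := sc_blow sch k.
have := @near_state_run f (w k) [::] 0 0 _ _ _ _ (sc_horse sch) (ltW (sc_e sch k)).
by rewrite cats0; apply.
Qed.

Lemma orbit_in_block x : start_domain x -> forall k i, (i <= size (w k))%N ->
  near_state (drop i (w k)) (erun ls (rev (take i (w k))) 0)
    (crun v0 v1 (rev (take i (w k))) 0) (blow k) (h k) (h k)
    (iter (block_time k + i) f x).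
Proof.
move=> xD k i ik; have n0 := nu_gt0 P; have n1 := nu_lt1 P.
have ni1 : 1 <= nu^-1 by rewrite ltW// invf_gt1.
have ek := sc_e sch k.
have sz : size (take i (w k)) = i by rewrite size_takel.
have le_blow : nu^-1 ^+ i * e k <= blow k.
  by rewrite ler_wpM2r ?(ltW ek)// ler_weXn2l.
have [bm _ _] := sc_blow sch k.
have := orbit_block_start xD k; rewrite -{1}(cat_take_drop i (w k)) => zk.
have := near_state_run (sc_horse sch) (ltW ek) zk; rewrite sz => /(_ (le_trans le_blow bm)).
rewrite addnC iterD => -[[h0 h1 h2 h3] h45]; split => //.
have hk0 : 0 <= h k := le_trans (ltW ek) (sc_eh sch k).
have [[ls0 lsv0 v0nu nuu0 u02] [u12 u11 v12 v11]] := consts_bounds P.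
split; rewrite ?(le_trans h0)// ?(le_trans h1)//.
  by rewrite (le_trans h2)// ler_piMl// exprn_ile1// ltW// ls_lt1.
rewrite (le_trans h3)// ler_piMl// (le_trans (cweight_le _ (v0_gt0 P) (v0_le_v1 P)))//.
by rewrite exprn_ile1// ltW// v1_gt0.
Qed.

End Orbit.
End Shadowing.

(** * Construction of the words and of the bumps *)

Section Words.
Implicit Types b : bool.

(* [0^L] if [b = false], and [(01)^(L/2)], followed by [0] if [L] is odd, if [b = true]. *)
Definition mid b L : seq bool := flatten (nseq L./2 [:: false; b]) ++ nseq (odd L) false.

Lemma size_mid b L : size (mid b L) = L.
Proof.
rewrite size_cat size_nseq size_flatten /shape map_nseq sumn_nseq /= mul2n.
by rewrite addnC odd_double_half.
Qed.

Lemma mid_false L : mid false L = nseq L false.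
Proof.
rewrite -{2}(odd_double_half L) addnC nseqD /mid; congr (_ ++ _).
by elim: L./2 => //= n ->.
Qed.

End Words.

Section Sizes.
Context {R : realType}.

Lemma cweight_le1 (v0 v1 : R) w : 0 < v0 -> v0 <= v1 -> v1 <= 1 -> cweight v0 v1 w <= 1.
Proof.
move=> v00 v01 v11; apply: le_trans (cweight_le w v00 v01) _.
by rewrite exprn_ile1// (le_trans (ltW v00)).
Qed.

(** Every second letter is [0], so each pair weighs at most [v0 * v1]. As [v0 * v1 < nu ^+ 2], the
    contraction of [y_s] over a middle part beats the strongest expansion. *)
Lemma cweight_mid (v0 v1 : R) b L : 0 < v0 -> v0 <= v1 -> v1 <= 1 ->
  cweight v0 v1 (mid b L) <= (v0 * v1) ^+ L./2.
Proof.
move=> v00 v01 v11; have v10 := lt_le_trans v00 v01.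
rewrite cweight_cat -[leRHS]mulr1; apply: ler_pM; rewrite ?(ltW (cweight_gt0 _ _ _))//; last first.
  exact: cweight_le1.
elim: L./2 => [|n IH]; first by rewrite /cweight big_nil expr0.
rewrite (_ : flatten _ = [:: false; b] ++ flatten (nseq n [:: false; b]))//.
rewrite cweight_cat exprS; apply: ler_pM; rewrite ?(ltW (cweight_gt0 _ _ _))//.
rewrite /cweight !big_cons big_nil mulr1 ler_pM2l//.
by case: (b).
Qed.

(* If the [N]-th block has length [N ^ 2] and radius [nu ^+ (3 * N ^ 2)] at its
   start, then its radius is [nu ^+ (2 * N ^ 2)] at the fold, which squares it; this
   is smaller than the next radius because [4 * N ^ 2] exceeds [3 * N.+1 ^ 2]. *)
Lemma size_constants (nu th a1 a2 c d wd mg : R) (H : nat) :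
  0 < nu -> nu < 1 -> 0 < th -> th < 1 -> 0 <= a1 -> 0 <= a2 -> 0 < c ->
  0 < d -> 0 < wd -> 0 < mg ->
  exists K, forall N, (K <= N)%N ->
  [/\ nu ^+ (2 * N.+1 ^ 2) <= Num.min d mg / 2,
      (1 + a2) * nu ^+ (2 * N ^ 2) <= Num.min (wd / 2) 2,
      (2 * H * N.+1 <= N.+1 ^ 2)%N &
      forall L0 l, (N.+1 ^ 2 <= l.*2.+1 + 2 * H * N.+1)%N ->
        0 <= L0 -> L0 <= (th * nu ^+ 2) ^+ l ->
        (1 + a1) * nu ^+ (4 * N.+1 ^ 2) + c * (L0 * nu ^+ (2 * N ^ 2)) <=
        nu ^+ (3 * N.+2 ^ 2)].
Proof.
move=> n0 n1 t0 t1 a10 a20 c0 d0 wd0 mg0.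
have e1 : 0 < Num.min d mg / 2 by rewrite divr_gt0// lt_min d0.
have [K1 K1P] := expr_lt_eps (ltW n0) n1 e1.
have a2' : 0 < 1 + a2 by lra.
have e2 : 0 < Num.min (wd / 2) 2 / (1 + a2).
  by rewrite divr_gt0// lt_min ltr0n andbT divr_gt0.
have [K2 K2P] := expr_lt_eps (ltW n0) n1 e2.
have a1' : 0 < 2 * (1 + a1) by lra.
have e3 : 0 < (2 * (1 + a1))^-1 by rewrite invr_gt0.
have [K3 K3P] := expr_lt_eps (ltW n0) n1 e3.
(* [3 * N.+2 ^ 2] is [3 * N ^ 2 + 12 * N.+1], and up to [2 * H * N.+1] letters lie outside the
   middle part; the gain [th ^+ l], with [l] quadratic in [N], pays for both. *)
have e4 : 0 < nu ^+ (12 + 2 * H) / 2 by rewrite divr_gt0// exprn_gt0.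
have [G GP] := expr_lt_eps (ltW t0) t1 e4.
have e5 : 0 < (2 * c)^-1 by rewrite invr_gt0 mulr_gt0.
have h0 : 0 <= (2^-1 : R) by rewrite invr_ge0.
have h1 : (2^-1 : R) < 1 by rewrite invf_lt1// ltr1n.
have [K5 K5P] := expr_lt_eps h0 h1 e5.
exists (K1 + K2 + K3 + K5 + 7 + 2 * H + 2 * G + 1)%N => N KN; split.
- apply/ltW/K1P; move: KN; clear; nia.
- rewrite mulrC -ler_pdivlMr//; apply/ltW/K2P; move: KN; clear; nia.
- move: KN; clear; nia.
move=> L0 l lN L00 L0l.
have i1 : (1 + a1) * nu ^+ (4 * N.+1 ^ 2) <= 2^-1 * nu ^+ (3 * N.+2 ^ 2).
  have -> : (4 * N.+1 ^ 2 = 3 * N.+2 ^ 2 + (4 * N.+1 ^ 2 - 3 * N.+2 ^ 2))%N.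
    by move: KN; clear; nia.
  have : nu ^+ (4 * N.+1 ^ 2 - 3 * N.+2 ^ 2) < (2 * (1 + a1))^-1.
    by apply: K3P; move: KN; clear; nia.
  rewrite exprD; set A := nu ^+ (3 * _); set B := nu ^+ _ => Blt.
  have A0 : 0 <= A by rewrite exprn_ge0// ltW.
  rewrite mulrCA [leRHS]mulrC ler_wpM2l//.
  have -> : 2^-1 = (1 + a1) * (2 * (1 + a1))^-1 :> R.
    by field; rewrite gt_eqF//; lra.
  by apply: ler_wpM2l; [lra|exact: ltW].
have i2 : c * (L0 * nu ^+ (2 * N ^ 2)) <= 2^-1 * nu ^+ (3 * N.+2 ^ 2).
  have lG : (G * N.+1 <= l)%N by move: KN lN; clear; rewrite -addnn; nia.
  have thl : th ^+ l <= nu ^+ ((12 + 2 * H) * N.+1) * 2^-1 ^+ N.+1.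
    apply: (@le_trans _ _ (th ^+ (G * N.+1))).
      by apply: ler_wiXn2l; rewrite ?(ltW t0) ?(ltW t1).
    rewrite exprM [nu ^+ _]exprM -exprMn; apply: lerXn2r.
    + by rewrite nnegrE exprn_ge0// ltW.
    + by rewrite nnegrE mulr_ge0// exprn_ge0// ltW.
    + by apply/ltW/GP.
  have nul : (nu ^+ 2) ^+ l <= nu ^+ (N ^ 2 - 2 * H * N.+1).
    rewrite -exprM; apply: ler_wiXn2l; rewrite ?(ltW n0) ?(ltW n1)//.
    by move: lN KN; clear; rewrite -addnn; nia.
  have L0le : L0 <= nu ^+ ((12 + 2 * H) * N.+1) * 2^-1 ^+ N.+1 *
      nu ^+ (N ^ 2 - 2 * H * N.+1).
    apply: le_trans L0l _; rewrite exprMn; apply: ler_pM => //.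
      by rewrite exprn_ge0// ltW.
    by rewrite !exprn_ge0// ltW.
  have c5 : c * 2^-1 ^+ N.+1 <= 2^-1.
    have : 2^-1 ^+ N.+1 < (2 * c)^-1 by apply: K5P; move: KN; clear; nia.
    rewrite invfM => h; rewrite mulrC -ler_pdivlMr//; exact: ltW.
  apply: (@le_trans _ _ (c * (nu ^+ ((12 + 2 * H) * N.+1) * 2^-1 ^+ N.+1 *
      nu ^+ (N ^ 2 - 2 * H * N.+1) * nu ^+ (2 * N ^ 2)))).
    by rewrite ler_pM2l// ler_wpM2r// exprn_ge0// ltW.
  have -> : c * (nu ^+ ((12 + 2 * H) * N.+1) * 2^-1 ^+ N.+1 *
      nu ^+ (N ^ 2 - 2 * H * N.+1) * nu ^+ (2 * N ^ 2)) = c * 2^-1 ^+ N.+1 *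
      (nu ^+ ((12 + 2 * H) * N.+1) * nu ^+ (N ^ 2 - 2 * H * N.+1) * nu ^+ (2 * N ^ 2)).
    by ring.
  rewrite -!exprD.
  have -> : ((12 + 2 * H) * N.+1 + (N ^ 2 - 2 * H * N.+1) + 2 * N ^ 2 = 3 * N.+2 ^ 2)%N.
    by move: KN; clear; nia.
  by rewrite ler_wpM2r// exprn_ge0// ltW.
by move: i1 i2; lra.
Qed.

End Sizes.

Section SchemeConstruction.
Context {R : realType}.

Lemma geometric_half_sum N : \sum_(0 <= k < N) 2^-1 ^+ k <= 2 :> R.
Proof.
suff -> : \sum_(0 <= k < N) 2^-1 ^+ k = 2 - 2 * 2^-1 ^+ N :> R.
  by rewrite gerBl mulr_ge0// exprn_ge0// invr_ge0.
elim: N => [|N IH]; first by rewrite big_geq// expr0; ring.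
by rewrite big_nat_recr//= IH exprS; lra.
Qed.

Lemma nu_pow_cvg0 (v c : R) (n : nat -> nat) : 0 < v -> v < 1 -> (forall k, (k <= n k)%N) ->
  (c * v ^+ n k) @[k --> \oo] --> (0 : R).
Proof.
move=> v0 v1 kn; apply/cvgr0Pnorm_le => e e0.
have [m0 m0P] := expr_mul_le_eps c v0 v1 e0.
exists m0 => // k /= mk; rewrite mulrC; apply: m0P; exact: leq_trans (kn k).
Qed.

Variable P : consts R.
Local Notation u0 := (u0 P).
Local Notation u1 := (u1 P).
Local Notation v0 := (v0 P).
Local Notation v1 := (v1 P).
Local Notation ls := (ls P).
Local Notation nu := (nu P).
Local Notation li := (li P).
Local Notation mi := (mi P).

Definition words_shape (ty : nat -> bool) (w : nat -> seq bool) := exists H N0 : nat,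
  (0 < N0)%N /\ forall k, size (w k) = ((k + N0) ^ 2)%N /\
    exists a c L, w k = a ++ mid (ty k) L ++ c /\ (size a + size c <= H * (k + N0))%N.

(** The two words agree on the first [m + j.+1 * k] letters and then read [1] and [0]; the images of
    the attractor under the two branches of [emap ls] are [2 * (2 - ehull ls)] apart. *)
Lemma baseword_separated m j k l q q' s s' : (k < l)%N ->
  `|s| <= ehull ls -> `|s'| <= ehull ls ->
  2 * ((2 - ehull ls) * ls ^+ (m + j.+1 * k)) <=
  `|erun ls (baseword m j k ++ true :: q) s - erun ls (baseword m j l ++ q') s'|.
Proof.
move=> kl sa sa'; have ls0 := ls_gt0 P; have ls1 := ls_lt1 P.
rewrite -(subnKC kl) addSnnS baseword_add -catA.
rewrite 2!(erun_cat _ (baseword m j k)) erunB size_baseword.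
rewrite normrM ger0_norm ?exprn_ge0 ?(ltW ls0)// mulrA mulrC ler_pM2l ?exprn_gt0//.
have [q2 ->] : exists q2, flatten (nseq (l - k.+1).+1 (loop j)) ++ q' = false :: q2.
  by eexists.
set t := erun ls q s; rewrite [erun ls (true :: q) s]/= -/(erun ls q s) -/t.
rewrite [erun ls (false :: q2) s']/= -/(erun ls q2 s'); set t' := erun ls q2 s'.
have ta : `|t| <= ehull ls by exact: erun_hull.
have ta' : `|t'| <= ehull ls by exact: erun_hull.
have fx := ehull_fix ls1; rewrite /emap.
have h1 : - (ls * ehull ls) <= ls * t.
  by rewrite -mulrN ler_pM2l//; move: ta; rewrite ler_norml => /andP[].
have h2 : ls * t' <= ls * ehull ls.
  by rewrite ler_pM2l//; move: ta'; rewrite ler_norml => /andP[].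
by rewrite ler_normr; apply/orP; left; lra.
Qed.

(** The words and the bumps are constructed before the map [f], which is to be the perturbation of
    [F] by these very bumps. The order of the constants matters: the radii [rho] precede the
    precision [e0 * rate ^+ k], and this precedes [H] and the lengths of the words. *)
Lemma scheme_exists (a1 a2 d wd : R) r (ty : nat -> bool) :
  0 <= a1 -> 0 <= a2 -> 0 < d -> 0 < wd -> forall eta, 0 < eta ->
  exists D1 D2 w e h, [/\ [/\ jet r D1 eta, jet r D2 eta &
      forall t, 2 * wd <= `|t - ehull ls| -> D1 0%N t = 0 /\ D2 0%N t = 0],
    forall f, horseshoe P f -> folded P a1 a2 d wd (D1 0%N) (D2 0%N) f ->
      scheme P f a1 a2 d wd (D1 0%N) (D2 0%N) w e h &
    words_shape ty w].
Proof.
move=> a10 a20 d0 wd0 eta1 eta10.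
have [[ls0 lsv0 v0nu nuu0 u02] [u12 u11 v12 v11]] := consts_bounds P.
have u00 := u0_gt0 P; have v00 := v0_gt0 P; have n0 := nu_gt0 P.
have v10 := v1_gt0 P; have u10 := u1_gt0 P.
have ls1 := ls_lt1 P; have nu1 := nu_lt1 P; have ls2 := ls_lt2 P; have nu2 := nu_lt2 P.
have l0 := li_gt0 P; have mi0 := mi_gt0 P.
have /andP[as1 as2] := ehull_lt2 ls0 ls2.
pose eta := Num.min eta1 1.
have eta0 : 0 < eta by rewrite lt_min eta10 ltr01.
have eta_le1 : eta <= 1 by rewrite /eta ge_min lexx orbT.
have eta_le : eta <= eta1 by rewrite /eta ge_min lexx.
clearbody eta; have [j jok] := base_ok_exists P.
have [Cp Cp0 pl] := @plateau_at R r.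
have [PL0 [jPL0 PL01 PL00]] := pl (ehull ls) _ wd0.
set C0 := (X in jet r PL0 X) in jPL0; have C00 := jet_ge0 jPL0; clearbody C0.
(* Even after a division by [li], an offset error below [tol] gives a plateau of C^r size at most
   [eta / 2]. *)
pose tol := eta / (2 * (C0 + 1)) * Num.min li 1.
have C01 : 0 < 2 * (C0 + 1) by rewrite mulr_gt0//; clear -C00; lra.
have min0 : 0 < Num.min li 1 by rewrite lt_min l0 ltr01.
have tol0 : 0 < tol by rewrite mulr_gt0// divr_gt0.
have [m1 m1P] := offsets_limit P j tol0.
have [m2 m2P] := expr_mul_le_eps (2 * ehull ls) ls0 ls1 wd0.
have wd2 : 0 < wd / 2 by rewrite divr_gt0.
have [m3 m3P] := expr_mul_le_eps 3 v10 v11 wd2.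
pose m := (m1 + m2 + m3)%N.
have [off1 off2] : `|offset1 P j m - (1 - li * ehull ls)| <= tol /\
    `|offset2 P j m - (1 - mi * ehull nu)| <= tol by apply: m1P; rewrite /m -addnA leq_addr.
have {m2P} lsm : `|ls ^+ m * (2 * ehull ls)| <= wd.
  by apply: m2P; rewrite /m addnAC leq_addl.
have {m3P} v1m : `|v1 ^+ m * 3| <= wd / 2 by apply: m3P; rewrite /m leq_addl.
clearbody m.
have [k1 mp] := matched_pairs jok m.
pose A := offset1 P j m; pose B := offset2 P j m.
(* Shifts of [x_s] and [y_s] that replace the constants of the unperturbed fold by [A] and [B]. *)
pose dl1 := (A - 1) / li + ehull ls; pose dl2 := 1 - mi * ehull nu - B.
have dl_le c : `|c| * Num.min li 1 <= tol -> `|c| * C0 <= eta / 2.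
  rewrite /tol ler_pM2r// ler_pdivlMr// => h.
  have := normr_ge0 c; rewrite mulrA mulrDr mulr1 in h; clear -h C00 => c0.
  by rewrite ler_pdivlMr//; lra.
have dl1C : `|dl1| * C0 <= eta / 2.
  apply: dl_le; apply: le_trans off1.
  have -> : offset1 P j m - (1 - li * ehull ls) = dl1 * li.
    by rewrite /dl1 /A; field; rewrite gt_eqF.
  by rewrite normrM (gtr0_norm l0) ler_wpM2l// ge_min lexx.
have dl2C : `|dl2| * C0 <= eta / 2.
  apply: dl_le; apply: le_trans off2.
  have -> : offset2 P j m - (1 - mi * ehull nu) = - dl2 by rewrite /dl2 /B; ring.
  by rewrite normrN ler_piMr// ge_min lexx orbT.
clear off1 off2 m1P tol0 tol dl_le.
pose rho0 := Num.min (2 - ehull ls) (Num.min (wd / 2) 1).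
have rho00 : 0 < rho0 by rewrite !lt_min subr_gt0 as2 wd2 ltr01.
have [rho0a rho0w rho01] : [/\ rho0 <= 2 - ehull ls, rho0 <= wd / 2 & rho0 <= 1].
  by rewrite /rho0 !ge_min !lexx !orbT.
clearbody rho0.
(* Radius of the bump at [Sw P w k]. By [baseword_separated] the other centres are at distance at
   least [2 * rho k], where this bump vanishes. *)
pose rho k := rho0 * ls ^+ (m + j.+1 * (k1 + k)).
have rho_gt0 k : 0 < rho k by rewrite mulr_gt0// exprn_gt0.
have rho_le k : rho k <= rho0.
  by rewrite ler_piMr ?(ltW rho00)// exprn_ile1// ltW.
have rho_le1 k : rho k <= 1 by exact: le_trans (rho_le k) rho01.
(* Compensates the [r.+1] powers of the radius lost in the C^r size; the factor [1/2] makes the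
   series of bumps converge. *)
pose rate := (ls ^+ j.+1) ^+ r.+1 / 2.
have rate0 : 0 < rate by rewrite divr_gt0// !exprn_gt0.
pose cst := Cp * (2 / rho 0%N) ^+ r.+1.
have cst0 : 0 <= cst by rewrite mulr_ge0// exprn_ge0// divr_ge0// ltW.
have bump_const k : (1 + (rho k)^-1) ^+ r.+1 * Cp * rate ^+ k <= cst * 2^-1 ^+ k.
  have ri : 1 <= (rho k)^-1 by rewrite invf_ge1.
  apply: (@le_trans _ _ ((2 / rho k) ^+ r.+1 * Cp * rate ^+ k)).
    rewrite ler_wpM2r ?exprn_ge0 ?(ltW rate0)// ler_wpM2r//.
    apply: lerXn2r; rewrite ?nnegrE; first by rewrite addr_ge0// invr_ge0 ltW.
      by rewrite divr_ge0// ltW.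
    by rewrite [2 / _]mulrDl mul1r lerD2r.
  have rhoE : rho k = rho 0%N * (ls ^+ j.+1) ^+ k.
    by rewrite /rho -mulrA -exprM -exprD; congr (_ * _ ^+ _); clear; lia.
  rewrite le_eqVlt; apply/orP; left; apply/eqP.
  rewrite rhoE invfM mulrA /cst; set c := 2 / rho 0%N; rewrite /rate; set x := ls ^+ j.+1.
  have x0 : x != 0 by rewrite gt_eqF// exprn_gt0.
  clearbody x.
  rewrite [(c / _) ^+ _]expr_div_n [(_ / 2) ^+ k]expr_div_n exprVn.
  have -> : (x ^+ k) ^+ r.+1 = (x ^+ r.+1) ^+ k by rewrite -!exprM mulnC.
  have Z0 : (x ^+ r.+1) ^+ k != 0 by do 2 apply: expf_neq0.
  have T0 : (2 : R) ^+ k != 0 by rewrite expf_neq0// pnatr_eq0.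
  by field; rewrite T0 Z0.
(* The geometric series sums to at most [2] and the bumps may use [eta / 2], whence the [4];
   [Num.min li 1] is there because the first residual gets divided by [li]. *)
pose e0 := eta / (4 * (cst + 1)) * Num.min li 1.
have cst4 : 0 < 4 * (cst + 1) by rewrite mulr_gt0//; clear -cst0; lra.
have e00 : 0 < e0 by rewrite mulr_gt0// divr_gt0.
have [H mpH] := mp e0 rate e00 rate0.
clear mp; have mpH2 k : exists pq : seq bool * seq bool,
    [/\ (size pq.1 + size pq.2 <= H * k.+1)%N,
    exists q1, pq.2 = baseword m j (k1 + k) ++ true :: q1,
    forall s x, `|s| <= ehull ls -> chull u0 <= x <= 1 ->
      `|crun u0 u1 pq.1 x - (A + li * erun ls pq.2 s)| <= e0 * rate ^+ k &
    forall y t, `|y| <= ehull nu -> chull v0 <= t <= 1 ->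
      `|crun v0 v1 pq.2 t - (B + mi * erun nu pq.1 y)| <= e0 * rate ^+ k].
  by have [p [q pqP]] := mpH k; exists (p, q).
(* Pair [k] joins block [k] to block [k.+1]; block [k.+1] therefore starts with [p k], and block [0]
   has no prescribed prefix. *)
have [pq pqP] := choice mpH2; pose p k := (pq k).1; pose q k := (pq k).2.
pose pp k := if k is k'.+1 then p k' else [::].
have th0 : 0 < v0 * v1 / nu ^+ 2 by rewrite divr_gt0 ?mulr_gt0 ?exprn_gt0.
have th1 : v0 * v1 / nu ^+ 2 < 1.
  by rewrite ltr_pdivrMr ?exprn_gt0// mul1r; exact: v01_nu.
pose c := 2 * (li + mi^-1) * (1 + a2).
have c0 : 0 < c.
  have h1 : 0 < 1 + a2 by clear -a20; lra.
  by rewrite mulr_gt0// mulr_gt0// addr_gt0// invr_gt0.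
pose mg := Num.min (margin P) (1 - 2 * nu).
have mg0 : 0 < mg by rewrite lt_min margin_gt0; clear -nu2; lra.
have [K KP] := size_constants H n0 nu1 th0 th1 a10 a20 c0 d0 wd0 mg0.
pose L k := ((K + k).+1 ^ 2 - (size (pp k) + size (q k)))%N.
pose w k := pp k ++ mid (ty k) (L k) ++ rev (q k).
have szpq k : (size (pp k) + size (q k) <= 2 * H * (K + k).+1)%N.
  have : (size (p k) + size (q k) <= H * k.+1)%N by have [] := pqP k.
  have : (size (pp k) <= H * k)%N.
    by case: k => //= k; have [] := pqP k; rewrite -/(p k) -/(q k); clear; lia.
  by clear; nia.
have szpq2 k : (size (pp k) + size (q k) <= (K + k).+1 ^ 2)%N.
  by apply: leq_trans (szpq k) _; have [] := KP (K + k)%N (leq_addr _ _).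
have szw k : size (w k) = ((K + k).+1 ^ 2)%N.
  rewrite /w 2!size_cat size_mid size_rev /L; move: (szpq2 k); clear; lia.
have hull0 : chull u0 <= (0 : R) <= 1.
  have /andP[_ h] := chull_gtN2 u00 u02.
  by clear -h; apply/andP; split; lra.
have hull0v : chull v0 <= (0 : R) <= 1.
  have /andP[_ h] := chull_gtN2 v00 (v0_lt2 P).
  by clear -h; apply/andP; split; lra.
have ehl0 : `|0 : R| <= ehull ls by rewrite normr0 ltW// ehull_gt0.
have ehn0 : `|0 : R| <= ehull nu by rewrite normr0 ltW// ehull_gt0.
have wS k : exists2 x, chull u0 <= x <= 1 & Xw P w k.+1 = crun u0 u1 (p k) x.
  exists (crun u0 u1 (mid (ty k.+1) (L k.+1) ++ rev (q k.+1)) 0).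
    by apply: crun_hull.
  by rewrite /Xw /w crun_cat.
have wY k : exists2 y, `|y| <= ehull nu & Yw P w k.+1 = erun nu (p k) y.
  exists (erun nu (mid (ty k.+1) (L k.+1) ++ rev (q k.+1)) 0).
    by apply: erun_hull.
  by rewrite /Yw /w erun_cat.
have revw k : rev (w k) = q k ++ rev (pp k ++ mid (ty k) (L k)).
  by rewrite /w catA rev_cat revK.
have wSw k : exists2 s, `|s| <= ehull ls & Sw P w k = erun ls (q k) s.
  exists (erun ls (rev (pp k ++ mid (ty k) (L k))) 0); first exact: erun_hull.
  by rewrite /Sw revw erun_cat.
have wT k : exists2 t, chull v0 <= t <= 1 & Tw P w k = crun v0 v1 (q k) t.
  exists (crun v0 v1 (rev (pp k ++ mid (ty k) (L k))) 0).
    by apply: crun_hull => //; exact: v0_lt2.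
  by rewrite /Tw revw crun_cat.
have qE k : exists q1, q k = baseword m j (k1 + k) ++ true :: q1 by have [] := pqP k.
have Sas k : `|Sw P w k - ehull ls| <= wd.
  have [s sa ->] := wSw k; have [q1 ->] := qE k.
  rewrite /baseword -catA erun_cat; set t := erun ls (_ ++ _) s.
  have ta : `|t| <= ehull ls by exact: erun_hull.
  rewrite erun_nseq1// addrAC subrr sub0r normrN.
  apply: le_trans lsm; rewrite normrM [leRHS]normrM ler_wpM2l//.
  rewrite (le_trans (ler_normB _ _))// [leRHS]ger0_norm; last by rewrite mulr_ge0// ltW// ehull_gt0.
  by rewrite (gtr0_norm (ehull_gt0 ls1)); clear -ta; lra.
have Tas k : `|Tw P w k - 1| <= wd / 2.
  have [t ta ->] := wT k; have [q1 ->] := qE k.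
  rewrite /baseword -catA crun_cat; set t' := crun v0 v1 (_ ++ _) t.
  have /andP[t0 t1] : chull v0 <= t' <= 1 by apply: crun_hull => //; exact: v0_lt2.
  have /andP[h _] := chull_gtN2 v00 (v0_lt2 P).
  rewrite crun_nseq1 addrAC subrr sub0r normrN.
  apply: le_trans v1m; rewrite normrM [leRHS]normrM ler_wpM2l//.
  by rewrite [`|3|]ger0_norm// ler_norml; clear -t0 t1 h; apply/andP; split; lra.
have Ssep k l : k != l -> 2 * rho l <= `|Sw P w k - Sw P w l|.
  have wlog_sep a b : (a < b)%N -> 2 * rho a <= `|Sw P w a - Sw P w b|.
    move=> ab; have [s sa ->] := wSw a; have [s' sa' ->] := wSw b.
    have [q1 ->] := qE a; have [q2 ->] := qE b.
    have ab' : (k1 + a < k1 + b)%N by rewrite ltn_add2l.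
    apply: le_trans (baseword_separated m j q1 (true :: q2) ab' sa sa').
    by rewrite ler_pM2l// /rho ler_wpM2r// exprn_ge0// ltW.
  rewrite neq_ltn => /orP[] kl; last by rewrite distrC; exact: wlog_sep.
  apply: le_trans (wlog_sep _ _ kl); rewrite ler_pM2l// /rho ler_pM2l//.
  by apply: ler_wiXn2l; rewrite ?(ltW ls0) ?(ltW ls1)//; move: kl; clear; nia.
(* What [D1] and [D2] must add to [dl1] and [dl2] at [Sw P w k] for the fold to hit the start of the
   next block exactly. *)
pose ep1 k := (Xw P w k.+1 - A) / li - Sw P w k.
pose ep2 k := 1 + mi * (Yw P w k.+1 - ehull nu) - Tw P w k - dl2.
have ep1_le k : `|ep1 k| * Num.min li 1 <= e0 * rate ^+ k.
  have [x xh xE] := wS k; have [s sa sE] := wSw k.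
  have [_ _ h _] := pqP k; have := h s x sa xh; rewrite -/(p k) -/(q k) -xE -sE.
  have -> : Xw P w k.+1 - (A + li * Sw P w k) = ep1 k * li.
    by rewrite /ep1; field; rewrite gt_eqF.
  by rewrite normrM (gtr0_norm l0); apply: le_trans; rewrite ler_wpM2l// ge_min lexx.
have ep2_le k : `|ep2 k| * Num.min li 1 <= e0 * rate ^+ k.
  have [y yh yE] := wY k; have [t ta tE] := wT k.
  have [_ _ _ h] := pqP k; have := h y t yh ta; rewrite -/(p k) -/(q k) -yE -tE.
  have -> : Tw P w k - (B + mi * Yw P w k.+1) = - ep2 k by rewrite /ep2 /dl2; ring.
  by rewrite normrN; apply: le_trans; rewrite ler_piMr// ge_min lexx orbT.
have [PL PLP] : exists PL : nat -> nat -> R -> R, forall k,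
    [/\ jet r (PL k) ((1 + (rho k)^-1) ^+ r.+1 * Cp),
        forall t, `|t - Sw P w k| <= rho k -> PL k 0%N t = 1 &
        forall t, 2 * rho k <= `|t - Sw P w k| -> PL k 0%N t = 0].
  have ex k := pl (Sw P w k) (rho k) (rho_gt0 k).
  by have [PL PLP] := choice ex; exists PL.
have jk (ep : nat -> R) k :
    jet r (fun jj t => ep k * PL k jj t) (`|ep k| * ((1 + (rho k)^-1) ^+ r.+1 * Cp)).
  by apply: jetZ; have [] := PLP k.
have sumC (ep : nat -> R) : (forall k, `|ep k| * Num.min li 1 <= e0 * rate ^+ k) ->
    forall N, series (fun k => `|ep k| * ((1 + (rho k)^-1) ^+ r.+1 * Cp)) N <= eta / 2.
  move=> ep_le N; rewrite /series /=.
  apply: (@le_trans _ _ (\sum_(0 <= k < N) eta / 4 * 2^-1 ^+ k)).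
    apply: ler_sum => k _.
    have epk : `|ep k| <= eta / (4 * (cst + 1)) * rate ^+ k.
      by move: (ep_le k); rewrite /e0 mulrAC ler_pM2r.
    have b0 : 0 <= (1 + (rho k)^-1) ^+ r.+1 * Cp.
      by rewrite mulr_ge0// exprn_ge0// addr_ge0// invr_ge0 ltW.
    apply: (@le_trans _ _ (eta / (4 * (cst + 1)) * (cst * 2^-1 ^+ k))).
      apply: le_trans (ler_wpM2r b0 epk) _.
      rewrite -[leLHS]mulrA ler_wpM2l ?(ltW (divr_gt0 eta0 cst4))//.
      by rewrite mulrC; exact: bump_const.
    rewrite mulrA ler_wpM2r ?exprn_ge0 ?invr_ge0//.
    rewrite mulrAC ler_pdivrMr// -mulrA; apply: ler_wpM2l; first exact: ltW.
    by clear; lra.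
  rewrite -mulr_sumr; have h := geometric_half_sum N.
  have -> : eta / 2 = eta / 4 * 2 by field.
  by apply: ler_wpM2l => //; rewrite divr_ge0// ltW.
pose mkD dl ep (jj : nat) (t : R) : R :=
  dl * PL0 jj t + jet_sum (fun k jj t => ep k * PL k jj t) jj t.
have mkD_jet dl ep : `|dl| * C0 <= eta / 2 ->
    (forall k, `|ep k| * Num.min li 1 <= e0 * rate ^+ k) -> jet r (mkD dl ep) eta.
  move=> dlC ep_le; apply: jet_le (jetD (jetZ dl jPL0) (jet_sum_jet (jk ep) (sumC _ ep_le))).
  by clear -dlC; lra.
have mkD_supp dl ep t : (forall k, `|ep k| * Num.min li 1 <= e0 * rate ^+ k) ->
    2 * wd <= `|t - ehull ls| -> mkD dl ep 0%N t = 0.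
  move=> ep_le tw; rewrite /mkD PL00// mulr0 add0r.
  have z k : PL k 0%N t = 0.
    have [_ _ ->] := PLP k => //.
    have := Sas k; have := rho_le k; have := rho0w.
    have := ler_normD (t - Sw P w k) (Sw P w k - ehull ls); rewrite subrKA.
    by move: tw; clear; lra.
  rewrite (jet_sum_single (jk ep) (sumC _ ep_le) (k0 := 0%N))// ?z ?mulr0// => k _.
  by rewrite z mulr0.
have mkD_at dl ep k : (forall k, `|ep k| * Num.min li 1 <= e0 * rate ^+ k) ->
    mkD dl ep 0%N (Sw P w k) = dl + ep k.
  move=> ep_le; rewrite /mkD PL01// mulr1; congr (_ + _).
  rewrite (jet_sum_single (jk ep) (sumC _ ep_le) (k0 := k))//.
    have [_ h _] := PLP k; rewrite h ?mulr1//.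
    by rewrite subrr normr0 ltW.
  move=> l lk; have [_ _ h] := PLP l; rewrite h ?mulr0//.
  by apply: Ssep; rewrite eq_sym.
pose e k := nu ^+ (3 * (K + k).+1 ^ 2).
pose h k := (1 + a2) * nu ^+ (2 * (K + k) ^ 2).
have blowE k : blow P w e k = nu ^+ (2 * (K + k).+1 ^ 2).
  rewrite /blow szw /e mulSn exprD mulrA -exprMn mulVf ?expr1n ?mul1r//.
  by rewrite gt_eqF.
have a2' : 1 <= 1 + a2 by clear -a20; lra.
have nle i i' : (i <= i')%N -> nu ^+ i' <= nu ^+ i.
  by move=> ii'; apply: ler_wiXn2l; rewrite ?(ltW n0) ?(ltW nu1).
exists (mkD dl1 ep1), (mkD dl2 ep2), w, e, h; split.
- split; [| |move=> t tw].
  + by apply: jet_le eta_le _; apply: mkD_jet.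
  + by apply: jet_le eta_le _; apply: mkD_jet.
  + by split; apply: mkD_supp.
- move=> f fh ff; split => //.
  + move=> s t; have := jet_lipschitz (mkD_jet _ _ dl1C ep1_le) s t (leq0n r).
    by move=> /le_trans; apply; rewrite ler_piMl.
  + move=> s t; have := jet_lipschitz (mkD_jet _ _ dl2C ep2_le) s t (leq0n r).
    by move=> /le_trans; apply; rewrite ler_piMl.
  + move=> k; rewrite mkD_at// /dl1 /ep1; field; by rewrite gt_eqF.
  + move=> k; rewrite mkD_at// /ep2; field; by rewrite gt_eqF.
  + by move=> k; rewrite exprn_gt0.
  + move=> k; apply: (@le_trans _ _ (nu ^+ (2 * (K + k) ^ 2))).
      by apply: nle; clear; nia.
    by rewrite ler_peMl// exprn_ge0// ltW.
  + move=> k; have [_ + _ _] := KP (K + k)%N (leq_addr _ _).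
    by rewrite le_min => /andP[].
  + move=> k; rewrite blowE; have [+ _ _ _] := KP (K + k)%N (leq_addr _ _).
    set x := nu ^+ _ => xle; have x0 : 0 < x by rewrite exprn_gt0.
    have : Num.min d mg <= d by rewrite ge_min lexx.
    have : Num.min d mg <= mg by rewrite ge_min lexx orbT.
    have : mg <= margin P by rewrite ge_min lexx.
    have : mg <= 1 - 2 * nu by rewrite ge_min lexx orbT.
    by move: xle x0; clear; split; lra.
  + move=> k; rewrite blowE -exprM mulnAC.
    have [_ _ _ big] := KP (K + k)%N (leq_addr _ _).
    have Lk : ((K + k).+1 ^ 2 <= (L k)./2.*2.+1 + 2 * H * (K + k).+1)%N.
      have := szpq k; have := odd_double_half (L k); rewrite /L.
      set x := (_ - _)%N; have : (x <= x./2.*2.+1)%N.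
        by rewrite -[in leqLHS](odd_double_half x); case: (odd x) => /=; clear; lia.
      rewrite /x; clear; lia.
    have cw0 := cweight_gt0 (w k) v00 v10.
    have cwL : cweight v0 v1 (w k) <= (v0 * v1 / nu ^+ 2 * nu ^+ 2) ^+ (L k)./2.
      rewrite divfK ?gt_eqF ?exprn_gt0//.
      have cm := cweight_mid (ty k) (L k) v00 (v0_le_v1 P) (ltW v11).
      apply: le_trans cm; rewrite /w cweight_cat cweight_cat mulrCA.
      rewrite ler_piMr ?(ltW (cweight_gt0 _ _ _))//.
      by rewrite mulr_ile1 ?(ltW (cweight_gt0 _ _ _))// cweight_le1// ?v0_le_v1// ltW.
    have := big _ _ Lk (ltW cw0) cwL; rewrite /e addnS; apply: le_trans.
    by rewrite le_eqVlt; apply/orP; left; apply/eqP; rewrite /c /h; ring.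
  + by move=> k; rewrite blowE /h addnS.
  + by move=> k; rewrite !szw addnS; clear; nia.
  + rewrite (_ : blow P w e = fun k => 1 * nu ^+ (2 * (K + k).+1 ^ 2)).
      by apply: nu_pow_cvg0 => // k; clear; nia.
    by apply/funext => k; rewrite blowE mul1r.
  + by apply: nu_pow_cvg0 => // k; clear; nia.
- exists (2 * H)%N, K.+1; split => // k.
  rewrite szw [(k + K.+1)%N]addnC addSn; split => //.
  exists (pp k), (rev (q k)), (L k); split => //.
  by rewrite size_rev szpq.
Qed.

End SchemeConstruction.

(** * The wandering domain *)

Section Wandering.
Context {R : realType}.
Local Notation E := 'rV[R]_4.
Variable P : consts R.
Variables (f : E -> E) (a1 a2 d wd : R) (g1 g2 : R -> R).
Variables (w : nat -> seq bool) (e h : nat -> R).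
Hypothesis sch : scheme P f a1 a2 d wd g1 g2 w e h.
Local Notation nu := (nu P).
Local Notation D := (start_domain P w e).
Local Notation blow := (blow P w e).
Local Notation time := (block_time w).

Lemma orbit_sign x : D x -> forall k i, (i < size (w k))%N ->
  if nth false (w k) i then 1 - 2 * nu <= (iter (time k + i) f x) 0 i1
  else (iter (time k + i) f x) 0 i1 <= - (1 - 2 * nu).
Proof.
move=> xD k i ik; have n0 := nu_gt0 P; have n1 := nu_lt1 P.
have ni0 : 0 < nu^-1 by rewrite invr_gt0.
have ni1 : 1 <= nu^-1 by rewrite ltW// invf_gt1.
have ek := sc_e sch k; have [bm _ _] := sc_blow sch k.
have le_blow l : (l <= size (w k))%N -> nu^-1 ^+ l * e k <= margin P.
  by move=> lk; apply: le_trans bm; rewrite ler_wpM2r ?(ltW ek)// ler_weXn2l.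
have := orbit_block_start sch xD k; rewrite -{1}(cat_take_drop i (w k)) => zk.
have := near_state_run (sc_horse sch) (ltW ek) zk.
rewrite size_takel ?(ltnW ik)// => /(_ (le_blow _ (ltnW ik))).
rewrite (drop_nth false ik) addnC iterD => z'.
apply: (near_state_sign (sc_horse sch) _ z').
  by rewrite mulr_ge0 ?(ltW ek)// exprn_ge0// ltW.
by rewrite mulrA -exprS le_blow.
Qed.

Lemma orbit_sign_norm x : D x -> forall k i, (i < size (w k))%N ->
  1 - 2 * nu <= `|(iter (time k + i) f x) 0 i1|.
Proof.
move=> xD k i ik; have := orbit_sign xD ik.
case: ifP => _ h1; rewrite ler_normr; apply/orP; [by left|right].
by rewrite lerNr.
Qed.

Lemma orbit_fold x : D x -> forall k,
  `|(iter (time k + size (w k)) f x) 0 i1| <= blow k.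
Proof.
move=> xD k; have [[_ + _ _] _] := orbit_in_block sch xD (leqnn (size (w k))).
by rewrite drop_size /erun /= subr0.
Qed.

Lemma time_mono k l : (k <= l)%N -> (time k <= time l)%N.
Proof.
move=> /subnKC <-; elim: (l - k)%N => [|n IH]; first by rewrite addn0.
by rewrite addnS block_timeS (leq_trans IH)// leq_addr.
Qed.

Lemma time_ge k : (k <= time k)%N.
Proof. by elim: k => // k IH; rewrite block_timeS addnS ltnS (leq_trans IH)// leq_addr. Qed.

Lemma time_decode t : exists k i, (i <= size (w k))%N /\ t = (time k + i)%N.
Proof.
elim: t => [|t [k [i [ik ->]]]]; first by exists 0%N, 0%N; rewrite /block_time big_ord0.
have [ilt|ige] := ltnP i (size (w k)); first by exists k, i.+1; rewrite addnS.
exists k.+1, 0%N; split => //; rewrite block_timeS addn0 addnS.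
by congr (_ + _).+1; apply/eqP; rewrite eqn_leq ik ige.
Qed.

Lemma fold_time_inj k i : (i <= size (w k))%N -> forall x, D x ->
  `|(iter (time k + i) f x) 0 i1| < 1 - 2 * nu -> i = size (w k).
Proof.
move=> ik x xD; apply: contraTeq => ine; rewrite -leNgt.
by apply: orbit_sign_norm => //; rewrite ltn_neqAle ine.
Qed.

Lemma size_mono k l : (k < l)%N -> (size (w k) < size (w l))%N.
Proof.
move=> /subnKC <-; elim: (l - k.+1)%N => [|n IH]; first by rewrite addn0; exact: sc_size sch k.
by rewrite addnS (ltn_trans IH)//; exact: sc_size sch _.
Qed.

Lemma size_ge k : (k <= size (w k))%N.
Proof. by elim: k => // k IH; apply: leq_ltn_trans IH _; exact: sc_size sch k. Qed.

(** If two iterates meet, injectivity makes some point of the domain the [m]-th iterate of another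
    one, with [m > 0]. Visits to the fold are recognised by [|y_u| < 1 - 2 * nu], so the visit times
    shifted by [m] are again visit times. But the gaps between visits increase strictly, and the gap
    between the first two visits cannot recur later. *)
Lemma wandering_disjoint : injective f ->
  forall i j : nat, i <> j -> iter i f @` D `&` iter j f @` D = set0.
Proof.
move=> finj.
have iterinj n : injective (iter n f).
  by elim: n => // n IH x y /= /finj /IH.
have main i j : (i < j)%N -> iter i f @` D `&` iter j f @` D = set0.
  move=> ij; rewrite -subset0 => z [[x xD <-] [y yD]].
  rewrite -(subnKC (ltnW ij)) iterD => /iterinj yx.
  set m := (j - i)%N in yx; have m0 : (0 < m)%N by rewrite subn_gt0.
  have shift k : exists b, (time k + size (w k) + m = time b + size (w b))%N.
    have [b [l [lb bE]]] := time_decode (time k + size (w k) + m).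
    exists b; rewrite bE; congr (_ + _)%N; apply: (fold_time_inj lb yD).
    rewrite -bE iterD yx; apply: le_lt_trans (orbit_fold xD k) _.
    by have [] := sc_blow sch k.
  have [a aE] := shift 0%N; have [b bE] := shift 1%N.
  have Fmono k l : (k <= l)%N -> (time k + size (w k) <= time l + size (w l))%N.
    rewrite leq_eqVlt => /orP[/eqP -> //|kl].
    by rewrite leq_add ?time_mono ?(ltnW kl)// ltnW// size_mono.
  have a0 : (0 < a)%N by case: (a) aE => // aE; move: m0; clear -aE; lia.
  have ab : (a < b)%N.
    rewrite ltnNge; apply/negP => /Fmono.
    have := Fmono 0%N 1%N isT; rewrite -aE -bE (block_timeS w 0) => h1.
    by move: (sc_size sch 0); clear; lia.
  have h1 := Fmono _ _ ab; rewrite -bE !block_timeS in h1.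
  have h2 : (size (w 1) < size (w a.+1))%N by exact: size_mono.
  by move: h1 h2 aE; clear; lia.
move=> i j /eqP; rewrite neq_ltn => /orP[ij|ji]; first exact: main.
by rewrite setIC; exact: main.
Qed.

Lemma orbit_diam x y : D x -> D y -> forall k i, (i <= size (w k))%N ->
  `|iter (time k + i) f x - iter (time k + i) f y| <= 2 * (blow k + h k).
Proof.
move=> xD yD k i ik.
have [[hx0 hx1 hx2 hx3] _] := orbit_in_block sch xD ik.
have [[hy0 hy1 hy2 hy3] _] := orbit_in_block sch yD ik.
have b0 : 0 <= blow k by apply: le_trans hx0.
have h0 : 0 <= h k by apply: le_trans hx2.
have tri (a b c r1 : R) : `|a - c| <= r1 -> `|b - c| <= r1 -> `|a - b| <= 2 * r1.
  rewrite !ler_norml => /andP[p1 q1] /andP[p2 q2].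
  by clear -sch p1 q1 p2 q2; apply/andP; split; lra.
apply: norm_row_le; first by rewrite mulr_ge0// addr_ge0.
apply: ord4_ind; rewrite !mxE.
- by rewrite (le_trans (tri _ _ _ _ hx0 hy0))// ler_pM2l// lerDl.
- by rewrite (le_trans (tri _ _ _ _ hx1 hy1))// ler_pM2l// lerDl.
- by rewrite (le_trans (tri _ _ _ _ hx2 hy2))// ler_pM2l// lerDr.
- by rewrite (le_trans (tri _ _ _ _ hx3 hy3))// ler_pM2l// lerDr.
Qed.

Lemma domain_center : D (pt4 (Xw P w 0) (Yw P w 0) 0 0).
Proof. by apply: ballxx; exact: sc_e sch 0. Qed.

Lemma domain_diam : diam (iter n f @` D) @[n --> \oo] --> 0%:E.
Proof.
have bh : (fun k => 2 * (blow k + h k)) @ \oo --> (0 : R).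
  have := cvgM (cvg_cst (2 : R)) (cvgD (sc_blow0 sch) (sc_h0 sch)).
  by rewrite addr0 mulr0; apply.
have main (ep : R) : 0 < ep -> \forall n \near \oo, (0 <= diam (iter n f @` D) <= ep%:E)%E.
  move=> ep0; have /cvgrPdist_le /(_ _ ep0) [k0 _ k0P] := bh.
  exists (time k0) => // n /= k0n; apply/andP; split.
    have cD : (iter n f @` D) (iter n f (pt4 (Xw P w 0) (Yw P w 0) 0 0)).
      by exists (pt4 (Xw P w 0) (Yw P w 0) 0 0) => //; exact: domain_center.
    apply: ereal_sup_ubound; eexists; eexists; split; [exact: cD|exact: cD|].
    by rewrite subrr normr0.
  apply: ge_ereal_sup => _ [_ [_ [[x xD <-] [y yD <-] ->]]].
  rewrite lee_fin; have [k [i [ik nE]]] := time_decode n.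
  have kk0 : (k0 <= k)%N.
    rewrite leqNgt; apply/negP => /time_mono; rewrite block_timeS => h1.
    by move: h1 ik k0n; rewrite nE; clear; lia.
  rewrite nE; apply: le_trans (orbit_diam xD yD ik) _.
  have := k0P _ kk0; rewrite /= sub0r normrN; apply: le_trans; exact: ler_norm.
apply/fine_cvgP; split.
  have := main 1 ltr01; apply: filterS => n /andP[d0 d1].
  rewrite ge0_fin_numE//; exact: le_lt_trans d1 (ltry _).
apply/cvgrPdist_le => ep ep0; have := main _ ep0; apply: filterS => n /andP[d0 d1] /=.
rewrite sub0r normrN ger0_norm ?fine_ge0// -lee_fin fineK//.
by rewrite ge0_fin_numE//; exact: le_lt_trans d1 (ltry _).
Qed.

Lemma domain_connected : connected D.
Proof.
rewrite /start_domain; set c := pt4 _ _ _ _; set r := e 0%N.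
have -> : ball c r = \bigcup_(x in ball c r) ((fun t : R => c + t *: (x - c)) @` `[0, 1]).
  rewrite eqEsubset; split=> [x xb|y [x xb [t]]].
    exists x => //; exists 1; first by rewrite /= in_itv /= ler01 lexx.
    by rewrite scale1r addrC subrK.
  rewrite /= in_itv /= => /andP[t0 t1] <-.
  move: xb; rewrite -ball_normE /= => xb.
  rewrite opprD addrA subrr sub0r normrN normrZ (ger0_norm t0).
  apply: le_lt_trans xb; rewrite [`|c - x|]distrC.
  by rewrite ler_piMl.
apply: bigcup_connected.
  exists c => x xb; exists 0; first by rewrite /= in_itv /= lexx ler01.
  by rewrite scale0r addr0.
move=> x xb; apply: connected_continuous_connected; first exact: segment_connected.
apply: continuous_subspaceT => t.
apply: (@cvgD _ _ _ _ _ (fun=> c) (fun t : R => t *: (x - c))); first exact: cvg_cst.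
exact: scalel_continuous.
Qed.

Lemma cluster_closed (u : nat -> E) z (A : set E) : cluster (u n @[n --> \oo]) z ->
  closed A -> (\forall n \near \oo, A (u n)) -> A z.
Proof.
move=> uz Ac uA; apply: Ac => B Bz; have := uz _ _ uA Bz; exact.
Qed.

Lemma orbit_bounded x : D x -> forall n, `|iter n f x| <= 2.
Proof.
move=> xD n; have [k [i [ik ->]]] := time_decode n.
have [[h0 h1 _ _] [h2 h3]] := orbit_in_block sch xD ik.
have [bm _ _] := sc_blow sch k.
apply: norm_row_le => //; apply: ord4_ind => //.
  have := ler_normD ((iter (time k + i) f x) 0 i0 - crun (u0 P) (u1 P) (drop i (w k)) 0)
    (crun (u0 P) (u1 P) (drop i (w k)) 0).
  rewrite subrK => /le_trans; apply; have := crun0_le P (drop i (w k)).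
  by move: h0 bm; clear -sch; lra.
have := ler_normD ((iter (time k + i) f x) 0 i1 - erun nu (drop i (w k)) 0)
  (erun nu (drop i (w k)) 0).
rewrite subrK => /le_trans; apply; have := erun0_le P (drop i (w k)).
by move: h1 bm; clear -sch; lra.
Qed.

(** Take an accumulation point of the visits to the fold: its [|y_u|] is at most [(1 - 2 * nu) / 2],
    whereas each later iterate is a limit of points in the strips and has [|y_u| >= 1 - 2 * nu]. So
    it never returns to itself. *)
Lemma fold_cluster : continuous f -> forall x, D x ->
  exists2 z, omega_limit f x z & forall m, (0 < m)%N -> iter m f z <> z.
Proof.
move=> fc x xD; pose u l := iter (time l + size (w l)) f x.
have iterc n : continuous (iter n f).
  elim: n => [|n IH] z; first exact: cvg_id.
  exact: (continuous_comp (IH z) (fc _)).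
have cK : compact [set z : E | `|z| <= 2].
  apply: bounded_closed_compact.
    exists 2; split; first exact: num_real.
    by move=> M M2 z /= /le_trans; apply; exact: ltW.
  apply: (@closed_comp _ _ (fun z : E => `|z|) [set y : R | y <= 2]).
    by move=> z _; exact: norm_continuous.
  exact: closed_le.
have [z [zK zu]] : exists z, [set z : E | `|z| <= 2] z /\ cluster (u l @[l --> \oo]) z.
  have [] := cK (u l @[l --> \oo]) _; last by move=> z []; exists z.
  by exists 0%N => // l _ /=; exact: orbit_bounded.
exists z.
  move=> A B [N _ NA] Bz; apply: zu Bz; exists N => // l /= Nl; apply: NA => /=.
  by rewrite (leq_trans Nl)// (leq_trans (time_ge l))// leq_addr.
have coordc (m : nat) : continuous (fun y : E => `|(iter m f y) 0 i1|).
  move=> y; apply: (continuous_comp (g := fun v : R => `|v|)); last exact: norm_continuous.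
  exact: (continuous_comp (iterc m y) (@coord_continuous _ _ _ 0 i1 _)).
have k00 : 0 < (1 - 2 * nu) / 2 by rewrite divr_gt0// subr_gt0; have := nu_lt2 P; lra.
have z1 : `|z 0 i1| <= (1 - 2 * nu) / 2.
  apply: (cluster_closed (A := [set y : E | `|y 0 i1| <= (1 - 2 * nu) / 2]) zu).
    apply: (@closed_comp _ _ (fun y : E => `|y 0 i1|) [set r | r <= _]); last exact: closed_le.
    by move=> y _; exact: (coordc 0%N).
  have /cvgrPdist_le /(_ _ k00) [k0 _ k0P] := sc_blow0 sch.
  exists k0 => // l /k0P /=; rewrite sub0r normrN => bl.
  apply: le_trans (orbit_fold xD l) _; apply: le_trans bl; exact: ler_norm.
move=> m m0 mz; suff : 1 - 2 * nu <= `|z 0 i1| by lra.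
rewrite -{1}mz.
apply: (cluster_closed (A := [set y : E | 1 - 2 * nu <= `|(iter m f y) 0 i1|]) zu).
  apply: (@closed_comp _ _ (fun y : E => `|(iter m f y) 0 i1|) [set r | _ <= r]); last exact: closed_ge.
  by move=> y _; exact: coordc.
exists m => // l /= ml; rewrite /u -iterD.
have -> : (m + (time l + size (w l)) = time l.+1 + m.-1)%N.
  by rewrite block_timeS; move: m0; clear; lia.
apply: orbit_sign_norm => //.
by have := size_ge l.+1; move: ml m0; clear; lia.
Qed.

Lemma contracting_wandering : continuous f -> injective f ->
  contracting_wandering_domain f D.
Proof.
move=> fc finj; split; last exact: domain_diam.
split; first by split; [exists (pt4 (Xw P w 0) (Yw P w 0) 0 0); exact: domain_center|
  exact: ball_open|exact: domain_connected].
  exact: wandering_disjoint.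
move=> [p [k [[k0 kp _] OE]]].
have [z zo zP] := fold_cluster fc domain_center.
have : (\bigcup_(x in D) omega_limit f x) z.
  by exists (pt4 (Xw P w 0) (Yw P w 0) 0 0) => //; exact: domain_center.
rewrite OE => -[i _ iz]; apply: (zP k k0).
by rewrite -iz -iterD addnC iterD kp.
Qed.

End Wandering.

(** * Empirical measures *)

Section OrbitMeasures.
Context {R : realType}.
Local Notation E := 'rV[R]_4.

Lemma continuous_measurable4 (phi : E -> R) : continuous phi ->
  measurable_fun [set: borel4 R] (phi : borel4 R -> R).
Proof.
move=> /continuousP phic; apply: (measurability _ (RGenOpens.measurableE R)).
move=> _ [_ [a [b ->]] <-]; rewrite setTI; apply: sub_sigma_algebra.
by apply: phic; exact: interval_open.
Qed.

Lemma integral_orbit_measure_ge0 (f : E -> E) x n (phi : E -> R) : continuous phi ->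
  (forall y, 0 <= phi y) ->
  (\int[orbit_measure f x n]_y (phi y)%:E = (n%:R^-1 * \sum_(i < n) phi (iter i f x))%:E)%E.
Proof.
move=> phic phi0; have phim := continuous_measurable4 phic.
have phimE : measurable_fun [set: borel4 R] (EFin \o (phi : borel4 R -> R)).
  exact/measurable_EFinP.
rewrite ge0_integral_mscale//; last by move=> y _; rewrite lee_fin.
rewrite ge0_integral_measure_sum//; last by move=> y _; rewrite lee_fin.
rewrite EFinM -sumEFin; congr (_ * _)%E; apply: eq_bigr => i _.
by rewrite integral_dirac// diracT mul1e.
Qed.

(** Adding the bound [M] reduces the claim to nonnegative integrands. *)
Lemma integral_orbit_measure (f : E -> E) x n (phi : E -> R) M : continuous phi ->
  (forall y, `|phi y| <= M) ->
  (\int[orbit_measure f x n]_y (phi y)%:E = (n%:R^-1 * \sum_(i < n) phi (iter i f x))%:E)%E.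
Proof.
move=> phic phiM; have M0 : 0 <= M := le_trans (normr_ge0 _) (phiM 0).
pose psi y := phi y + M; have psic : continuous psi.
  by move=> y; exact: (continuousD (phic y) (@cst_continuous E R M y)).
have psi0 y : 0 <= psi y.
  by have := phiM y; rewrite ler_norml /psi => /andP[h _]; rewrite -lerBlDr sub0r.
have cM : continuous (fun _ : E => M) by exact: cst_continuous.
have fin (g : E -> R) : continuous g -> (forall y, 0 <= g y) ->
    (orbit_measure f x n).-integrable setT (fun y : borel4 R => (g y)%:E).
  move=> gc g0; apply/integrableP; split.
    by apply/measurable_EFinP; exact: continuous_measurable4.
  rewrite (eq_integral (fun y : borel4 R => (g y)%:E)); last first.
    by move=> y _; rewrite gee0_abs// lee_fin.
  by rewrite integral_orbit_measure_ge0// ltry.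
have -> : (\int[orbit_measure f x n]_y (phi y)%:E =
    \int[orbit_measure f x n]_y ((psi y)%:E - M%:E))%E.
  by apply: eq_integral => y _; rewrite -EFinB /psi addrK.
rewrite integralB//; [|exact: fin|exact: fin].
rewrite !integral_orbit_measure_ge0// -EFinB -mulrBr -sumrB; congr (_ * _)%:E.
by apply: eq_bigr => i _; rewrite /psi addrK.
Qed.

Definition average (f : E -> E) (x : E) (phi : E -> R) m : R :=
  m.+1%:R^-1 * \sum_(i < m.+1) phi (iter i f x).

Lemma weak_cvg_fixed (f : E -> E) x p : 
  (forall phi : E -> R, continuous phi -> (exists M, forall y, `|phi y| <= M) ->
     average f x phi m @[m --> \oo] --> phi p) ->
  weak_cvg (empirical f x) (periodic_measure f p 1).
Proof.
move=> av phi phic [M phiM].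
rewrite /periodic_measure (integral_orbit_measure f p 1 phic phiM).
rewrite big_ord1 invr1 mul1r /=.
rewrite (_ : (fun m => _) = fun m => (average f x phi m)%:E); last first.
  by apply/funext => m; rewrite (integral_orbit_measure f x m.+1 phic phiM).
by apply/fine_cvgP; split; [exact: nearW|apply: av => //; exists M].
Qed.

(** A limit measure is a probability and [phi] is bounded, so the limit integral is finite, and
    convergence in the extended reals would give the averages a real limit. *)
Lemma historic_of_average (f : E -> E) x (phi : E -> R) M : continuous phi ->
  (forall y, `|phi y| <= M) ->
  (forall l : R, ~ (average f x phi m @[m --> \oo] --> l)) ->
  historic_behavior f x.
Proof.
move=> phic phiM nocvg [mu /(_ phi phic (ex_intro _ M phiM))].
rewrite (_ : (fun m => _) = fun m => (average f x phi m)%:E); last first.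
  by apply/funext => m; rewrite (integral_orbit_measure f x m.+1 phic phiM).
set I := (\int[mu]_y _)%E => cvI.
have : I \is a fin_num.
  apply: integrable_fin_num => //.
  apply: measurable_bounded_integrable => //.
  - by have mu1 := @probability_setT _ _ _ mu; rewrite [X in (X < _)%E]mu1 ltry.
  - exact: continuous_measurable4.
  - exists M; split; first exact: num_real.
    by move=> K MK y _; exact: le_trans (phiM y) (ltW MK).
move=> Ifin; move: cvI; rewrite -(fineK Ifin) => /fine_cvgP [_].
exact: nocvg.
Qed.

End OrbitMeasures.

Section Statistics.
Context {R : realType}.
Local Notation E := 'rV[R]_4.

Lemma crun_nseq0 (v0 v1 : R) a x : v0 < 1 ->
  crun v0 v1 (nseq a false) x = chull v0 + v0 ^+ a * (x - chull v0).
Proof.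
move=> v01; have fx := chull_fix v01.
elim: a => [|a IH] /=; first by rewrite expr0; ring.
by rewrite IH /cmap exprS -{3}fx; ring.
Qed.

Lemma erun_nseq0 (nu : R) a x : nu < 1 ->
  erun nu (nseq a false) x = - ehull nu + nu ^+ a * (x + ehull nu).
Proof.
move=> n1; have fx := ehull_fix n1.
elim: a => [|a IH] /=; first by rewrite expr0; ring.
by rewrite IH /emap exprS -{3}fx; ring.
Qed.

Lemma quadratic_dominates (C N0 : nat) (ep : R) : 0 < ep -> exists k0, forall k, (k0 <= k)%N ->
  (C * (k + N0) + C)%:R <= ep * ((k + N0) ^ 2).+1%:R.
Proof.
move=> e0; pose q := (C * 2)%:R / ep.
have [n nq] : exists n : nat, q <= n%:R.
  by exists (Num.truncn q).+1; apply/ltW/truncnS_gt.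
exists n.+1 => k nk; rewrite -ler_pdivrMl// mulrC.
apply: (@le_trans _ _ ((k + N0)%:R * q)).
  rewrite /q mulrA ler_wpM2r ?invr_ge0 ?(ltW e0)// -natrM ler_nat.
  by move: nk; clear; nia.
apply: (@le_trans _ _ ((k + N0)%:R * n%:R)); first by rewrite ler_wpM2l.
by rewrite -natrM ler_nat; move: nk; clear; nia.
Qed.

(** * Averages of sequences cut into blocks *)

Section Cesaro.
Variables (len : nat -> nat) (v : nat -> R).
Hypothesis len_gt0 : forall k, (0 < len k)%N.
Let T k := \sum_(i < k) len i.
Let S N := \sum_(i < N) v i.

Lemma block_startS k : T k.+1 = (T k + len k)%N.
Proof. by rewrite /T big_ord_recr. Qed.

Lemma block_sum k : S (T k.+1) - S (T k) = \sum_(i < len k) v (T k + i)%N.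
Proof.
rewrite /S /T big_ord_recr /= -!(big_mkord xpredT).
rewrite (@big_cat_nat _ _ _ (\sum_(0 <= i < k) len i) 0)//= ?leq_addr//.
rewrite addrAC subrr add0r -{1}[X in \sum_(X <= _ < _) _]add0n big_addn addKn.
by rewrite !big_mkord; apply: eq_bigr => i _; rewrite addnC.
Qed.

Lemma blocks_sum_le c a b : (a <= b)%N ->
  (forall k, (a <= k < b)%N -> S (T k.+1) - S (T k) <= c * (len k)%:R) ->
  S (T b) - S (T a) <= c * ((T b)%:R - (T a)%:R).
Proof.
move=> /subnKC <-; elim: (b - a)%N => [|n IH] H; first by rewrite addn0 !subrr mulr0.
have h1 : S (T (a + n)) - S (T a) <= c * ((T (a + n))%:R - (T a)%:R).
  by apply: IH => k /andP[ak kn]; apply: H; rewrite ak addnS ltnS ltnW.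
have := H (a + n)%N; rewrite leq_addr addnS leqnn => /(_ isT) h2.
move: h1 h2; rewrite block_startS natrD !mulrBr mulrDr; lra.
Qed.

Lemma blocks_sum_ge c a b : (a <= b)%N ->
  (forall k, (a <= k < b)%N -> c * (len k)%:R <= S (T k.+1) - S (T k)) ->
  c * ((T b)%:R - (T a)%:R) <= S (T b) - S (T a).
Proof.
move=> /subnKC <-; elim: (b - a)%N => [|n IH] H; first by rewrite addn0 !subrr mulr0.
have h1 : c * ((T (a + n))%:R - (T a)%:R) <= S (T (a + n)) - S (T a).
  by apply: IH => k /andP[ak kn]; apply: H; rewrite ak addnS ltnS ltnW.
have := H (a + n)%N; rewrite leq_addr addnS leqnn => /(_ isT) h2.
move: h1 h2; rewrite block_startS natrD !mulrBr mulrDr; lra.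
Qed.

Lemma block_start_le a b : (a <= b)%N -> (T a <= T b)%N.
Proof.
move=> /subnKC <-; elim: (b - a)%N => [|n IH]; first by rewrite addn0.
by rewrite addnS block_startS (leq_trans IH)// leq_addr.
Qed.

Lemma block_start_ge k : (k <= T k)%N.
Proof.
elim: k => // k IH; rewrite block_startS.
by rewrite (leq_ltn_trans IH)// -[ltnLHS]addn0 ltn_add2l.
Qed.

Lemma block_start_cover N : exists k, (T k <= N)%N /\ (N <= T k.+1)%N.
Proof.
elim: N => [|N [k [k1 k2]]]; first by exists 0%N; rewrite /T big_ord0.
move: k2; rewrite leq_eqVlt => /orP[/eqP ->|k2]; last by exists k; rewrite ltnW.
by exists k.+1; rewrite leqnSn; split => //; rewrite (block_startS k.+1) -addn1 leq_add2l.
Qed.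

(** The growth bound on [len] gives [T k.+1 <= 5 * T k], so an incomplete last block may be counted
    as a complete one. *)
Lemma averages_cvg0 : (forall k, (len k.+1 <= 4 * len k)%N) -> (forall t, 0 <= v t) ->
  (forall ep : R, 0 < ep -> exists k0, forall k, (k0 <= k)%N ->
     \sum_(i < len k) v (T k + i)%N <= ep * (len k)%:R) ->
  (m.+1%:R^-1 * S m.+1) @[m --> \oo] --> (0 : R).
Proof.
move=> len4 v0 small.
have S0 N : 0 <= S N by apply: sumr_ge0.
have Smono a b : (a <= b)%N -> S a <= S b.
  move=> /subnKC <-; elim: (b - a)%N => [|n IH]; first by rewrite addn0.
  by rewrite addnS /S big_ord_recr /= (le_trans IH)// lerDl.
(* The factor [5] turns [ep / 10] into [ep / 2]; the other half pays for the blocks before [k0]. *)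
apply/cvgr0Pnorm_le => ep ep0; have e6 : 0 < ep / 10 by rewrite divr_gt0.
have [k0 k0P] := small _ e6.
pose q := S (T k0) / (ep / 2).
have [n nq] : exists n : nat, q <= n%:R.
  by exists (Num.truncn q).+1; apply/ltW/truncnS_gt.
exists (n + T k0.+2)%N => // m /= nm.
rewrite ger0_norm; last by rewrite mulr_ge0.
rewrite ler_pdivrMl// mulrC.
have [k [Tk1 Tk2]] := block_start_cover m.+1.
have kk0 : (k0 < k)%N.
  rewrite ltnNge; apply/negP => kk; have := @block_start_le k.+1 k0.+2; rewrite ltnS (leqW kk) => /(_ isT).
  by move: nm Tk2; clear -len_gt0; lia.
have h1 : S (T k.+1) - S (T k0) <= ep / 10 * ((T k.+1)%:R - (T k0)%:R).
  apply: blocks_sum_le; first by rewrite ltnW// ltnW.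
  by move=> l /andP[kl _]; rewrite block_sum k0P.
have T5 : (T k.+1 <= 5 * T k)%N.
  case: k {Tk1 Tk2 h1} kk0 => // k _.
  have Tk : T k.+2 = (T k.+1 + len k.+1)%N by exact: block_startS.
  have Tk' : T k.+1 = (T k + len k)%N by exact: block_startS.
  by have := len4 k; rewrite Tk; move: Tk'; clear -len_gt0; lia.
have h2 : S m.+1 <= S (T k.+1) by apply: Smono.
have h3 : (T k.+1)%:R <= 5 * m.+1%:R :> R.
  by rewrite -natrM ler_nat (leq_trans T5)// leq_mul2l.
have h4 : S (T k0) <= ep / 2 * m.+1%:R.
  have : q <= m.+1%:R by rewrite (le_trans nq)// ler_nat; move: nm; clear -len_gt0; lia.
  by rewrite /q ler_pdivrMr ?divr_gt0// mulrC.
have h5 : ep / 10 * (T k.+1)%:R <= ep / 10 * (5 * m.+1%:R) by rewrite ler_pM2l.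
have h6 : 0 <= ep / 10 * (T k0)%:R by rewrite mulr_ge0// ltW.
by move: h1 h2 h4 h5 h6; rewrite mulrBr; lra.
Qed.

(* The blocks numbered from [2 ^ j] to [2 ^ j.+1] occupy at least half of the time
   elapsed, so the averages at their ends depend on the parity of [j]. *)
Lemma alternating_averages_diverge : (forall k, (len k <= len k.+1)%N) ->
  (forall t, `|v t| <= 1) ->
  (exists k0, forall k, (k0 <= k)%N ->
    (~~ odd (trunc_log 2 k) -> S (T k.+1) - S (T k) <= - (3 / 4) * (len k)%:R) /\
    (odd (trunc_log 2 k) -> - (1 / 4) * (len k)%:R <= S (T k.+1) - S (T k))) ->
  forall l : R, ~ ((m.+1%:R^-1 * S m.+1) @[m --> \oo] --> l).
Proof.
move=> lenS v1 [k0 k0P] l cv.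
(* The time before an era is at most its length, so the errors at its two ends add up to at most
   [3/24 = 1/8] of that length: the limit would be at most [-5/8] and at least [-3/8]. *)
have e24 : 0 < 24^-1 :> R by rewrite invr_gt0.
have /cvgrPdist_le /(_ _ e24) [n0 _ n0P] := cv.
have nP n : (n0 < n)%N -> `|l * n%:R - S n| <= 24^-1 * n%:R.
  case: n => // n /n0P /= h; have n1 : 0 < n.+1%:R :> R by rewrite ltr0n.
  rewrite -ler_pdivrMr// -[X in _ / X]gtr0_norm// -normf_div; move: h.
  by rewrite mulrBl mulfK ?gt_eqF// [S _ / _]mulrC.
have len_mono a b : (len a <= len (a + b))%N.
  by elim: b => [|b IH]; [rewrite addn0|rewrite addnS (leq_trans IH)].
have Tdouble a l' : (T a + T l' <= T (a + l'))%N.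
  elim: l' => [|l' IH]; first by rewrite addn0 {2}/T big_ord0 addn0.
  rewrite addnS !block_startS addnA leq_add//.
  by rewrite addnC len_mono.
have era j : (n0 + k0 < 2 ^ j)%N -> exists A B : R, [/\ 0 <= A, A <= B,
    `|l * (A + B) - S (T (2 ^ j.+1))| <= 24^-1 * (A + B),
    `|l * A - S (T (2 ^ j))| <= 24^-1 * A &
    0 < B /\ B = (T (2 ^ j.+1))%:R - (T (2 ^ j))%:R].
  move=> jn; exists (T (2 ^ j))%:R, ((T (2 ^ j.+1))%:R - (T (2 ^ j))%:R).
  have TT : (T (2 ^ j) + T (2 ^ j) <= T (2 ^ j.+1))%N by rewrite expnS mul2n -addnn; exact: Tdouble.
  have Tj := block_start_ge (2 ^ j); have TjS := block_start_ge (2 ^ j.+1).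
  have hle : (T (2 ^ j))%:R + (T (2 ^ j))%:R <= (T (2 ^ j.+1))%:R :> R.
    by rewrite -natrD ler_nat.
  have hpos : 0 < (T (2 ^ j))%:R :> R by rewrite ltr0n; move: jn Tj; clear -len_gt0; lia.
  rewrite [_%:R + (_ - _)]addrC subrK; split => //; first by lra.
  - by apply: nP; move: jn TT Tj; clear -len_gt0; lia.
  - by apply: nP; move: jn Tj; clear -len_gt0; lia.
  - by split => //; lra.
have logE j k : (2 ^ j <= k < 2 ^ j.+1)%N -> trunc_log 2 k = j.
  by move=> jk; apply: trunc_log_eq.
have big j : (j < 2 ^ j)%N by apply: ltn_expl.
pose j := (n0 + k0).*2.
have lelo : l <= - (5 / 8).
  have jbig : (n0 + k0 < 2 ^ j)%N by apply: leq_ltn_trans (big j); rewrite /j; clear -len_gt0; lia.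
  have [A [B [A0 AB h1 h2 [B0 BE]]]] := era j jbig.
  have : S (T (2 ^ j.+1)) - S (T (2 ^ j)) <= - (3 / 4) * B.
    rewrite BE; apply: blocks_sum_le; first by rewrite leq_exp2l.
    move=> k jk; have [|+ _] := k0P k; first by move: jk jbig; clear -len_gt0; lia.
    by apply; rewrite (logE _ _ jk) /j odd_double.
  move: h1 h2; rewrite !ler_norml => /andP[_ h1] /andP[h2 _] h3.
  have : l * B <= (- (5 / 8)) * B by move: h1; rewrite mulrDr; lra.
  by rewrite ler_pM2r.
have lehi : - (3 / 8) <= l.
  have jbig : (n0 + k0 < 2 ^ j.+1)%N by apply: leq_ltn_trans (big j.+1); rewrite /j; clear -len_gt0; lia.
  have [A [B [A0 AB h1 h2 [B0 BE]]]] := era j.+1 jbig.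
  have : - (1 / 4) * B <= S (T (2 ^ j.+2)) - S (T (2 ^ j.+1)).
    rewrite BE; apply: blocks_sum_ge; first by rewrite leq_exp2l.
    move=> k jk; have [|_ +] := k0P k; first by move: jk jbig; clear -len_gt0; lia.
    by apply; rewrite (logE _ _ jk) /= /j odd_double.
  move: h1 h2; rewrite !ler_norml => /andP[h1 _] /andP[_ h2] h3.
  have : (- (3 / 8)) * B <= l * B by move: h1; rewrite mulrDr; lra.
  by rewrite ler_pM2r.
by move: lelo lehi; lra.
Qed.

End Cesaro.

End Statistics.

Section Statistics.
Context {R : realType}.
Local Notation E := 'rV[R]_4.

Lemma sum_three_pieces (g : nat -> R) (C c : R) p q : 0 <= C -> 0 <= c ->
  (forall i, g i <= C) -> (forall i, (p <= i < q)%N -> g i <= c) ->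
  forall n, \sum_(i < n) g i <= c * n%:R + C * (p + (n - q))%:R.
Proof.
move=> C0 c0 gC gc n.
apply: (@le_trans _ _ (c * n%:R + C * (minn n p + (n - q))%:R)); last first.
  by rewrite lerD2l ler_wpM2l// ler_nat leq_add2r geq_minr.
elim: n => [|n IH]; first by rewrite big_ord0 min0n sub0n mulr0 mulr0 addr0.
rewrite big_ord_recr /= -[n.+1%:R]natr1 mulrDr mulr1.
have [np|pn] := ltnP n p.
  have : (minn n p + (n - q)).+1%:R <= (minn n.+1 p + (n.+1 - q))%:R :> R.
    by rewrite ler_nat; move: np; clear; lia.
  rewrite -natr1 => /(ler_wpM2l C0); rewrite mulrDr mulr1.
  by move: IH (gC n) c0; clear; lra.
have [qn|nq] := leqP q n.
  have : (minn n p + (n - q)).+1%:R <= (minn n.+1 p + (n.+1 - q))%:R :> R.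
    by rewrite ler_nat; move: qn pn; clear; lia.
  rewrite -natr1 => /(ler_wpM2l C0); rewrite mulrDr mulr1.
  by move: IH (gC n) c0; clear; lra.
have : (minn n p + (n - q))%:R <= (minn n.+1 p + (n.+1 - q))%:R :> R.
  by rewrite ler_nat; move: nq pn; clear; lia.
move=> /(ler_wpM2l C0); have := gc n; rewrite pn nq => /(_ isT).
by move: IH; clear; lra.
Qed.

Definition sign_sum (s : seq bool) : R := \sum_(b <- s) (if b then 1 else -1).

Lemma sign_sum_cat s1 s2 : sign_sum (s1 ++ s2) = sign_sum s1 + sign_sum s2.
Proof. exact: big_cat. Qed.

Lemma sign_sum_le s : `|sign_sum s| <= (size s)%:R.
Proof.
elim: s => [|b s IH]; first by rewrite /sign_sum big_nil normr0.
rewrite /sign_sum big_cons (le_trans (ler_normD _ _))// /= -natr1 addrC lerD//.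
by case: b; rewrite ?normrN normr1.
Qed.

Lemma sign_sum_nseq L : sign_sum (nseq L false) = - L%:R.
Proof.
elim: L => [|L IH]; first by rewrite /sign_sum big_nil oppr0.
by rewrite -natr1 opprD addrC -IH /sign_sum /= big_cons.
Qed.

Lemma sign_sum_mid_true L : -1 <= sign_sum (mid true L).
Proof.
have h n : sign_sum (flatten (nseq n [:: false; true])) = 0.
  by elim: n => [|n IH]; rewrite /sign_sum /= ?big_nil// !big_cons -/(sign_sum _) IH; lra.
rewrite (sign_sum_cat (flatten _)) h add0r sign_sum_nseq.
by case: (odd L); rewrite ?lexx// oppr0; lra.
Qed.

Lemma crun_chull_dist (v v' : R) q : 0 < v -> v < 2^-1 -> 0 < v' -> v' < 1 ->
  `|crun v v' q 0 - chull v| <= 4.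
Proof.
move=> v0 v2 v'0 v'1; have /andP[c1 c2] := chull_gtN2 v0 v2.
have := crun_hull q v0 v2 v'0 v'1 (x := 0); rewrite ler01 andbT => /(_ ltac:(lra)) /andP[].
by rewrite ler_norml => h1 h2; apply/andP; split; lra.
Qed.

Lemma erun_ehull_dist (v : R) q : 0 < v -> v < 2^-1 -> `|erun v q 0 + ehull v| <= 4.
Proof.
move=> v0 v2; have /andP[c1 c2] := ehull_lt2 v0 v2.
have := erun_hull q (x := 0) v0 ltac:(lra).
rewrite normr0 !ler_norml => /(_ ltac:(lra)) /andP[h1 h2]; apply/andP; split; lra.
Qed.

End Statistics.

Section OrbitStatistics.
Context {R : realType}.
Local Notation E := 'rV[R]_4.
Variable P : consts R.
Variables (f : E -> E) (a1 a2 d wd : R) (g1 g2 : R -> R).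
Variables (w : nat -> seq bool) (e h : nat -> R).
Hypothesis sch : scheme P f a1 a2 d wd g1 g2 w e h.
Local Notation nu := (nu P).
Local Notation u0 := (u0 P).
Local Notation v0 := (v0 P).
Local Notation v1 := (v1 P).
Local Notation ls := (ls P).
Local Notation D := (start_domain P w e).
Local Notation blow := (blow P w e).
Local Notation time := (block_time w).

(** The point of V_0 whose past and future are both coded by [0] only. *)
Definition fixpoint0 : E := pt4 (chull u0) (- ehull nu) (- ehull ls) (chull v0).

(** The next [m] letters [0] determine the unstable coordinates up to [2^-1 ^+ m] and the last [m]
    the stable ones, as the rates [u0], [nu], [ls] and [v0] of the letter [0] are all below
    [1/2]. *)
Lemma orbit_near_fixpoint x k a L c i m : D x -> w k = a ++ nseq L false ++ c ->
  (size a + m <= i)%N -> (i + m <= size a + L)%N ->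
  `|iter (time k + i) f x - fixpoint0| <= blow k + h k + 4 * 2^-1 ^+ m.
Proof.
move=> xD wE ai im.
have [[ls0 lsv0 v0nu nuu0 u02] [u12 u11 v12 v11]] := consts_bounds P.
have u00 := u0_gt0 P; have v00 := v0_gt0 P; have n0 := nu_gt0 P.
have v10 := v1_gt0 P; have u10 := u1_gt0 P.
have ik : (i <= size (w k))%N.
  by rewrite wE !size_cat size_nseq; move: im; clear; lia.
have [[x0 x1 x2 x3] _] := orbit_in_block sch xD ik.
have b0 : 0 <= blow k := le_trans (normr_ge0 _) x0.
have h0 : 0 <= h k := le_trans (normr_ge0 _) x2.
have dE : drop i (w k) = nseq (size a + L - i) false ++ c.
  rewrite wE drop_cat ltnNge (leq_trans _ ai) ?leq_addr//= drop_cat size_nseq.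
  have [iL|Li] := ltnP (i - size a) L; first by rewrite drop_nseq; congr (nseq _ _ ++ _); move: ai iL; clear; lia.
  have -> : (i - size a - L = 0)%N by move: im; clear; lia.
  by rewrite drop0 (_ : size a + L - i = 0)%N//; move: Li ai; clear; lia.
have tE : rev (take i (w k)) = nseq (i - size a) false ++ rev a.
  rewrite wE take_cat ltnNge (leq_trans _ ai) ?leq_addr//= take_cat size_nseq.
  have -> : (if (i - size a < L)%N then take (i - size a) (nseq L false) else
      nseq L false ++ take (i - size a - L) c) = nseq (i - size a) false.
    have [iL|Li] := ltnP (i - size a) L; first by rewrite take_nseq// ltnW.
    have -> : (i - size a - L = 0)%N by move: im; clear; lia.
    by rewrite take0 cats0; congr nseq; move: im ai Li; clear; lia.
  by rewrite rev_cat rev_nseq.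
have pw (th u : R) n : 0 < th -> th < 2^-1 -> `|u| <= 4 -> (m <= n)%N ->
    `|th ^+ n * u| <= 4 * 2^-1 ^+ m.
  move=> th0 th1 u4 mn; rewrite normrM normrX (gtr0_norm th0) mulrC ler_pM ?exprn_ge0 ?(ltW th0)//.
  apply: (@le_trans _ _ (2^-1 ^+ n)); first by rewrite lerXn2r// ?nnegrE ltW.
  by rewrite ler_wiXn2l// ?invr_ge0// invf_le1// ler1n.
have nu2 := nu_lt2 P; have ls2 := ls_lt2 P; have v02 := v0_lt2 P.
have n01 : (m <= size a + L - i)%N by move: im; clear; lia.
have n02 : (m <= i - size a)%N by move: ai; clear; lia.
have tri (z y p r : R) (hh : `|z - y| <= r) (k4 : `|y - p| <= 4 * 2^-1 ^+ m) :
    `|z - p| <= r + 4 * 2^-1 ^+ m.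
  by rewrite -(subrKA y) (le_trans (ler_normD _ _))// lerD.
have m0 : 0 <= 2^-1 ^+ m :> R by rewrite exprn_ge0.
have crunE (v v' : R) n q : v < 2^-1 ->
    crun v v' (nseq n false ++ q) 0 - chull v = v ^+ n * (crun v v' q 0 - chull v).
  by move=> v2; rewrite crun_cat crun_nseq0 1?addrC ?addKr//; move: v2; clear -sch; lra.
have erunE (v : R) n q : v < 2^-1 ->
    erun v (nseq n false ++ q) 0 - - ehull v = v ^+ n * (erun v q 0 + ehull v).
  by move=> v2; rewrite erun_cat erun_nseq0 1?addrC ?addKr//; move: v2; clear -sch; lra.
rewrite dE in x0 x1; rewrite tE in x2 x3.
apply: norm_row_le; first by rewrite !addr_ge0// mulr_ge0.
apply: ord4_ind; rewrite !mxE /=.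
- apply: (@le_trans _ _ (blow k + 4 * 2^-1 ^+ m)); last by rewrite lerD2r lerDl.
  by apply: tri x0 _; rewrite crunE//; apply: pw => //; exact: crun_chull_dist.
- apply: (@le_trans _ _ (blow k + 4 * 2^-1 ^+ m)); last by rewrite lerD2r lerDl.
  by apply: tri x1 _; rewrite erunE//; apply: pw => //; exact: erun_ehull_dist.
- apply: (@le_trans _ _ (h k + 4 * 2^-1 ^+ m)); last by rewrite lerD2r lerDr.
  by apply: tri x2 _; rewrite erunE//; apply: pw => //; exact: erun_ehull_dist.
- apply: (@le_trans _ _ (h k + 4 * 2^-1 ^+ m)); last by rewrite lerD2r lerDr.
  by apply: tri x3 _; rewrite crunE//; apply: pw => //; exact: crun_chull_dist.
Qed.

Lemma average_cvg_fixpoint x (phi : E -> R) M : words_shape (fun=> false) w -> D x ->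
  continuous phi -> (forall y, `|phi y| <= M) ->
  average f x phi m @[m --> \oo] --> phi fixpoint0.
Proof.
move=> [H [N0 [N00 wS]]] xD phic phiM.
have M0 : 0 <= M := le_trans (normr_ge0 _) (phiM 0).
pose v t := `|phi (iter t f x) - phi fixpoint0|.
have v2M t : v t <= 2 * M.
  rewrite /v (le_trans (ler_normB _ _))//; have := phiM (iter t f x); have := phiM fixpoint0.
  by clear -sch; lra.
suff : (m.+1%:R^-1 * \sum_(i < m.+1) v i) @[m --> \oo] --> (0 : R).
  move=> /cvgr0Pnorm_le cv; apply/cvgrPdist_le => ep ep0.
  have := cv _ ep0; apply: filterS => m /= hm; rewrite distrC; apply: le_trans hm.
  have -> : average f x phi m - phi fixpoint0 =
      m.+1%:R^-1 * \sum_(i < m.+1) (phi (iter i f x) - phi fixpoint0).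
    rewrite sumrB big_const_ord iter_addr_0 mulrBr -[phi _ *+ _]mulr_natl mulrA mulVf ?mul1r ?pnatr_eq0//.
  rewrite !normrM ler_wpM2l//; apply: le_trans (ler_norm_sum _ _ _) _.
  exact: ler_norm.
apply: (@averages_cvg0 R (fun i => (size (w i)).+1) v) => //.
- move=> k; have [-> _] := wS k; have [-> _] := wS k.+1.
  by move: N00; clear -sch; rewrite -!mulnn; nia.
- by move=> t; exact: normr_ge0.
move=> ep ep0; have ep2 : 0 < ep / 2 by rewrite divr_gt0.
have /cvgrPdist_le /(_ _ ep2) := phic fixpoint0.
move=> /nbhs_ballP [r /= r0 rP].
have r2 : 0 < r / 4 by rewrite divr_gt0.
have [m mP] := @expr_lt_eps R 2^-1 (r / 16) ltac:(by rewrite invr_ge0) ltac:(by rewrite invf_lt1// ltr1n) ltac:(by rewrite divr_gt0).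
have /cvgrPdist_le /(_ _ r2) [kb _ kbP] := sc_blow0 sch.
have /cvgrPdist_le /(_ _ r2) [kh _ khP] := sc_h0 sch.
(* Only the times in the two ends of a block, or within [m] letters of them, are bad; each costs at
   most [2 * M], and there are O(k) of them in a block of length about k^2. *)
have [C HC] : exists C : nat, 2 * M * (H + 2 * m + 1)%:R <= C%:R.
  by exists (Num.truncn (2 * M * (H + 2 * m + 1)%:R)).+1; apply/ltW/truncnS_gt.
have [kq kqP] := quadratic_dominates C N0 ep2.
exists (maxn kq (maxn kb kh)) => k; rewrite !geq_max => /and3P[qk bk hk].
have [sE [a [c [L [wE ac]]]]] := wS k.
rewrite mid_false in wE.
have wsz : size (w k) = (size a + L + size c)%N by rewrite wE !size_cat size_nseq addnA.
have := @sum_three_pieces R (fun i => v (time k + i)%N) (2 * M) (ep / 2) (size a + m)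
  ((size a + L).+1 - m) ltac:(by rewrite mulr_ge0) (ltW ep2) (fun i => v2M _).
move=> /(_ _ (size (w k)).+1) h1.
apply: le_trans (h1 _) _.
  move=> i /andP[ai iL]; rewrite /v distrC; apply: rP.
  rewrite -ball_normE /= distrC.
  apply: le_lt_trans (orbit_near_fixpoint (m := m) xD wE ai _) _.
    by move: iL; clear -sch; lia.
  have := kbP _ bk; have := khP _ hk; have := mP _ (leqnn m).
  rewrite /= !sub0r !normrN => q1 /(le_trans (ler_norm _)) q2 /(le_trans (ler_norm _)) q3.
  by move: q1 q2 q3 r0; clear -sch; lra.
have := kqP k qk; rewrite -sE => h2.
have : 2 * M * (size a + m + ((size (w k)).+1 - ((size a + L).+1 - m)))%:R <= (C * (k + N0) + C)%:R.
  apply: (@le_trans _ _ (2 * M * (((H + 2 * m + 1) * (k + N0) + (H + 2 * m + 1))%N)%:R)).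
    by rewrite ler_wpM2l ?mulr_ge0// ler_nat wsz; move: ac N00; clear -sch; nia.
  rewrite -!mulnSr natrM mulrA natrM ler_wpM2r//.
by move: h2; clear -sch; lra.
Qed.

Lemma orbit_historic x : words_shape (fun k => odd (trunc_log 2 k)) w -> D x ->
  historic_behavior f x.
Proof.
move=> [H [N0 [N00 wS]]] xD.
have k0 : 0 < 1 - 2 * nu by have := nu_lt2 P; lra.
(* In the strips [|y_u| >= 1 - 2 * nu], so [clip] turns [y_u] into the sign [1] or [-1] of the
   letter. Its average is close to [-1] over a word of 0's and close to [0] over a word of
   (01)'s. *)
pose clip (y : R) : R := Num.max (-1) (Num.min (y / (1 - 2 * nu)) 1).
pose phi (z : E) := clip (z 0 i1).
have clip1 y : `|clip y| <= 1.
  by rewrite ler_norml /clip le_max lexx /= ge_max ge_min lexx orbT andbT; lra.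
have clip_hi y : 1 - 2 * nu <= y -> clip y = 1.
  move=> hy; rewrite /clip min_r; last by rewrite ler_pdivlMr// mul1r.
  by rewrite max_r//; lra.
have clip_lo y : y <= - (1 - 2 * nu) -> clip y = -1.
  move=> hy; have h1 : y / (1 - 2 * nu) <= -1 by rewrite ler_pdivrMr// mulN1r.
  by rewrite /clip min_l; [rewrite max_l|lra].
apply: (@historic_of_average _ f x phi 1).
- have divc : continuous (fun y : R => y / (1 - 2 * nu)).
    by move=> y; exact: (continuousM (@cvg_id _ _) (@cst_continuous _ _ _ y)).
  have c1 (z : E) : {for z, continuous (fun z : E => z 0 i1 / (1 - 2 * nu))}.
    exact: (continuous_comp (@coord_continuous _ _ _ 0 i1 z) (divc _)).
  have c2 (z : E) : {for z, continuous (fun z : E => Num.min (z 0 i1 / (1 - 2 * nu)) 1)}.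
    exact: (continuous_min (c1 z) (@cst_continuous _ _ _ z)).
  by move=> z; exact: (continuous_max (@cst_continuous _ _ _ z) (c2 z)).
- by move=> y; exact: clip1.
apply: (@alternating_averages_diverge R (fun i => (size (w i)).+1) (fun t => phi (iter t f x))) => //.
- by move=> k; rewrite ltnS ltnW//; exact: sc_size sch k.
- by move=> t; exact: clip1.
have [kq kqP] := @quadratic_dominates R (2 * H + 2) N0 (1 / 4) ltac:(by rewrite divr_gt0).
exists kq => k qk; have [sE [a [c [L [wE ac]]]]] := wS k.
have bsum : \sum_(i < (size (w k)).+1) phi (iter (time k + i) f x) =
    sign_sum (w k) + phi (iter (time k + size (w k)) f x).
  rewrite big_ord_recr /=; congr (_ + _).
  rewrite /sign_sum (big_nth false) big_mkord; apply: eq_bigr => i _.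
  have := orbit_sign sch xD (ltn_ord i); rewrite /phi.
  by case: ifP => _; [exact: clip_hi|exact: clip_lo].
have -> := @block_sum R (fun i => (size (w i)).+1) (fun t => phi (iter t f x)) k.
rewrite -/(time k) bsum.
have := kqP k qk; rewrite -sE => h2.
have /ler_normlP[h3 h3'] := clip1 ((iter (time k + size (w k)) f x) 0 i1).
rewrite -/(phi _) in h3 h3'.
have := sign_sum_le (R := R) a; rewrite ler_norml => /andP[ha ha'].
have := sign_sum_le (R := R) c; rewrite ler_norml => /andP[hc hc'].
have ac' : (size a + size c)%:R <= (H * (k + N0))%:R :> R by rewrite ler_nat.
have kN : 0 <= (H * (k + N0))%:R :> R by [].
have wsz : size (w k) = (size a + L + size c)%N by rewrite wE (size_cat a) (size_cat (mid _ _)) size_mid addnA.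
have {}wsz : (size (w k))%:R = (size a)%:R + L%:R + (size c)%:R :> R by rewrite wsz !natrD.
have ss : sign_sum (w k) = sign_sum a + sign_sum (mid (odd (trunc_log 2 k)) L) + sign_sum c :> R.
  by rewrite wE (sign_sum_cat a) (sign_sum_cat (mid _ _)) addrA.
have {}h2 : 2 * (H * (k + N0))%:R + 2 <= 1 / 4 * (size (w k)).+1%:R :> R.
  by apply: le_trans h2; rewrite -natrM -natrD ler_nat; clear; nia.
rewrite natrD in ac'; rewrite -natr1 in h2 *.
split=> [/negbTE o|o]; rewrite ss o.
  rewrite mid_false sign_sum_nseq; move: ha' hc' ac' h2 h3 h3' kN wsz; clear -sch; lra.
have := @sign_sum_mid_true R L; move: ha hc ac' h2 h3 h3' kN wsz; clear -sch; lra.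
Qed.

End OrbitStatistics.

(** * The saddle fixed point *)

Section Saddle.
Context {R : realType}.

Lemma jacobian_locally_affine n m (f : 'rV[R]_n -> 'rV[R]_m) x (A : 'M[R]_(n, m)) :
  (\forall h \near (0 : 'rV[R]_n), f (h + x) = f x + h *m A) -> jacobian f x = A.
Proof.
move=> fA; pose L : {linear 'rV[R]_n -> 'rV[R]_m} := mulmxr A.
have Lc : continuous L.
  apply/linear_bounded_continuous/linear_boundedP; near=> M => h.
  apply: (@le_trans _ _ ((\sum_i \sum_j `|A i j|) * `|h|)); last by rewrite ler_wpM2r.
  apply: norm_row_le => [|j].
    by rewrite mulr_ge0// sumr_ge0// => i _; rewrite sumr_ge0.
  rewrite mxE (le_trans (ler_norm_sum _ _ _))// mulr_suml ler_sum// => i _.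
  rewrite normrM mulrC ler_pM ?norm_coord_le//.
  by rewrite (bigD1 j)//= lerDl sumr_ge0.
have fL : is_diff x f L.
  apply: is_diff_eps => // e e0; apply: filterS fA => h ->.
  by rewrite subrr normr0 mulr_ge0// ltW.
apply/row_matrixP => i; rewrite rowE mul_rV_lin1 diff_val /=.
by rewrite -rowE.
Unshelve. all: by end_near. Qed.

Lemma eigenvalue_diag (F : fieldType) n (v : 'rV[F]_n) a :
  reflect (exists j, a = v 0 j) (eigenvalue (diag_mx v) a).
Proof.
apply: (iffP eigenvalueP) => [[u]|[j ->]].
  rewrite mul_mx_diag => uE /rV0Pn [j uj]; exists j.
  by move/matrixP: uE => /(_ 0 j); rewrite !mxE mulrC => /(mulIf uj).
exists (delta_mx 0 j); last by apply/rV0Pn; exists j; rewrite mxE !eqxx oner_eq0.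
rewrite mul_mx_diag; apply/rowP => k; rewrite !mxE eqxx /=.
by case: eqVneq => [->|_]; rewrite ?mulr1 ?mul1r ?mulr0 ?mul0r.
Qed.

Lemma norm_real_complex (x : R) : `|real_complex R x| = real_complex R `|x|.
Proof. by rewrite normc_def /= expr0n addr0 sqrtr_sqr. Qed.

Lemma saddle_diag (f : 'rV[R]_4 -> 'rV[R]_4) p (v : 'rV[R]_4) i j :
  f p = p -> jacobian f p = diag_mx v -> (forall k, `|v 0 k| != 1) ->
  `|v 0 i| < 1 -> 1 < `|v 0 j| -> saddle f p 1.
Proof.
move=> fp fA v1 vi vj; rewrite /saddle (_ : iter 1 f = f) ?fA ?map_diag_mx; last exact/funext.
have ev k : eigenvalue (diag_mx (map_mx (real_complex R) v)) (real_complex R (v 0 k)).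
  by apply/eigenvalue_diag; exists k; rewrite mxE.
split.
- by split => // k; case: k => [|[|k]].
- move=> z /eigenvalue_diag[k ->]; rewrite mxE norm_real_complex.
  by rewrite -(rmorph1 (real_complex R)) (inj_eq (fmorph_inj _)).
- by exists (real_complex R (v 0 i)) => //; rewrite norm_real_complex ltcR.
- by exists (real_complex R (v 0 j)) => //; rewrite norm_real_complex ltcR.
Qed.

(** Near this point the map is affine, with diagonal linear part [(u0^-1, nu^-1, ls, v0)]. *)
Lemma saddle_fixpoint0 (P : consts R) f : horseshoe P f -> saddle f (fixpoint0 P) 1.
Proof.
move=> hf; have [[ls0 lsv0 v0nu nuu0 u02] _] := consts_bounds P.
have u00 := u0_gt0 P; have v00 := v0_gt0 P; have n0 := nu_gt0 P.
have m0 := margin_gt0 P.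
have hull v : v <= u0 P -> `|ehull v| <= 2 - margin P.
  move=> vu; rewrite /margin /chull /ehull opprD opprK addrA subrr add0r.
  by rewrite ger0_norm ?invr_ge0 ?lef_pV2 ?posrE; lra.
have hullN v : v <= u0 P -> `|- ehull v| <= 2 - margin P by rewrite normrN; exact: hull.
pose A : 'rV[R]_4 := pt4 (u0 P)^-1 (nu P)^-1 (ls P) (v0 P).
have near2 (a b h : R) : `|a| <= 2 - margin P -> `|h| <= margin P -> `|a + h| <= 2.
  by move=> ha hh; have := ler_normD a h; lra.
(* [ls] is smaller than [u0] and [nu], so this radius stays within [margin P] after a division by
   either. *)
have fA (h : 'rV[R]_4) : `|h| <= ls P * margin P ->
    f (h + fixpoint0 P) = fixpoint0 P + h *m diag_mx A.
  move=> hr.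
  have hc k : `|h 0 k| <= ls P * margin P := le_trans (norm_coord_le _ _) hr.
  have hm k : `|h 0 k| <= margin P.
    by apply: le_trans (hc k) _; rewrite ler_piMl// ?ltW// ls_lt1.
  have hv (v : R) k : ls P <= v -> `|v^-1 * h 0 k| <= margin P.
    move=> lv; have v_gt0 : 0 < v := lt_le_trans ls0 lv.
    rewrite normrM normfV (gtr0_norm v_gt0) ler_pdivrMl//.
    by apply: le_trans (hc k) _; rewrite ler_wpM2r// ltW.
  have -> : h + fixpoint0 P = pt4
      (cmap (u0 P) (u1 P) false (chull (u0 P) + (u0 P)^-1 * h 0 i0))
      (emap (nu P) false (- ehull (nu P) + (nu P)^-1 * h 0 i1))
      (- ehull (ls P) + h 0 i2) (chull (v0 P) + h 0 i3).
    apply/rowP; apply: ord4_ind; rewrite !mxE /= /cmap /emap.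
    - by rewrite -{1}(@chull_fix _ (u0 P)); [field; rewrite gt_eqF|lra].
    - by rewrite -{1}(@ehull_fix _ (nu P)); [field; rewrite gt_eqF|exact: nu_lt1].
    - by rewrite addrC.
    - by rewrite addrC.
  rewrite hf; last 4 first.
  - by apply: (near2 _ 0) => //; [exact: hullN|apply: hv; lra].
  - by apply: (near2 _ 0) => //; [apply: hullN; lra|apply: hv; lra].
  - by apply: (near2 _ 0) => //; apply: hullN; lra.
  - by apply: (near2 _ 0) => //; apply: hullN; lra.
  rewrite mul_mx_diag; apply/rowP; apply: ord4_ind; rewrite !mxE /= /cmap /emap.
  - by rewrite mulrC.
  - by rewrite mulrC.
  - rewrite -{2}(@ehull_fix _ (ls P)) ?ls_lt1//; ring.
  - rewrite -{2}(@chull_fix _ (v0 P)); [ring|lra].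
have fp : f (fixpoint0 P) = fixpoint0 P.
  by have := fA 0; rewrite normr0 add0r mul0mx addr0; apply; rewrite mulr_ge0// ltW.
have ui : 1 < `|A 0 i0| by rewrite mxE /= normfV gtr0_norm// invf_gt1//; lra.
apply: (@saddle_diag f _ A i2 i0) => //.
- apply: jacobian_locally_affine; rewrite fp.
  apply/nbhs_ballP; exists (ls P * margin P) => /=; first by rewrite mulr_gt0.
  move=> h; rewrite -ball_normE /= sub0r normrN => hr; apply: fA; exact: ltW.
- apply: ord4_ind.
  + by rewrite gt_eqF.
  + by rewrite mxE /= normfV gtr0_norm// gt_eqF// invf_gt1//; lra.
  + by rewrite mxE /= gtr0_norm// lt_eqF//; lra.
  + by rewrite mxE /= gtr0_norm// lt_eqF//; lra.
- by rewrite mxE /= gtr0_norm//; lra.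
Qed.

End Saddle.

(** * Approximation of the diffeomorphism *)

Section Perturbation.
Context {R : realType}.
Local Notation E := 'rV[R]_4.
Variables (P : consts R) (F : E -> E) (a1 a2 d : R) (r : nat).
Hypotheses (a10 : 0 <= a1) (a20 : 0 <= a2) (d0 : 0 < d) (d1 : d < 1 - 2 * nu P).
Hypotheses (Fr : Ck_diffeo r F) (r0 : (0 < r)%N) (Fh : horseshoe P F).
Hypothesis Ff : forall xu yu xs ys : R, `|xu| <= d -> `|yu| <= d -> `|xs| <= 2 -> `|ys| <= 2 ->
  F (pt4 xu yu xs ys) = pt4 (- xu ^+ 2 + li P * (xs - ehull (ls P)) + 1)
    (- a1 * yu ^+ 2 + (mi P)^-1 * (ys - 1) + ehull (nu P)) (a2 * xu) yu.

(** The perturbation lives where [|y_u| <= d], while [|y_u| >= 1 - 2 * nu > d] in the strips, so the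
    horseshoe formulas survive. The fold formula is used only up to [d / 2], where the cutoffs in
    [x_u] and [y_u] equal [1]. *)
Lemma scheme_approximation ty ep : 0 < ep -> exists f, [/\ Ck_diffeo r f,
  (Ck_dist r f F <= ep%:E)%E & exists wd g1 g2 w e h,
    scheme P f a1 a2 (d / 2) wd g1 g2 w e h /\ words_shape ty w].
Proof.
move=> ep0; have ls0 := ls_gt0 P; have ls2 := ls_lt2 P.
have /andP[h1 h2] := ehull_lt2 ls0 ls2.
pose wd := Num.min ((2 - ehull (ls P)) / 4) (1 / 8).
have wd0 : 0 < wd by rewrite lt_min !divr_gt0 ?subr_gt0.
have wd1 : wd <= (2 - ehull (ls P)) / 4 by rewrite ge_min lexx.
have wd2 : wd <= 1 / 8 by rewrite ge_min lexx orbT.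
have [eta eta0 approx] := @local_perturbation R (li P) (mi P)^-1 (ehull (ls P))
  (ehull (nu P)) a1 a2 d wd r F (li_gt0 P) ltac:(by rewrite invr_gt0 mi_gt0) d0 wd0
  ltac:(lra) ltac:(lra) ltac:(lra) r0 Fr Ff ep ep0.
have d20 : 0 < d / 2 by rewrite divr_gt0.
have [D1 [D2 [w [e [h [[J1 J2 supp] sch ws]]]]]] :=
  @scheme_exists R P a1 a2 (d / 2) wd r ty a10 a20 d20 wd0 eta eta0.
have [f [fr fF feq ff]] := approx D1 D2 J1 J2 supp.
exists f; split => //; exists wd, (D1 0%N), (D2 0%N), w, e, h; split => //.
apply: sch; last exact: ff.
move=> b x y s t x2 y2 s2 t2.
rewrite feq ?Fh// mxE /= /emap.
have := d1; have n0 := nu_gt0 P; move: y2; rewrite ler_norml => /andP[y2 y2'] d1'.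
have : -2 * nu P <= nu P * y by rewrite mulrC ler_pM2l.
have : nu P * y <= 2 * nu P by rewrite mulrC ler_pM2r.
rewrite ltr_normr; case: (b) => k1 k2; apply/orP; [left|right]; lra.
Qed.

End Perturbation.

Section Sequences.
Context {R : realType}.
Local Notation E := 'rV[R]_4.

Lemma Ck_diffeo_continuous r (f : E -> E) : Ck_diffeo r f -> continuous f.
Proof. by move=> [[_ fc] _]; exact: (fc [::]). Qed.

Lemma Ck_diffeo_inj r (f : E -> E) : Ck_diffeo r f -> injective f.
Proof. by move=> [_ [g [fK _ _]]]; exact: can_inj fK. Qed.

Lemma Cinfty_diffeo_Ck r (f : E -> E) : Cinfty_diffeo f -> Ck_diffeo r f.
Proof. by move=> [fC [g [fK gK gC]]]; split => //; exists g. Qed.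

Lemma Ck_approximation r (F : E -> E) (Q : (E -> E) -> Prop) :
  (forall ep : R, 0 < ep -> exists f, (Ck_dist r f F <= ep%:E)%E /\ Q f) ->
  exists F_ : nat -> E -> E, Ck_cvg r F_ F /\ forall n, Q (F_ n).
Proof.
move=> H; have /choice[F_ F_P] : forall n : nat, exists f,
    (Ck_dist r f F <= (n.+1%:R^-1)%:E)%E /\ Q f by move=> n; apply: H.
exists F_; split => [|n]; last by have [] := F_P n.
apply: (@squeeze_cvge _ _ _ _ (fun=> 0%:E) _ (fun n : nat => (n.+1%:R^-1)%:E)).
- apply: nearW => n; have [-> _] := F_P n; rewrite andbT.
  apply: (@le_trans _ _ `|F_ n 0 - F 0|%:E); first by rewrite lee_fin.
  by apply: ereal_sup_ubound; exists [::], 0.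
- exact: cvg_cst.
- apply/fine_cvgP; split; first exact: nearW.
  exact: cvg_harmonic.
Qed.

End Sequences.

Theorem theorem1p1 (R : realType)
  (lcu0 lcu1 lu lcs0 lcs1 ls delta a1 a2 : R)
  (hcu1 : 1 < lcu1) (hcu12 : lcu1 < 2) (hcu0 : 2 < lcu0) (hu : lcu0 < lu)
  (hs : 0 < ls) (hcs0 : ls < lcs0) (hcs02 : lcs0 < 1 / 2)
  (hcs1 : 1 / 2 < lcs1) (hcs11 : lcs1 < 1)
  (hcu : 1 < lcu0^-1 + lcu1^-1)
  (hcs : 1 < lcs0 + lcs1)
  (hcsu : lcs0 * lcs1 * lu ^+ 2 < 1)
  (hcs0u1 : 1 < lcs0 * lu ^+ 2) (hcs0u2 : lcs0 * lu ^+ 2 < 2)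
  (hdelta0 : 0 < delta) (hdelta : delta < 1 - 2 * lu^-1)
  (ha1 : 1 / (2 * (1 - 2 * lu^-1)) < a1)
  (ha20 : 0 < a2) (ha2 : a2 < 2 * ls / delta) :
  exists M : R, 0 < M /\
  forall lstar mustar : R, M < lstar -> M < mustar ->
  lstar^-1 < (- 2 + lcu0^-1 + lcu1^-1 * a_u lu) / 4 ->
  mustar^-1 < (- 2 + lcs1 + lcs1 * a_s ls) / 4 ->
  forall F : 'rV[R]_4 -> 'rV[R]_4,
  Cinfty_diffeo F ->
  (forall xu yu xs ys, V0 lcu0 lu (xu, yu) -> box2 (xs, ys) ->
     F (pt4 xu yu xs ys) =
     pt4 (lcu0 * (xu + 1)) (lu * (yu + 1)) (ls * xs - 1) (lcs0 * ys - 1)) ->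
  (forall xu yu xs ys, V1 lcu1 lu (xu, yu) -> box2 (xs, ys) ->
     F (pt4 xu yu xs ys) =
     pt4 (lcu1 * (xu - 1) + 1) (lu * (yu - 1))
         (ls * xs + 1) (lcs1 * (ys - 1) + 1)) ->
  (forall xu yu xs ys, Vstar delta (xu, yu) -> box2 (xs, ys) ->
     F (pt4 xu yu xs ys) =
     pt4 (- xu ^+ 2 + lstar^-1 * (xs - a_s ls) + 1)
         (- a1 * yu ^+ 2 + mustar * (ys - 1) + a_u lu)
         (a2 * xu) yu) ->
  forall r : nat, (1 <= r)%N ->
  exists F_ G_ : nat -> 'rV[R]_4 -> 'rV[R]_4,
    [/\ forall n, Ck_diffeo r (F_ n) /\ Ck_diffeo r (G_ n),
        Ck_cvg r F_ F /\ Ck_cvg r G_ F,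
        forall n, exists D : set 'rV[R]_4,
          contracting_wandering_domain (F_ n) D /\
          (forall x, D x -> historic_behavior (F_ n) x) &
        forall n, exists D : set 'rV[R]_4,
          contracting_wandering_domain (G_ n) D /\
          exists p k, saddle (G_ n) p k /\
            forall x, D x ->
              weak_cvg (empirical (G_ n) x) (periodic_measure (G_ n) p k)].
Proof.
exists 1; split => // lstar mustar l1 m1 _ _ F FC F0 F1 Fs r r1.
have lcu00 : 0 < lcu0 by lra.
have lcu10 : 0 < lcu1 by lra.
have lu0 : 0 < lu by lra.
have lst0 : 0 < lstar by lra.
have mst0 : 0 < mustar by lra.
have luV : lu^-1 * lu = 1 by rewrite mulVf// gt_eqF.
have nu0 : 0 < lu^-1 by rewrite invr_gt0.
(* From [lcs0 * lu ^+ 2 < 2 < lu]. *)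
have v0nu : lcs0 < lu^-1.
  rewrite -(ltr_pM2r lu0) luV -(ltr_pM2r lu0) mul1r -mulrA -expr2; lra.
have v01nu : lcs0 * lcs1 < lu^-1 ^+ 2.
  by rewrite exprVn -[ltRHS]mul1r ltr_pdivlMr// exprn_gt0.
have nuu0 : lu^-1 < lcu0^-1 by rewrite ltf_pV2 ?posrE.
have u02 : lcu0^-1 < 2^-1 by rewrite ltf_pV2 ?posrE.
have u11 : lcu1^-1 < 1 by rewrite invf_lt1.
pose P := @Consts R lcu0^-1 lcu1^-1 lcs0 lcs1 ls lu^-1 lstar^-1 mustar^-1
  hs hcs0 v0nu nuu0 u02 u11 hcs11 hcu hcs v01nu
  ltac:(by rewrite invr_gt0) ltac:(by rewrite invr_gt0).
have nu2 := nu_lt2 P; rewrite /= in nu2.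
have a10 : 0 <= a1.
  by apply/ltW; apply: le_lt_trans ha1; rewrite divr_ge0//; lra.
have asE : ehull ls = a_s ls by rewrite /ehull /a_s div1r.
have auE : ehull lu^-1 = a_u lu by rewrite /ehull /a_u div1r.
have u00 : 0 < lcu0^-1 by rewrite invr_gt0.
have u10 : 0 < lcu1^-1 by rewrite invr_gt0.
have boxP (s t : R) : `|s| <= 2 -> `|t| <= 2 -> box2 (s, t).
  by rewrite !ler_norml /box2 => ? ?; split; rewrite /= in_itv.
have between (u v : R) : 0 < u -> `|v| <= 2 -> u * v <= 2 * u /\ - (2 * u) <= u * v.
  move=> u_gt0; rewrite ler_norml => /andP[v1' v2'].
  by rewrite [u * v]mulrC !(ler_pM2r u_gt0) -mulNr ler_pM2r.
have Fh : horseshoe P F.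
  move=> b x y s t x2 y2 s2 t2; rewrite /cmap /emap /P /=.
  have sb := boxP _ _ s2 t2.
  have [x_1 x_2] := between _ _ u00 x2; have [y_1 y_2] := between _ _ nu0 y2.
  have [x_3 x_4] := between _ _ u10 x2.
  case: b.
  - rewrite F1//; last first.
      split; rewrite /= in_itv /=; apply/andP; move: x_3 x_4 y_1 y_2; clear; split; lra.
    by congr pt4; field; rewrite gt_eqF.
  - rewrite F0//; last first.
      split; rewrite /= in_itv /=; apply/andP; move: x_1 x_2 y_1 y_2; clear; split; lra.
    by congr pt4; field; rewrite gt_eqF.
have Ff (xu yu xs ys : R) : `|xu| <= delta -> `|yu| <= delta -> `|xs| <= 2 -> `|ys| <= 2 ->
  F (pt4 xu yu xs ys) = pt4 (- xu ^+ 2 + li P * (xs - ehull ls) + 1)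
    (- a1 * yu ^+ 2 + (mi P)^-1 * (ys - 1) + ehull lu^-1) (a2 * xu) yu.
  move=> xd yd s2 t2; rewrite Fs ?asE ?auE ?invrK//; last exact: boxP.
  by move: xd yd; rewrite !ler_norml => xd yd; split; rewrite /= in_itv.
have approx := @scheme_approximation R P F a1 a2 delta r a10 (ltW ha20) hdelta0 hdelta
  (Cinfty_diffeo_Ck r FC) r1 Fh Ff.
pose Q ty f := Ck_diffeo r f /\ exists wd g1 g2 w e h,
    scheme P f a1 a2 (delta / 2) wd g1 g2 w e h /\ words_shape ty w.
have approxQ ty (ep : R) : 0 < ep -> exists f, (Ck_dist r f F <= ep%:E)%E /\ Q ty f.
  by move=> /(approx ty)[f [fr fF fs]]; exists f.
have [F_ [F_cvg F_P]] := Ck_approximation (approxQ (fun k => odd (trunc_log 2 k))).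
have [G_ [G_cvg G_P]] := Ck_approximation (approxQ (fun=> false)).
have wander f wd g1 g2 w e h : Ck_diffeo r f ->
    scheme P f a1 a2 (delta / 2) wd g1 g2 w e h ->
    contracting_wandering_domain f (start_domain P w e).
  move=> fr sch; apply: (contracting_wandering sch).
    exact: Ck_diffeo_continuous fr.
  exact: Ck_diffeo_inj fr.
exists F_, G_; split => // n.
- by split; [have [] := F_P n|have [] := G_P n].
- have [fr [wd [g1 [g2 [w [e [h [sch ws]]]]]]]] := F_P n.
  exists (start_domain P w e); split; first exact: wander fr sch.
  by move=> x xD; exact: (orbit_historic sch ws xD).
- have [fr [wd [g1 [g2 [w [e [h [sch ws]]]]]]]] := G_P n.
  exists (start_domain P w e); split; first exact: wander fr sch.
  exists (fixpoint0 P), 1%N; split; first exact: saddle_fixpoint0 (sc_horse sch).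
  move=> x xD; apply: weak_cvg_fixed => phi phic [M phiM].
  exact: (average_cvg_fixpoint sch ws xD phic phiM).
Qed.
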